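(* Let $n>1$ and let $F$ satisfy the standing assumptions below, the smallness-of-third-derivatives condition (SC) with $C_1^2<2/\sqrt n$, and the symmetry condition (SYM). Let $T>0$, $M>0$, $R>0$, and let $u:\mathbb{R}^n\times[0,T]\to\mathbb{R}$ be a $C^3$ solution of (AMCF) with $|u|\le M$. Then there exist constants $A>0$, $P>F(-\phi^0)$ and $k>0$ depending only on $F$ (and $n$), and $T'\in(0,T]$, $q>1$, $r>1$ depending only on $F$, $n$, $M$ (and $R$), such that $$F(Du-\phi^0)(x,t)\le\max\left\{t^{q/2}\exp\!\left(\frac{Aq\,(|u(x,t)|-2M)^2}{4t}\right)\big(R^2-2kt-|x|^2\big)^{-r},\ P\right\}$$ for all $0<t\le T'$ and all $x\in\mathbb{R}^n$ with $|x|^2<R^2-2kt$.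
   Context: Let $V\cong\mathbb{R}^{n+1}$ with basis $e_0,\dots,e_n$ and $V^*$ with dual basis $\phi^0,\dots,\phi^n$. Standing assumptions on $F$: $F:V^*\to\mathbb{R}$ is positive (on $V^*\setminus\{0\}$), convex, $C^3$ on $V^*\setminus\{0\}$, homogeneous of degree one, and each sublevel set $\{F\le\lambda\}$ is uniformly convex. $\Sigma_\lambda=\{F=\lambda\}$; $p$ is tangent to $\Sigma_{F(\nu)}$ at $\nu$ iff $DF|_\nu(p)=0$. $D^kF|_\nu$ is the $k$-th derivative of $F$ at $\nu$ as a symmetric $k$-linear form. For $u(y,t)$, $y\in\mathbb{R}^n$, write $u_i=\partial u/\partial y^i$, $u_{ij}=\partial^2u/\partial y^i\partial y^j$, $Du=\sum_{i=1}^n u_i\phi^i$. (AMCF): $u_t=\sum_{i,j=1}^n F(\nu)D^2F|_\nu(\phi^i,\phi^j)u_{ij}$, $\nu=Du-\phi^0$. (SC) with constant $C_1>0$: for every $\nu\ne0$ and all $p,q,r$ tangent to $\Sigma_{F(\nu)}$ at $\nu$, $F(\nu)^2D^3F|_\nu(p,q,r)\le C_1[F(\nu)^3D^2F|_\nu(p,p)D^2F|_\nu(q,q)D^2F|_\nu(r,r)]^{1/2}$. (SYM): $F(p+\phi^0)=F(p-\phi^0)$ for all $p\in\operatorname{span}\{\phi^1,\dots,\phi^n\}$. *)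

(* Defs.v *)
From HB Require Import structures.
From mathcomp Require Import all_boot all_order all_algebra.
From mathcomp Require Import all_classical all_reals all_analysis.
Set Implicit Arguments. Unset Strict Implicit. Unset Printing Implicit Defensive.
Import Order.TTheory GRing.Theory Num.Theory.
Import numFieldNormedType.Exports.
Local Open Scope classical_set_scope.
Local Open Scope ring_scope.

Section Defs.
Variable R : realType.

(* standard basis vector of 'rV_m (phi^i for V^*, e_i for R^n) *)
Definition bvec (m : nat) (i : 'I_m) : 'rV[R]_m := \row_j (j == i)%:R.

Definition enorm (m : nat) (p : 'rV[R]_m) : R := Num.sqrt (\sum_j p 0 j ^+ 2).

Definition iterD (V : normedModType R) (vs : seq V) (f : V -> R) : V -> R :=
  foldr (fun v g => 'D_v g) f vs.

Definition Ck_on (V : normedModType R) (k : nat) (B : seq V) (S : set V)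
    (f : V -> R) : Prop :=
  (forall vs, (size vs < k)%N -> all (fun v => v \in B) vs ->
     forall v, v \in B -> forall x, S x -> derivable (iterD vs f) x v) /\
  (forall vs, (size vs <= k)%N -> all (fun v => v \in B) vs ->
     forall x, S x -> {for x, continuous (iterD vs f)}).

Definition Ck_upto (V : normedModType R) (k : nat) (B : seq V) (S : set V)
    (f : V -> R) : Prop :=
  Ck_on k B S f /\ {within closure S, continuous f} /\
  (forall vs, (size vs <= k)%N -> all (fun v => v \in B) vs ->
     exists g : V -> R, {within closure S, continuous g} /\
       (forall x, S x -> iterD vs f x = g x)).

Definition basis_seq (m : nat) : seq 'rV[R]_m := [seq bvec i | i <- enum 'I_m].

Definition unif_convex_set (m : nat) (K : set 'rV[R]_m) : Prop :=
  exists c : R, 0 < c /\ forall x y z, K x -> K y ->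
    enorm (z - (2^-1) *: (x + y)) <= c * enorm (x - y) ^+ 2 -> K z.

Section Fdefs.
Variable (n : nat) (F : 'rV[R]_n.+1 -> R).

Definition phi0 : 'rV[R]_n.+1 := bvec ord0.

Definition DF (nu p : 'rV[R]_n.+1) : R := 'D_p F nu.
Definition D2F (nu p q : 'rV[R]_n.+1) : R := 'D_p ('D_q F) nu.
Definition D3F (nu p q r : 'rV[R]_n.+1) : R := 'D_p ('D_q ('D_r F)) nu.

Definition tangent (nu p : 'rV[R]_n.+1) : Prop := DF nu p = 0.

Definition standing_assumptions : Prop :=
  (forall p, p != 0 -> 0 < F p) /\
  (forall p q (l : R), 0 <= l <= 1 -> F (l *: p + (1 - l) *: q) <= l * F p + (1 - l) * F q) /\
  Ck_on 3 (basis_seq n.+1) [set p | p != 0] F /\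
  (forall (c : R) p, 0 < c -> F (c *: p) = c * F p) /\
  (forall lam : R, unif_convex_set [set p | F p <= lam]).

Definition SC (C1 : R) : Prop :=
  forall nu p q r, nu != 0 -> tangent nu p -> tangent nu q -> tangent nu r ->
    F nu ^+ 2 * D3F nu p q r <=
      C1 * Num.sqrt (F nu ^+ 3 * D2F nu p p * D2F nu q q * D2F nu r r).

(* span{phi^1..phi^n} = vectors with zero 0-th coordinate *)
Definition SYM : Prop :=
  forall p : 'rV[R]_n.+1, p 0 ord0 = 0 -> F (p + phi0) = F (p - phi0).

Definition du (u : 'rV[R]_n -> R -> R) (i : 'I_n) (y : 'rV[R]_n) (t : R) : R :=
  'D_(bvec i) (fun z => u z t) y.
Definition d2u (u : 'rV[R]_n -> R -> R) (i j : 'I_n) (y : 'rV[R]_n) (t : R) : R :=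
  'D_(bvec i) ('D_(bvec j) (fun z => u z t)) y.
Definition dtu (u : 'rV[R]_n -> R -> R) (y : 'rV[R]_n) (t : R) : R :=
  'D_1 (fun s => u y s) t.

(* Du = sum_i u_i phi^i  (phi^i, i = 1..n, is bvec (lift ord0 i)) *)
Definition Du (u : 'rV[R]_n -> R -> R) (y : 'rV[R]_n) (t : R) : 'rV[R]_n.+1 :=
  \sum_(i < n) du u i y t *: bvec (lift ord0 i).

Definition AMCF_at (u : 'rV[R]_n -> R -> R) (y : 'rV[R]_n) (t : R) : Prop :=
  let nu := Du u y t - phi0 in
  dtu u y t = \sum_(i < n) \sum_(j < n)
     F nu * D2F nu (bvec (lift ord0 i)) (bvec (lift ord0 j)) * d2u u i j y t.

Definition st_dirs : seq ('rV[R]_n * R)%type :=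
  (0, 1) :: [seq (bvec i, 0) | i <- enum 'I_n].

Definition C3_solution (T : R) (u : 'rV[R]_n -> R -> R) : Prop :=
  Ck_upto 3 st_dirs [set z | 0 < z.2 < T] (fun z => u z.1 z.2) /\
  (forall y t, 0 < t < T -> AMCF_at u y t).

End Fdefs.
End Defs.

(* Main.v *)
(* Doubling of variables. Where the solution is steep, its equation is comparable, in the direction of the gradient, with v_t = v'' / (v')^2, whose inverse functions solve the heat equation. So let zeta(s, t) = exp(-K/t) (exp(L s/t) - 1), a subsolution of zeta_t = (c/20) zeta_ss that vanishes as t -> 0 uniformly for |s| <= 2 M; then zeta(u(x,t) - u(y,t), t) <= |x - y| for all x, y. At an interior maximum of the difference both gradients are parallel to x - y, and the second order conditions are summed over a family of pairs of directions (xi, eta) with sum xi xi = A(Du(x)), sum eta eta = A(Du(y)), parallel except for a reflection in the direction x - y; uniform convexity of F makes that reflection worth (c/20) zeta_ss.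

   A penalty mu^2 |x|^2 makes the maximum exist, but separates the two gradients, which costs O(mu^2 / |x - y|) because A is a Lipschitz function of the normal. Replacing |x - y| by |x - y| + delta |x - y|^(1/2) pays for this: its concavity dominates the error near the diagonal, uniformly as mu -> 0.

   The resulting Lipschitz bound |Du| <= (t/L) exp(K/t) is independent of x, hence is dominated by the required right-hand side for small t once q is large. *)
Require Import Defs.
From HB Require Import structures.
From mathcomp Require Import all_boot all_order all_algebra.
From mathcomp Require Import all_classical all_reals all_analysis.
From mathcomp Require Import ring lra.
Import Order.TTheory GRing.Theory Num.Theory.
Import numFieldNormedType.Exports.
Local Open Scope classical_set_scope.
Local Open Scope ring_scope.
Set Implicit Arguments. Unset Strict Implicit. Unset Printing Implicit Defensive.

(** * Calculus along lines *)

(** Why steepness does no harm: F D^2F is homogeneous of degree zero, so compactness gives bounds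
    valid at every normal, and it degenerates exactly along the normal. On a graph of slope w the
    coefficient in the gradient direction e is therefore only of order 1/w^2, but zeta_ss is
    multiplied by the squared change of u, which restores the factor w^2. The product stays above
    c/20 whatever w is.

    The constants of zeta follow. L^2 c/20 = K lets zeta_ss balance the time derivative of
    exp(-K/t), and K = 2 (M+1) L keeps exp((L s - K)/t) below exp(-2L/t) for s <= 2M. The -1 in zeta
    leaves a strict surplus, bounded below on any time interval away from 0; it pays for the Hessian
    of the penalty, so mu can be fixed before the maximum is located.

    The pairs (xi, eta) are never constructed by hand. One prescribes their 2n by 2n Gram matrix,
    with diagonal blocks A(Du(x)) and A(Du(y)) and an off-diagonal block close to the average of the
    two, shows that it is nonnegative, and factors it; the rows of the factor are the pairs. *)

Lemma is_derive_line (R : realType) (V : normedModType R) (f : V -> R)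
    (x v : V) (t d : R) :
  is_derive (x + t *: v) v f d <-> is_derive t 1 (fun h => f (x + h *: v)) d.
Proof.
have E : (fun h : R => h^-1 *: (f (h *: v + (x + t *: v)) - f (x + t *: v)))
       = (fun h : R => h^-1 *: (f (x + (h *: (1 : R) + t) *: v) - f (x + t *: v))).
  apply/funext => h; congr (_ *: (f _ - _)).
  by rewrite addrCA -scalerDl /GRing.scale /= mulr1.
split => -[H1 H2]; apply: DeriveDef.
- by rewrite /derivable -E.
- by rewrite -H2 /derive -E.
- by rewrite /derivable E.
- by rewrite -H2 /derive E.
Qed.

(** Rescaling to [[0, 1]] lets one statement serve positive, negative and zero increments [a]. *)
Lemma MVT0 (R : realType) (f df : R -> R) (a : R) :
  (forall l : R, 0 <= l <= 1 -> is_derive (l * a) 1 f (df (l * a))) ->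
  exists2 l : R, 0 < l < 1 & f a - f 0 = a * df (l * a).
Proof.
move=> H; have [->|a0] := eqVneq a 0.
  by exists (2^-1); [lra | rewrite subrr mul0r].
pose g (l : R) := f (a * l).
have dg (l : R) : 0 <= l <= 1 -> is_derive l 1 g (a * df (l * a)).
  move=> /H H1; apply/(is_derive_eq (df := a * df (l * a)) (f' := a *: df (l * a))) => //.
  rewrite /g -[a *: _]mulr1 [a *: _]mulrC.
  rewrite -/(g) /g (_ : (fun l : R => f (a * l)) = f \o ( *%R a)) //.
  apply: is_derive_eq; first apply: is_derive1_comp.
    by rewrite mulrC; exact: H1.
  by rewrite /= /GRing.scale /=; ring.
have dg' (l : R) : l \in `]0, 1[ -> is_derive l 1 g (a * df (l * a)).
  by rewrite in_itv /= => l01; apply: dg; lra.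
have cg : {within `[0, 1], continuous g}.
  apply: derivable_within_continuous => l; rewrite in_itv /= => l01.
  by have [] := dg l l01.
have [l l01] := MVT ltr01 dg' cg; rewrite in_itv /= in l01.
by rewrite /g mulr0 mulr1 subr0 mulr1 => ->; exists l.
Qed.

(** The quotient [df h / h] tends to [d], so it is negative near 0. The mean value theorem writes
    [f h - f 0] as [l h^2] times such a quotient, so [df] need only be differentiable at the point
    0. *)
Lemma deriv2_lt0_max (R : realType) (f df : R -> R) (d : R) :
  (\forall h \near (0 : R), is_derive (h : R) 1 f (df h)) -> df 0 = 0 ->
  is_derive (0 : R) 1 df d -> d < 0 ->
  \forall h \near (0 : R), h != 0 -> f h < f 0.
Proof.
move=> Hf df0 [Hd1 Hd2] d0.
have C : (fun h : R => h^-1 * df h) @ 0^' --> d.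
  rewrite -Hd2 /derive.
  rewrite (_ : (fun h => _) = (fun h : R => h^-1 *: (df (h *: 1 + 0) - df 0))) //.
  by apply/funext => h; rewrite df0 subr0 addr0 /GRing.scale /= mulr1.
have C2 : \forall h \near 0^', h^-1 * df h < 0 by exact: cvgr_lt C _ d0.
case/nbhs_ballP: C2 => e1 /= e10 B1; case/nbhs_ballP: Hf => e2 /= e20 B2.
apply/nbhs_ballP; exists (Num.min e1 e2); rewrite /= ?lt_min ?e10 // => h.
rewrite /ball /= sub0r normrN lt_min => /andP[he1 he2] h0.
have hl (l : R) : 0 <= l <= 1 -> `|l * h| <= `|h|.
  move=> /andP[l0 l1]; rewrite normrM ger0_norm //.
  by rewrite ler_piMl.
have [l /andP[l0 l1] E] : exists2 l : R, 0 < l < 1 & f h - f 0 = h * df (l * h).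
  apply: MVT0 => l Hl; apply: B2.
  by rewrite /ball /= sub0r normrN (le_lt_trans (hl _ Hl)).
have lh0 : l * h != 0 by rewrite mulf_neq0 // gt_eqF.
have : (l * h)^-1 * df (l * h) < 0.
  apply: B1 => //=; rewrite /ball /= sub0r normrN (le_lt_trans (hl _ _)) //.
  by rewrite !ltW.
move=> X; rewrite -subr_lt0 E.
have -> : h * df (l * h) = l * h ^+ 2 * ((l * h)^-1 * df (l * h)).
  by field; rewrite h0 gt_eqF.
by rewrite pmulr_rlt0 // mulr_gt0 // lt_def sqr_ge0 sqrf_eq0 h0.
Qed.

Lemma deriv2_max_le0 (R : realType) (f df : R -> R) (d : R) :
  (\forall h \near (0 : R), is_derive (h : R) 1 f (df h)) ->
  is_derive (0 : R) 1 df d -> (\forall h \near (0 : R), f h <= f 0) -> df 0 = 0 /\ d <= 0.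
Proof.
move=> Hf Hd Hm.
have Hf0 : is_derive (0 : R) 1 f (df 0) by exact: nbhs_singleton Hf.
have df0 : df 0 = 0.
  case/nbhs_ballP: Hm => e /= e0 B1; case/nbhs_ballP: Hf => e2 /= e20 B2.
  pose m := Num.min e e2; have m0 : 0 < m by rewrite lt_min e0.
  have mm : (- m < m)%R by lra.
  have Bm (t : R) : t \in `]- m, m[ -> `|0 - t| < e /\ `|0 - t| < e2.
    rewrite in_itv /= sub0r normrN => Ht.
    have : `|t| < m by rewrite ltr_norml.
    by rewrite lt_min => /andP.
  have := @derive1_at_max R f (- m) m 0 (ltW mm).
  case=> [t /Bm [_ /B2 []]||t /Bm [/B1]|_ D0] //; first by rewrite in_itv /=; lra.
  by case: Hf0 => _ <-; exact: D0.
(* If [d] were positive, [- f] would have a strict maximum at 0, against the maximum of [f]. *)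
split => //; rewrite leNgt; apply/negP => d0.
have Hf' : \forall h \near (0 : R), is_derive (h : R) 1 (- f) ((- df) h).
  by apply: filterS Hf => h Hh; exact: is_deriveN.
have df0' : (- df) 0 = 0 by rewrite fctE df0 oppr0.
have Hd' : is_derive (0 : R) 1 (- df) (- d) by exact: is_deriveN.
have d0' : - d < 0 by rewrite oppr_lt0.
have /nbhs_ballP [e /= e0 B] := deriv2_lt0_max Hf' df0' Hd' d0'.
have /nbhs_ballP [e2 /= e20 B2] := Hm.
pose m := (Num.min e e2) / 2.
have m1 : 0 < Num.min e e2 by rewrite lt_min e0.
have m0 : 0 < m by rewrite divr_gt0.
have mlt : m < Num.min e e2 by rewrite /m; lra.
have me : m < e by rewrite (lt_le_trans mlt) // ge_min lexx.
have me2 : m < e2 by rewrite (lt_le_trans mlt) // ge_min lexx orbT.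
have := B m; rewrite /ball /= sub0r normrN gtr0_norm // => /(_ me).
rewrite gt_eqF // => /(_ isT); rewrite !fctE.
have := B2 m; rewrite /ball /= sub0r normrN gtr0_norm // => /(_ me2).
lra.
Qed.

(* The increment along [v + c b] splits into one along [v] and one along [b], to which the mean value theorem applies. *)
Lemma is_derive_add_dir (R : realType) (V : normedModType R) (f df : V -> R)
    (x v b : V) (dv c : R) :
  is_derive x v f dv -> (\forall y \near x, is_derive y b f (df y)) ->
  {for x, continuous df} -> is_derive x (v + c *: b) f (dv + c * df x).
Proof.
move=> [Hv1 Hv2] Hb cdf.
have Cv : (fun h : R => h^-1 *: (f (h *: v + x) - f x)) @ 0^' --> dv.
  by rewrite -Hv2; exact: Hv1.
have Cb : (fun h : R => h^-1 * (f (h *: v + x + (h * c) *: b) - f (h *: v + x)))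
    @ 0^' --> c * df x.
  apply/cvgrPdist_lt => e e0.
  have e10 : 0 < e / (`|c| + 1) by rewrite divr_gt0 // ltr_wpDl.
  move/cvgrPdist_lt: cdf => /(_ _ e10) /nbhs_normP [r1 /= r10 B1].
  case/nbhs_normP: Hb => r2 /= r20 B2.
  pose r := Num.min r1 r2; have r0 : 0 < r by rewrite lt_min r10.
  pose m := `|v| + `|c| * `|b| + 1.
  have m0 : 0 < m by rewrite ltr_wpDl // addr_ge0 // mulr_ge0.
  apply/nbhs_ballP; exists (r / m); first exact: divr_gt0.
  move=> h; rewrite /ball /= sub0r normrN ltr_pdivlMr // => hr h0.
  have near_pt (l : R) : 0 <= l <= 1 ->
      `|x - (h *: v + x + (l * (h * c)) *: b)| < r.
    move=> /andP[l0 l1]; apply: le_lt_trans hr.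
    rewrite addrAC opprD addrCA subrr addr0 normrN.
    apply: le_trans (ler_normD _ _) _.
    rewrite !normrZ (ger0_norm l0) /m mulrDr mulrDr mulr1 mulrA.
    have H1 : l * (`|h| * `|c|) * `|b| <= `|h| * `|c| * `|b|.
      by rewrite ler_wpM2r // ler_piMl // mulr_ge0.
    have := normr_ge0 h; lra.
  have [l /andP[l0 l1] E] : exists2 l : R, 0 < l < 1 &
      f (h *: v + x + (h * c) *: b) - f (h *: v + x + 0 *: b)
      = (h * c) * df (h *: v + x + (l * (h * c)) *: b).
    apply: (MVT0 (f := fun s => f (h *: v + x + s *: b))
      (df := fun s => df (h *: v + x + s *: b))) => l Hl.
    apply: (iffLR (is_derive_line f (h *: v + x) b (l * (h * c)) _)); apply: B2.
    by apply: lt_le_trans (near_pt _ Hl) _; rewrite ge_min lexx orbT.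
  rewrite scale0r addr0 in E; rewrite E.
  have -> : h^-1 * (h * c * df (h *: v + x + (l * (h * c)) *: b))
    = c * df (h *: v + x + (l * (h * c)) *: b) by field.
  rewrite -mulrBr normrM.
  have := B1 (h *: v + x + (l * (h * c)) *: b).
  rewrite /= => /(_ _)/wrap[].
    apply: lt_le_trans (near_pt l _) _; first by rewrite !ltW.
    by rewrite ge_min lexx.
  move=> H; have c1 : 0 < `|c| + 1 by rewrite ltr_wpDl.
  move: H; rewrite ltr_pdivlMr // => H.
  apply: le_lt_trans H; rewrite mulrC ler_wpM2l //; lra.
have E : (fun h : R => h^-1 *: (f (h *: (v + c *: b) + x) - f x)) =
  (fun h : R => h^-1 *: (f (h *: v + x) - f x))
  + (fun h : R => h^-1 * (f (h *: v + x + (h * c) *: b) - f (h *: v + x))).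
  apply/funext => h; rewrite fctE -mulrDr; congr (_ * _).
  by rewrite scalerDr scalerA (addrAC (h *: v)); ring.
have C : (fun h : R => h^-1 *: (f (h *: (v + c *: b) + x) - f x)) @ 0^'
    --> dv + c * df x by rewrite E; exact: cvgD Cv Cb.
apply: DeriveDef; last exact: cvg_lim C.
by apply/cvg_ex; exists (dv + c * df x).
Qed.

(* [f (x + h a + h b) - f (x + h a) - f (x + h b) + f x] is [h ^ 2] times either mixed derivative at a nearby point. *)
Lemma mixed_derivative_sym (R : realType) (V : normedModType R)
    (f fa fb fab fba : V -> R) (x a b : V) :
  (\forall y \near x, [/\ is_derive y a f (fa y), is_derive y b f (fb y),
     is_derive y b fa (fba y) & is_derive y a fb (fab y)]) ->
  {for x, continuous fab} -> {for x, continuous fba} -> fab x = fba x.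
Proof.
move=> H cab cba.
have key (g ga gba : V -> R) (u w : V) (r : R) : 0 < r ->
   (forall y, `|x - y| < r -> is_derive y u g (ga y) /\ is_derive y w ga (gba y)) ->
   forall h : R, h * (`|u| + `|w|) < r -> 0 < h ->
   exists2 y, `|x - y| < r & g (x + h *: u + h *: w) - g (x + h *: u)
      - (g (x + h *: w) - g x) = h ^+ 2 * gba y.
  move=> r0 B h hr h0; have B1 y Hy := (B y Hy).1; have B2 y Hy := (B y Hy).2.
  have near_pt (l k : R) : 0 <= l <= 1 -> 0 <= k <= 1 ->
      `|x - (x + (l * h) *: u + (k * h) *: w)| < r.
    move=> /andP[l0 l1] /andP[k0 k1]; apply: le_lt_trans hr.
    rewrite -addrA opprD addrA subrr add0r normrN.
    apply: le_trans (ler_normD _ _) _.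
    rewrite !normrZ !ger0_norm ?mulr_ge0 ?(ltW h0) // mulrDr.
    by rewrite lerD // ler_wpM2r // ler_piMl // ltW.
  have [l Hl E1] : exists2 l : R, 0 < l < 1 &
      (g (x + h *: u + h *: w) - g (x + h *: u))
      - (g (x + 0 *: u + h *: w) - g (x + 0 *: u)) =
      h * (ga (x + (l * h) *: u + h *: w) - ga (x + (l * h) *: u)).
    apply: (MVT0 (f := fun s => g (x + s *: u + h *: w) - g (x + s *: u))
      (df := fun s => ga (x + s *: u + h *: w) - ga (x + s *: u))) => l Hl.
    apply: is_deriveB.
      rewrite (_ : (fun s => _) = (fun s => g ((x + h *: w) + s *: u))); last first.
        by apply/funext => s; rewrite addrAC.
      apply: (iffLR (is_derive_line g (x + h *: w) u (l * h) _)).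
      rewrite addrAC; apply: B1.
      by have := near_pt l 1 Hl; rewrite mul1r ler01 lexx; exact.
    apply: (iffLR (is_derive_line g x u (l * h) _)); apply: B1.
    by have := near_pt l 0 Hl; rewrite mul0r scale0r addr0 ler01 lexx; exact.
  have Hl' : 0 <= l <= 1 by case/andP: Hl => ? ?; rewrite !ltW.
  have [k Hk E2] : exists2 k : R, 0 < k < 1 &
      ga (x + (l * h) *: u + h *: w) - ga (x + (l * h) *: u + 0 *: w)
      = h * gba (x + (l * h) *: u + (k * h) *: w).
    apply: (MVT0 (f := fun s => ga (x + (l * h) *: u + s *: w))
      (df := fun s => gba (x + (l * h) *: u + s *: w))) => k Hk.
    apply: (iffLR (is_derive_line ga (x + (l * h) *: u) w (k * h) _)).
    by apply: B2; exact: near_pt.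
  have Hk' : 0 <= k <= 1 by case/andP: Hk => ? ?; rewrite !ltW.
  exists (x + (l * h) *: u + (k * h) *: w); first exact: near_pt.
  move: E1 E2; rewrite !scale0r !addr0 => -> ->; ring.
apply/eqP; rewrite -subr_eq0 -normr_eq0; apply/eqP/le_anti.
rewrite normr_ge0 andbT; apply/ler_addgt0Pr => e e0; rewrite add0r.
have e2 : 0 < e / 2 by rewrite divr_gt0.
move/cvgrPdist_lt: cab => /(_ _ e2) /nbhs_normP [r1 /= r10 B1].
move/cvgrPdist_lt: cba => /(_ _ e2) /nbhs_normP [r2 /= r20 B2].
case/nbhs_normP: H => r3 /= r30 B3.
pose r := Num.min r1 (Num.min r2 r3).
have r0 : 0 < r by rewrite !lt_min r10 r20.
have m0 : 0 < `|a| + `|b| + 1 by rewrite ltr_wpDl // addr_ge0.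
pose h := r / (`|a| + `|b| + 1) / 2.
have h0 : 0 < h by rewrite !divr_gt0.
have hr : h * (`|a| + `|b|) < r.
  have : h * (`|a| + `|b| + 1) = r / 2 by rewrite /h; field; lra.
  rewrite mulrDr mulr1 => Eh; lra.
have lt3 y : `|x - y| < r -> [/\ `|x - y| < r1, `|x - y| < r2 & `|x - y| < r3].
  by rewrite !lt_min => /and3P.
have [] := key f fa fba a b r r0 _ h hr h0.
  by move=> y /lt3 [_ _ /B3 []].
move=> y1 /lt3 [_ Y1 _] E1.
have [] := key f fb fab b a r r0 _ h _ h0.
- by move=> y /lt3 [_ _ /B3 []].
- by rewrite (addrC `|b|).
move=> y2 /lt3 [Y2 _ _] E2.
have E : fab y2 = fba y1.
  have h2 : h ^+ 2 != 0 by rewrite sqrf_eq0 gt_eqF.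
  apply: (mulfI h2); rewrite -E1 -E2 (addrAC x (h *: b)); ring.
have := B1 _ Y2; have := B2 _ Y1; rewrite /= -E.
rewrite !ltr_norml ler_norml; lra.
Qed.

(** * Euclidean linear algebra *)

Definition dot (R : realType) (m : nat) (u v : 'rV[R]_m) : R := (u *m v^T) 0 0.

Section Dot.
Variables (R : realType) (m : nat).
Implicit Types u v w : 'rV[R]_m.

Lemma dotE u v : dot u v = \sum_j u 0 j * v 0 j.
Proof. by rewrite /dot mxE; apply: eq_bigr => j _; rewrite mxE. Qed.

Lemma dotC u v : dot u v = dot v u.
Proof. by rewrite !dotE; apply: eq_bigr => j _; rewrite mulrC. Qed.

Lemma dotDl u v w : dot (u + v) w = dot u w + dot v w.
Proof. by rewrite /dot mulmxDl mxE. Qed.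

Lemma dotDr u v w : dot w (u + v) = dot w u + dot w v.
Proof. by rewrite dotC dotDl !(dotC w). Qed.

Lemma dotZl c u v : dot (c *: u) v = c * dot u v.
Proof. by rewrite /dot -scalemxAl mxE. Qed.

Lemma dotZr c u v : dot u (c *: v) = c * dot u v.
Proof. by rewrite dotC dotZl dotC. Qed.

Lemma dotNl u v : dot (- u) v = - dot u v.
Proof. by rewrite -scaleN1r dotZl mulN1r. Qed.

Lemma dotNr u v : dot u (- v) = - dot u v.
Proof. by rewrite dotC dotNl dotC. Qed.

Lemma dotBl u v w : dot (u - v) w = dot u w - dot v w.
Proof. by rewrite dotDl dotNl. Qed.

Lemma dotBr u v w : dot w (u - v) = dot w u - dot w v.
Proof. by rewrite dotDr dotNr. Qed.

Lemma dot0l u : dot 0 u = 0.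
Proof. by rewrite /dot mul0mx mxE. Qed.

Lemma dot0r u : dot u 0 = 0.
Proof. by rewrite dotC dot0l. Qed.

Lemma dot_ge0 u : 0 <= dot u u.
Proof. by rewrite dotE sumr_ge0 // => j _; rewrite -expr2 sqr_ge0. Qed.

Lemma dot_eq0 u : (dot u u == 0) = (u == 0).
Proof.
apply/eqP/eqP => [|->]; last by rewrite dot0l.
rewrite dotE => /eqP; rewrite psumr_eq0 => [/allP H|j _]; last by rewrite -expr2 sqr_ge0.
apply/rowP => j; rewrite mxE; have := H j; rewrite mem_index_enum => /(_ isT) /=.
by rewrite mulf_eq0 orbb => /eqP.
Qed.

Lemma dot_gt0 u : (0 < dot u u) = (u != 0).
Proof. by rewrite lt_def dot_ge0 andbT dot_eq0. Qed.

Lemma dot_enorm u : dot u u = enorm u ^+ 2.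
Proof.
rewrite /enorm sqr_sqrtr; first by rewrite dotE; apply: eq_bigr => j _; rewrite expr2.
by apply: sumr_ge0 => j _; rewrite sqr_ge0.
Qed.

Lemma enorm_ge0 u : 0 <= enorm u.
Proof. exact: sqrtr_ge0. Qed.

Lemma enormE u : enorm u = Num.sqrt (dot u u).
Proof. by rewrite dot_enorm sqrtr_sqr ger0_norm // enorm_ge0. Qed.

Lemma cauchy_schwarz u v : dot u v ^+ 2 <= dot u u * dot v v.
Proof.
have [->|v0] := eqVneq v 0; first by rewrite !dot0r expr0n mulr0.
have vv : 0 < dot v v by rewrite dot_gt0.
have := dot_ge0 (dot v v *: u - dot u v *: v).
rewrite dotBl !dotBr !dotZl !dotZr (dotC v u) => H.
have : 0 <= dot v v * (dot u u * dot v v - dot u v ^+ 2) by lra.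
by rewrite pmulr_rge0 // subr_ge0.
Qed.

Lemma dot_le u v : `|dot u v| <= enorm u * enorm v.
Proof.
rewrite -[leRHS]ger0_norm ?mulr_ge0 ?enorm_ge0 // -ler_sqr ?nnegrE ?normr_ge0 //.
by rewrite !real_normK ?num_real // exprMn -!dot_enorm cauchy_schwarz.
Qed.

Lemma enorm0 : enorm (0 : 'rV[R]_m) = 0.
Proof. by rewrite enormE dot0l sqrtr0. Qed.

Lemma enorm_eq0 u : (enorm u == 0) = (u == 0).
Proof. by rewrite enormE sqrtr_eq0 -dot_eq0 eq_le dot_ge0 andbT. Qed.

Lemma enorm_gt0 u : (0 < enorm u) = (u != 0).
Proof. by rewrite lt_def enorm_ge0 andbT enorm_eq0. Qed.

Lemma enormZ c u : enorm (c *: u) = `|c| * enorm u.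
Proof. by rewrite !enormE dotZl dotZr mulrA -expr2 sqrtrM ?sqr_ge0 // sqrtr_sqr. Qed.

Lemma enormN u : enorm (- u) = enorm u.
Proof. by rewrite -scaleN1r enormZ normrN1 mul1r. Qed.

Lemma enormD u v : enorm (u + v) <= enorm u + enorm v.
Proof.
rewrite -ler_sqr ?nnegrE ?addr_ge0 ?enorm_ge0 // -dot_enorm dotDl !dotDr !dot_enorm (dotC v u).
have := dot_le u v; rewrite ler_norml => /andP[_ H]; rewrite sqrrD; lra.
Qed.

Lemma enormB u v : enorm (u - v) <= enorm u + enorm v.
Proof. by rewrite -(enormN v) enormD. Qed.

Lemma coord_le_enorm u j : `|u 0 j| <= enorm u.
Proof.
rewrite -sqrtr_sqr ler_wsqrtr // (bigD1 j) //= lerDl sumr_ge0 // => i _.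
exact: sqr_ge0.
Qed.

End Dot.

Lemma dot_mulmx (R : realType) (m k : nat) (u : 'rV[R]_m) (M : 'M[R]_(m, k)) v :
  dot (u *m M) v = dot u (v *m M^T).
Proof. by rewrite /dot trmx_mul trmxK mulmxA. Qed.

Lemma dot_row_mx (R : realType) (m k : nat) (a c : 'rV[R]_m) (b d : 'rV[R]_k) :
  dot (row_mx a b) (row_mx c d) = dot a c + dot b d.
Proof. by rewrite /dot tr_row_mx mul_row_col mxE. Qed.

(** * Norm bounds for bilinear forms, and factorization of nonnegative ones *)

Section BilinearBound.
Variables (R : realType) (m : nat).
Implicit Types (M : 'M[R]_m) (a b : 'rV[R]_m).

Definition opbound M (K : R) := forall a b, `|dot (a *m M) b| <= K * (enorm a * enorm b).

Lemma opboundW M K K' : K <= K' -> opbound M K -> opbound M K'.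
Proof.
move=> KK H a b; apply: le_trans (H a b) _.
by rewrite ler_wpM2r // mulr_ge0 // enorm_ge0.
Qed.

Lemma opboundD M M' K K' : opbound M K -> opbound M' K' -> opbound (M + M') (K + K').
Proof.
move=> H H' a b; rewrite mulmxDr dotDl mulrDl.
by apply: le_trans (ler_normD _ _) _; rewrite lerD.
Qed.

Lemma opboundZ c M K : opbound M K -> opbound (c *: M) (`|c| * K).
Proof.
by move=> H a b; rewrite -scalemxAr dotZl normrM -mulrA ler_wpM2l.
Qed.

Lemma opbound_entries M K : (forall i j, `|M i j| <= K) -> opbound M (m%:R * m%:R * K).
Proof.
move=> H a b; rewrite dotE.
apply: le_trans (ler_norm_sum _ _ _) _.
have K0 i j : `|a 0 i| * `|M i j| * `|b 0 j| <= K * (enorm a * enorm b).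
  rewrite -mulrA mulrCA ler_pM ?mulr_ge0 ?normr_ge0 //.
  by rewrite ler_pM ?normr_ge0 // coord_le_enorm.
have E j : `|(a *m M) 0 j * b 0 j| <= m%:R * (K * (enorm a * enorm b)).
  rewrite mxE mulr_suml; apply: le_trans (ler_norm_sum _ _ _) _.
  apply: le_trans (ler_sum _ (_ : forall i, true -> _ <= K * (enorm a * enorm b))) _.
    by move=> i _; rewrite !normrM.
  by rewrite sumr_const card_ord mulr_natl.
apply: le_trans (ler_sum _ (fun j _ => E j)) _.
by rewrite sumr_const card_ord -[leLHS]mulr_natl !mulrA.
Qed.

Lemma opbound_enorm M K a : opbound M K -> enorm (a *m M) <= K * enorm a.
Proof.
move=> H; have [->|n0] := eqVneq (enorm (a *m M)) 0.
  have [->|a0] := eqVneq a 0; first by rewrite enorm0 mulr0.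
  have := H a a; rewrite mulrA => /(le_trans (normr_ge0 _)).
  by rewrite pmulr_lge0 // enorm_gt0.
have np : 0 < enorm (a *m M) by rewrite lt_def n0 enorm_ge0.
have := H a (a *m M); rewrite dot_enorm ger0_norm ?sqr_ge0 // expr2 mulrA.
by rewrite ler_pM2r.
Qed.

End BilinearBound.

(** Cholesky factorization, splitting off the first row and column. A positive pivot leaves the
    Schur complement, which is again nonnegative; a zero pivot forces the rest of its row to
    vanish. *)
Lemma psd_factor (R : realType) (m : nat) (M : 'M[R]_m) :
  M^T = M -> (forall u, 0 <= dot (u *m M) u) -> exists B : 'M[R]_m, M = B^T *m B.
Proof.
elim: m M => [|m IH] M; first by exists 0; apply/matrixP => -[].
move: M; change m.+1 with (1 + m)%N => M; rewrite -[M]submxK => Ms Mp.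
set a := ulsubmx M; set b := ursubmx M; set b' := dlsubmx M; set C := drsubmx M.
rewrite -/a -/b -/b' -/C in Ms Mp *; rewrite tr_block_mx in Ms.
clearbody a b b' C.
have [_ Eb' Eb EC] := eq_block_mx Ms.
have {Ms Mp} Mp (s : R) (w : 'rV[R]_m) : 0 <= s ^+ 2 * a 0 0 + 2 * s * dot b w + dot (w *m C) w.
  have := Mp (row_mx s%:M w).
  rewrite mul_row_block dot_row_mx !dotDl -Eb !mul_scalar_mx !dotZl.
  have -> : dot a s%:M = s * a 0 0 by rewrite dotE big_ord1 mxE mulrC eqxx.
  have -> : dot (w *m b^T) s%:M = s * dot b w.
    by rewrite dotE big_ord1 [s%:M 0 0]mxE eqxx mulr1n mulrC -/(dot w b) dotC.
  by lra.
have a0 : 0 <= a 0 0 by have := Mp 1 0; rewrite dot0r mul0mx dot0l; lra.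
have [az|anz] := eqVneq (a 0 0) 0.
  have b0 : b = 0.
    apply/eqP; rewrite -dot_eq0 -sqrf_eq0 eq_le sqr_ge0 andbT.
    rewrite leNgt; apply/negP => bp.
    have bb : 0 < dot b b by rewrite lt_def dot_ge0 andbT; apply: contraTN bp => /eqP ->; rewrite expr0n ltxx.
    (* With zero pivot the form is affine in [s]; this value of [s] makes it equal to -1. *)
    have := Mp (- (dot (b *m C) b + 1) / (2 * dot b b)) b.
    rewrite az mulr0 add0r.
    have -> : 2 * (- (dot (b *m C) b + 1) / (2 * dot b b)) * dot b b = - (dot (b *m C) b + 1).
      by field; rewrite gt_eqF.
    lra.
  have [B' EB'] : exists B : 'M[R]_m, C = B^T *m B.
    by apply: IH => // w; have := Mp 0 w; rewrite expr0n /= !mul0r mulr0 mul0r !add0r.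
  exists (block_mx 0 0 0 B' : 'M[R]_(1 + m)).
  rewrite tr_block_mx mulmx_block !trmx0 !mul0mx !mulmx0 !add0r -EB' -Eb b0 trmx0.
  by congr block_mx; rewrite [LHS]mx11_scalar az; apply/matrixP => i j; rewrite !mxE mul0rn.
have ap : 0 < a 0 0 by rewrite lt_def anz.
have [B' EB'] : exists B : 'M[R]_m, C - (a 0 0)^-1 *: (b^T *m b) = B^T *m B.
  apply: IH; first by rewrite linearB linearZ /= trmx_mul trmxK EC.
  move=> w; rewrite mulmxBr dotBl -scalemxAr dotZl mulmxA.
  have -> : dot (w *m b^T *m b) w = dot b w ^+ 2.
    by rewrite [w *m b^T]mx11_scalar mul_scalar_mx dotZl -/(dot w b) dotC.
  (* The minimizer in [s], at which the form takes the value of the Schur complement at [w]. *)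
  have := Mp (- (dot b w / a 0 0)) w.
  rewrite (_ : _ ^+ 2 * _ = dot b w ^+ 2 / a 0 0); last by field.
  rewrite (_ : 2 * _ * _ = - 2 * (dot b w ^+ 2 / a 0 0)); last by field.
  rewrite (mulrC _^-1); lra.
pose r := Num.sqrt (a 0 0).
have r2 : r ^+ 2 = a 0 0 by rewrite sqr_sqrtr.
have rnz : r != 0 by rewrite sqrtr_eq0 -ltNge.
exists (block_mx r%:M (r^-1 *: b) 0 B' : 'M[R]_(1 + m)).
rewrite tr_block_mx mulmx_block !trmx0 !mul0mx !mulmx0 !addr0 -EB'.
rewrite tr_scalar_mx !linearZ /= -!scalemxAl mul_scalar_mx mul_mx_scalar !scalerA.
congr block_mx.
- by rewrite [LHS]mx11_scalar scale_scalar_mx -expr2 r2.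
- by rewrite mul_scalar_mx scalerA mulVf // scale1r.
- by rewrite mulVf // scale1r -Eb.
- by rewrite -invfM -expr2 r2 scalerN addrC subrK.
Qed.

(** * Coupling of two degenerate quadratic forms *)

Section Coupling.
Variable R : realType.

Lemma dot_sym_mx (m : nat) (N : 'M[R]_m) a b :
  N^T = N -> dot (b *m N) a = dot (a *m N) b.
Proof. by move=> NT; rewrite dot_mulmx NT dotC. Qed.

Section Pair.
Variables (m : nat) (N1 N2 : 'M[R]_m) (c E k : R).
Hypotheses (N1s : N1^T = N1) (N2s : N2^T = N2) (c0 : 0 < c).
Hypotheses (hE : opbound (N1 - N2) E) (kE : E ^+ 2 <= c * k) (kc : k <= c / 2).

(** The block form with diagonal blocks [N1], [N2] and off-diagonal block [(N1 + N2) / 2 - k]. For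
    [N1 = N2] and [k = 0] it is [N1] evaluated at [a + b], null at [b = - a]: the coupled directions
    coincide. The shift by [k] lifts this null space, so that positivity survives a small difference
    [N1 - N2]. *)
Definition pair_form (a b : 'rV[R]_m) : R :=
  dot (a *m N1) a + dot (b *m N2) b + dot (a *m (N1 + N2)) b - 2 * k * dot a b.

(* In terms of [a + b] and [a - b] the form is nearly diagonal. *)
Lemma pair_formE a b : pair_form a b =
  2^-1 * dot ((a + b) *m (N1 + N2)) (a + b)
  + 2^-1 * dot ((a + b) *m (N1 - N2)) (a - b)
  - k / 2 * (dot (a + b) (a + b) - dot (a - b) (a - b)).
Proof.
rewrite /pair_form !mulmxDl !mulmxDr !mulmxN !dotDl !dotDr !dotNl !dotNr.
rewrite (dot_sym_mx a b N1s) (dot_sym_mx a b N2s) (dotC b a); lra.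
Qed.

(** The only cross term, between [a + b] and [a - b], comes from [N1 - N2] and has size [E / 2]; it
    is absorbed by the two squares because [E ^+ 2 <= c * k]. *)
Lemma pair_form_ge a b :
  (forall x, c * dot x x <= dot (x *m N1) x) ->
  (forall x, c * dot x x <= dot (x *m N2) x) ->
  c / 4 * dot (a + b) (a + b) + k / 4 * dot (a - b) (a - b) <= pair_form a b.
Proof.
move=> H1 H2; rewrite pair_formE [_ *m (N1 + N2)]mulmxDr (dotDl (_ *m N1)).
have := H1 (a + b); have := H2 (a + b).
have := hE (a + b) (a - b); rewrite ler_norml => /andP[+ _].
rewrite !dot_enorm.
have := enorm_ge0 (a + b); have := enorm_ge0 (a - b).
move: (enorm _) (enorm _) (dot _ _) (dot _ _) (dot _ _) => x y u v w y0 x0 Hu Hv Hw.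
have k0 : 0 <= k by rewrite -(pmulr_rge0 k c0); exact: le_trans (sqr_ge0 E) kE.
have key : 0 <= c / 2 * x ^+ 2 - 2^-1 * E * (x * y) + k / 4 * y ^+ 2.
  rewrite -(pmulr_rge0 _ c0).
  have : 0 <= (c * k - E ^+ 2) * y ^+ 2 by rewrite mulr_ge0 ?sqr_ge0 // subr_ge0.
  have := sqr_ge0 (c * x - E * y); have := sqr_ge0 (c * x); nra.
have : 0 <= (c / 2 - k) * x ^+ 2 by rewrite mulr_ge0 ?sqr_ge0 // subr_ge0.
lra.
Qed.

Lemma pair_form_le B a b : opbound N1 B -> opbound N2 B ->
  pair_form a b <= B * enorm (a + b) ^+ 2
    + 2^-1 * E * (enorm (a + b) * enorm (a - b)) + k / 2 * enorm (a - b) ^+ 2.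
Proof.
move=> H1 H2; rewrite pair_formE [_ *m (N1 + N2)]mulmxDr (dotDl (_ *m N1)).
have := H1 (a + b) (a + b); rewrite ler_norml => /andP[_].
have := H2 (a + b) (a + b); rewrite ler_norml => /andP[_].
have := hE (a + b) (a - b); rewrite ler_norml => /andP[_].
have k0 : 0 <= k by rewrite -(pmulr_rge0 k c0); exact: le_trans (sqr_ge0 E) kE.
have : 0 <= k * enorm (a + b) ^+ 2 by rewrite mulr_ge0 ?sqr_ge0.
rewrite !dot_enorm -!expr2; lra.
Qed.

End Pair.

Definition line_proj (m : nat) (v : 'rV[R]_m) : 'M[R]_m := (dot v v)^-1 *: (v^T *m v).

Lemma dot_proj (m : nat) (v a b : 'rV[R]_m) :
  dot (a *m line_proj v) b = dot a v * dot v b / dot v v.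
Proof.
rewrite /line_proj -scalemxAr dotZl mulmxA [a *m v^T]mx11_scalar mul_scalar_mx dotZl.
by rewrite -/(dot a v) mulrC.
Qed.

Lemma tr_line_proj (m : nat) (v : 'rV[R]_m) : (line_proj v)^T = line_proj v.
Proof. by rewrite /line_proj linearZ /= trmx_mul trmxK. Qed.

Lemma line_proj_id (m : nat) (v : 'rV[R]_m) : v != 0 -> v *m line_proj v = v.
Proof.
move=> v0; rewrite /line_proj -scalemxAr mulmxA [v *m v^T]mx11_scalar mul_scalar_mx.
by rewrite -/(dot v v) scalerA mulVf ?scale1r // dot_eq0.
Qed.

Lemma line_projK (m : nat) (v : 'rV[R]_m) : v != 0 -> line_proj v *m line_proj v = line_proj v.
Proof. by move=> v0; rewrite {1 3}/line_proj -scalemxAl -mulmxA line_proj_id. Qed.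

Lemma unit_vec_dist (m : nat) (v w : 'rV[R]_m) (h : R) : v != 0 -> w != 0 ->
  enorm (v - w) <= h / 2 * enorm w ->
  enorm ((enorm v)^-1 *: v - (enorm w)^-1 *: w) <= h.
Proof.
move=> v0 w0 H; have nv : 0 < enorm v by rewrite enorm_gt0.
have nw : 0 < enorm w by rewrite enorm_gt0.
have -> : (enorm v)^-1 *: v - (enorm w)^-1 *: w =
    (enorm w)^-1 *: (v - w) + ((enorm v)^-1 - (enorm w)^-1) *: v.
  by rewrite scalerBr scalerBl [RHS]addrC addrA subrK.
apply: le_trans (enormD _ _) _; rewrite !enormZ ger0_norm ?invr_ge0 ?enorm_ge0 //.
have -> : `|(enorm v)^-1 - (enorm w)^-1| * enorm v = `|enorm w - enorm v| / enorm w.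
  have -> : (enorm v)^-1 - (enorm w)^-1 = (enorm w - enorm v) / enorm v / enorm w.
    by field; rewrite !gt_eqF.
  by rewrite !normrM !normfV !(ger0_norm (enorm_ge0 _)); field; rewrite !gt_eqF.
have D : `|enorm w - enorm v| <= enorm (v - w).
  rewrite ler_norml.
  have := enormD (v - w) w; have := enormB v (v - w).
  by rewrite subrK opprB addrC subrK; lra.
rewrite mulrC -mulrDl ler_pdivrMr //; lra.
Qed.

(** Each projection is a rank one product of unit vectors; changing the two factors in turn costs
    [h] each. *)
Lemma opbound_proj_diff (m : nat) (v w : 'rV[R]_m) (h : R) : v != 0 -> w != 0 ->
  enorm (v - w) <= h / 2 * enorm w -> opbound (line_proj v - line_proj w) (2 * h).
Proof.
move=> v0 w0 H a b; have := unit_vec_dist v0 w0 H.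
have nv : enorm v != 0 by rewrite enorm_eq0.
have nw : enorm w != 0 by rewrite enorm_eq0.
set v' := _ *: v; set w' := _ *: w => H'.
have v'1 : enorm v' = 1 by rewrite enormZ ger0_norm ?invr_ge0 ?enorm_ge0 // mulVf.
have w'1 : enorm w' = 1 by rewrite enormZ ger0_norm ?invr_ge0 ?enorm_ge0 // mulVf.
have E (x : 'rV[R]_m) : enorm x != 0 -> dot a x * dot x b / dot x x =
    dot a ((enorm x)^-1 *: x) * dot ((enorm x)^-1 *: x) b.
  by move=> x0; rewrite dotZl dotZr dot_enorm; field.
rewrite mulmxBr dotBl !dot_proj !E // -/v' -/w'.
have -> : dot a v' * dot v' b - dot a w' * dot w' b =
  dot a (v' - w') * dot v' b + dot a w' * dot (v' - w') b.
  by rewrite dotBl dotBr; ring.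
have := dot_le a (v' - w'); have := dot_le a w'.
have := dot_le v' b; have := dot_le (v' - w') b; rewrite v'1 w'1 mul1r mulr1.
move=> H1 H2 H3 H4; apply: le_trans (ler_normD _ _) _; rewrite !normrM.
have a0 := enorm_ge0 a; have b0 := enorm_ge0 b.
have X1 : `|dot a (v' - w')| * `|dot v' b| <= (enorm a * h) * enorm b.
  by rewrite ler_pM // (le_trans H4) // ler_wpM2l.
have X2 : `|dot a w'| * `|dot (v' - w') b| <= enorm a * (h * enorm b).
  by rewrite ler_pM // (le_trans H1) // ler_wpM2r.
lra.
Qed.

Lemma dot_delta (m : nat) (i : 'I_m) (u : 'rV[R]_m) : dot (delta_mx 0 i) u = u 0 i.
Proof.
rewrite dotE (bigD1 i) //= mxE !eqxx mul1r big1 ?addr0 // => j ji.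
by rewrite mxE (negPf ji) mul0r.
Qed.

Lemma enorm_delta (m : nat) (i : 'I_m) : enorm (delta_mx 0 i : 'rV[R]_m) = 1.
Proof. by rewrite enormE dot_delta mxE !eqxx sqrtr1. Qed.

Lemma dot_block_mx (m k : nat) (A : 'M[R]_m) (C : 'M[R]_(m, k)) (D : 'M[R]_k) a b :
  dot (row_mx a b *m block_mx A C C^T D) (row_mx a b) =
  dot (a *m A) a + dot (b *m D) b + 2 * dot (a *m C) b.
Proof.
by rewrite mul_row_block dot_row_mx !dotDl (dot_mulmx b) trmxK (dotC b); ring.
Qed.

Lemma sum_sqr_factor (m k N : nat) (X : 'M[R]_(N, m)) (Y : 'M[R]_(N, k)) a b :
  \sum_i (dot a (row i X) + dot b (row i Y)) ^+ 2 =
  dot (row_mx a b *m ((row_mx X Y)^T *m row_mx X Y)) (row_mx a b).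
Proof.
rewrite mulmxA dot_mulmx dotE; apply: eq_bigr => i _.
rewrite -expr2; congr (_ ^+ 2).
rewrite -dot_row_mx -row_row_mx dotE [RHS]mxE; apply: eq_bigr => j _.
by rewrite [row _ _ _ _]mxE [_^T _ _]mxE.
Qed.

(** The rows are phi^1, ..., phi^n: multiplication on the right maps the row of partial derivatives
    to Du in V^*, and conjugation cuts a matrix on V^* down to its block with indices 1, ..., n. *)
Definition graph_emb (n : nat) : 'M[R]_(n, n.+1) := \matrix_(i, j) (j == lift ord0 i)%:R.

Definition graph_normal (n : nat) (p : 'rV[R]_n) : 'rV[R]_n.+1 := p *m graph_emb n - phi0 R n.

Lemma graph_embE n (p : 'rV[R]_n) :
  (p *m graph_emb n) 0 ord0 = 0 /\ (forall i, (p *m graph_emb n) 0 (lift ord0 i) = p 0 i).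
Proof.
split=> [|i]; rewrite mxE.
  by rewrite big1 // => j _; rewrite mxE mulr0.
rewrite (bigD1 i) //= mxE eqxx mulr1 big1 ?addr0 // => j ji; rewrite mxE.
by rewrite (inj_eq lift_inj) eq_sym (negPf ji) mulr0.
Qed.

Lemma dot_graph_emb n (p q : 'rV[R]_n) :
  dot (p *m graph_emb n) (q *m graph_emb n) = dot p q.
Proof.
have [p0 pl] := graph_embE p; have [q0 ql] := graph_embE q.
rewrite !dotE big_ord_recl p0 mul0r add0r; apply: eq_bigr => i _.
by rewrite pl ql.
Qed.

Lemma dot_phi0 n (v : 'rV[R]_n.+1) : dot v (phi0 R n) = v 0 ord0.
Proof.
rewrite dotE big_ord_recl /phi0 /bvec mxE eqxx mulr1 big1 ?addr0 // => i _.
by rewrite mxE mulr0.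
Qed.

Lemma dot_graph_normal n (p q : 'rV[R]_n) :
  dot (graph_normal p) (graph_normal q) = dot p q + 1.
Proof.
rewrite /graph_normal !dotBl !dotBr dot_graph_emb !(dotC (phi0 R n)) !dot_phi0.
by rewrite (graph_embE p).1 (graph_embE q).1 /phi0 /bvec mxE eqxx /=; ring.
Qed.

Lemma graph_normal_neq0 n (p : 'rV[R]_n) : graph_normal p != 0.
Proof. by rewrite -dot_gt0 dot_graph_normal ltr_wpDl ?dot_ge0. Qed.

Lemma graph_normalB n (p q : 'rV[R]_n) :
  graph_normal p - graph_normal q = (p - q) *m graph_emb n.
Proof. by rewrite /graph_normal mulmxBl opprB addrA subrK. Qed.

End Coupling.

Lemma dot_conj (R : realType) (m k j l : nat) (X : 'M[R]_(m, k)) (N : 'M[R]_(k, j))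
    (Y : 'M[R]_(l, j)) a b :
  dot (a *m (X *m N *m Y^T)) b = dot (a *m X *m N) (b *m Y).
Proof. by rewrite /dot trmx_mul !mulmxA. Qed.

Lemma dot_polar (R : realType) (m : nat) (x y f g : 'rV[R]_m) :
  dot x f + dot y g = 2^-1 * dot (x + y) (f + g) + 2^-1 * dot (x - y) (f - g).
Proof. by rewrite !dotDl !dotDr !dotNl !dotNr; lra. Qed.

Lemma enorm_tangent (R : realType) (m : nat) (u v : 'rV[R]_m) : v != 0 ->
  enorm (u *m (1%:M - line_proj v)) <= enorm u.
Proof.
move=> v0; rewrite !enormE ler_wsqrtr // mulmxBr mulmx1 dotBl !dotBr.
rewrite (dotC u (u *m _)) !dot_proj (dotC v (u *m _)) dot_proj (dotC v u).
have vv : dot v v != 0 by rewrite dot_eq0.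
have -> : dot u v * (dot u v * dot v v / dot v v) / dot v v = dot u v ^+ 2 / dot v v by field.
have : 0 <= dot u v ^+ 2 / dot v v by rewrite divr_ge0 ?sqr_ge0 ?dot_ge0.
lra.
Qed.

Lemma phi0_ord0 (R : realType) n : phi0 R n 0 ord0 = 1.
Proof. by rewrite /phi0 /bvec mxE eqxx. Qed.

Section CouplingLemma.
Variables (R : realType) (n : nat) (T1 T2 : 'M[R]_n.+1) (p1 e : 'rV[R]_n).
Variables (c B D h w : R).
Let p2 := w *: e.
Let v1 := graph_normal p1.
Let v2 := graph_normal p2.
Hypotheses (c0 : 0 < c) (B0 : 0 <= B) (D0 : 0 <= D) (h0 : 0 <= h <= 1) (w1 : 1 <= w).
Hypotheses (e1 : dot e e = 1) (p12 : enorm (p1 - p2) <= h / 2 * w).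
Hypotheses (T1s : T1^T = T1) (T2s : T2^T = T2) (T1k : v1 *m T1 = 0) (T2k : v2 *m T2 = 0).
Hypothesis T1c : forall a, c * (dot a a - dot a v1 ^+ 2 / dot v1 v1) <= dot (a *m T1) a.
Hypothesis T2c : forall a, c * (dot a a - dot a v2 ^+ 2 / dot v2 v2) <= dot (a *m T2) a.
Hypotheses (T1B : opbound T1 B) (T2B : opbound T2 B) (T12 : opbound (T1 - T2) (D * h)).
Let L := @graph_emb R n.
(** [D' * h] bounds [N1 - N2] below: [D * h] from the forms themselves, [2 * c * h] from the
    projections. [K] is chosen so that [c * k] equals [(D' * h)^2 + (c * h)^2]; the first summand
    meets the condition of [pair_form_ge], the second gives [c * h^2 <= k] for [form_ge0]. *)
Let D' := D + 2 * c.
Let K := D' ^+ 2 / c + c.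
Hypothesis hK : K * h ^+ 2 <= c / 2.
(** The strength of the reflection. The tangent vector over [e] has length of order [w], so the
    coefficient in direction [e] leaves room for an amount of order [c / w^2]; the factor 40 is what
    [form_ge0] tolerates. *)
Let th := c / (40 * w ^+ 2).
Let k := K * h ^+ 2.
(** [T1] and [T2] vanish along their normals. Filling in these kernels makes both forms coercive on
    the whole space, as [pair_form_ge] demands; the projections [P1], [P2] remove the filling
    again. *)
Let N1 := T1 + c *: line_proj v1.
Let N2 := T2 + c *: line_proj v2.
Let P1 := 1%:M - line_proj v1.
Let P2 := 1%:M - line_proj v2.
(** The prescribed correlation of xi and eta. The first term alone would make them nearly parallel;
    the second one is the reflection in the direction [e]. *)
Let C := (L *m P1) *m (2^-1 *: (N1 + N2) - k%:M) *m (L *m P2)^T - (2 * th) *: (e^T *m e).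

Let v1n0 : v1 != 0 := graph_normal_neq0 p1.
Let v2n0 : v2 != 0 := graph_normal_neq0 p2.

Let w0 : 0 < w. Proof. exact: lt_le_trans ltr01 w1. Qed.
Let th0 : 0 < th. Proof. by rewrite divr_gt0 // mulr_gt0 // exprn_gt0. Qed.
Let D'0 : 0 <= D'. Proof. by rewrite addr_ge0 // mulr_ge0 // ltW. Qed.

Let N1s : N1^T = N1. Proof. by rewrite linearD linearZ /= tr_line_proj T1s. Qed.
Let N2s : N2^T = N2. Proof. by rewrite linearD linearZ /= tr_line_proj T2s. Qed.

Let normal_dist : enorm (v1 - v2) <= h / 2 * enorm v2.
Proof.
rewrite graph_normalB !enormE dot_graph_emb -enormE; apply: le_trans p12 _.
case/andP: h0 => h00 _; rewrite ler_wpM2l ?divr_ge0 //.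
rewrite dot_graph_normal dotZl dotZr e1 mulr1 -[leLHS]ger0_norm ?(ltW w0) // -sqrtr_sqr.
by rewrite ler_wsqrtr // expr2; lra.
Qed.

Let NB (T : 'M[R]_n.+1) v : v != 0 -> opbound T B -> opbound (T + c *: line_proj v) (B + c).
Proof.
move=> vn0 TB; apply: opboundD => //.
rewrite -[X in opbound _ X](mulr1 c) -{2}(gtr0_norm c0); apply: opboundZ => a b.
rewrite dot_proj normrM normfV (ger0_norm (dot_ge0 v)) ler_pdivrMr ?dot_gt0 // mul1r.
rewrite normrM dot_enorm; apply: le_trans (ler_pM _ _ (dot_le a v) (dot_le v b)) _ => //.
by rewrite expr2; lra.
Qed.

Let Nc (T : 'M[R]_n.+1) v : v != 0 ->
  (forall a, c * (dot a a - dot a v ^+ 2 / dot v v) <= dot (a *m T) a) ->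
  forall a, c * dot a a <= dot (a *m (T + c *: line_proj v)) a.
Proof.
move=> vn0 H a; rewrite mulmxDr dotDl -scalemxAr dotZl dot_proj (dotC v a) -expr2.
have := H a; lra.
Qed.

Let N12 : opbound (N1 - N2) (D' * h).
Proof.
have -> : N1 - N2 = (T1 - T2) + c *: (line_proj v1 - line_proj v2).
  by rewrite /N1 /N2 scalerBr opprD addrACA.
have -> : D' * h = D * h + `|c| * (2 * h) by rewrite gtr0_norm // /D'; ring.
by apply: opboundD => //; apply: opboundZ; exact: opbound_proj_diff.
Qed.

(** Since [T] annihilates [v] from both sides, compression to the tangent space kills the added
    multiple of the projection and leaves [T] unchanged. *)
Let PNP (T : 'M[R]_n.+1) v : v != 0 -> T^T = T -> v *m T = 0 ->
  (L *m (1%:M - line_proj v)) *m (T + c *: line_proj v) *m (L *m (1%:M - line_proj v))^T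
  = L *m T *m L^T.
Proof.
move=> vn0 Ts Tk.
have GT : line_proj v *m T = 0 by rewrite /line_proj -scalemxAl -mulmxA Tk mulmx0 scaler0.
have TG : T *m line_proj v = 0 by rewrite -[LHS]trmxK trmx_mul tr_line_proj Ts GT trmx0.
rewrite trmx_mul [(1%:M - _)^T]linearB /= trmx1 tr_line_proj !mulmxA; congr (_ *m _).
rewrite -!mulmxA; congr (_ *m _).
have -> : (T + c *: line_proj v) *m (1%:M - line_proj v) = T.
  by rewrite mulmxBr mulmx1 mulmxDl TG -scalemxAl line_projK // add0r addrK.
by rewrite mulmxBl mul1mx GT subr0.
Qed.

Let form a b : dot (row_mx a b *m block_mx (L *m T1 *m L^T) C C^T (L *m T2 *m L^T)) (row_mx a b)
  = pair_form N1 N2 k (a *m (L *m P1)) (b *m (L *m P2)) - 4 * th * (dot a e * dot b e).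
Proof.
have HC : dot (a *m C) b = dot (a *m (L *m P1) *m (2^-1 *: (N1 + N2) - k%:M)) (b *m (L *m P2))
    - 2 * th * (dot a e * dot b e).
  rewrite /C [a *m (_ - _)]mulmxBr dotBl -scalemxAr dotZl dot_conj; congr (_ - _ * _).
  by rewrite mulmxA [a *m e^T]mx11_scalar mul_scalar_mx dotZl -/(dot a e) (dotC e b).
rewrite dot_block_mx -(PNP v1n0 T1s T1k) -(PNP v2n0 T2s T2k) !dot_conj HC /pair_form.
rewrite -/N1 -/N2 -/P1 -/P2 [_ *m (_ - k%:M)]mulmxBr dotBl mul_mx_scalar dotZl.
rewrite -scalemxAr dotZl; do 6!move: (dot _ _) => ?; lra.
Qed.

Let kE : (D' * h) ^+ 2 <= c * k.
Proof.
have -> : c * k = (D' * h) ^+ 2 + (c * h) ^+ 2 by rewrite /k /K; field; rewrite gt_eqF.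
by rewrite lerDl sqr_ge0.
Qed.

Let E0 : 0 <= D' * h. Proof. by case/andP: h0 => h00 _; rewrite mulr_ge0. Qed.

Let p1e : w / 2 <= dot p1 e <= 2 * w.
Proof.
have e1' : enorm e = 1 by rewrite enormE e1 sqrtr1.
have := dot_le (p1 - p2) e; rewrite e1' mulr1 dotBl dotZl e1 mulr1 => H.
have := le_trans H p12; rewrite ler_norml.
have : h * w <= w by rewrite ler_piMl ?(ltW w0) //; case/andP: h0.
lra.
Qed.

Let T1E : forall x, c * dot x x <= dot (x *m N1) x. Proof. exact: Nc. Qed.
Let T2E : forall x, c * dot x x <= dot (x *m N2) x. Proof. exact: Nc. Qed.

(* [dot a e] is recovered from the tangential part of [a] by pairing with the tangent vector [(e, dot p e)]. *)
Let dot_tangent (p a : 'rV[R]_n) :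
  dot (a *m (L *m (1%:M - line_proj (graph_normal p)))) (e *m L + dot p e *: phi0 R n) = dot a e.
Proof.
have [e0 _] := graph_embE e; have [a0 _] := graph_embE a.
have z : dot (graph_normal p) (e *m L + dot p e *: phi0 R n) = 0.
  rewrite /graph_normal dotBl !dotDr !dotZr dot_graph_emb !dot_phi0 (graph_embE p).1.
  by rewrite (dotC (phi0 R n) (e *m _)) dot_phi0 e0 phi0_ord0; ring.
rewrite mulmxA mulmxBr mulmx1 dotBl dot_proj z mulr0 mul0r subr0.
by rewrite dotDr dot_graph_emb dotZr dot_phi0 a0 mulr0 addr0.
Qed.

(** The reflection costs at most [th] times the square of [dot a e + dot b e]. Written with tangent
    vectors [f1], [f2], this pairs [x + y] with [f1 + f2], of length of order [w], and [x - y] with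
    [f1 - f2], of length at most [h * w / 2]. The pair form controls [x - y] only with weight [k],
    of order [h^2], and that is just what the shorter vector requires. *)
Let form_ge0 u : 0 <= dot (u *m block_mx (L *m T1 *m L^T) C C^T (L *m T2 *m L^T)) u.
Proof.
rewrite -[u]hsubmxK form; set a := lsubmx u; set b := rsubmx u.
rewrite -(dot_tangent p1 a) -(dot_tangent p2 b) -/v1 -/v2 -/P1 -/P2.
set x := a *m (L *m P1); set y := b *m (L *m P2).
set f1 := e *m L + _; set f2 := e *m L + _.
have pf := pair_form_ge N1s N2s c0 N12 kE hK x y T1E T2E.
apply: le_trans (_ : 0 <= pair_form N1 N2 k x y - th * (dot x f1 + dot y f2) ^+ 2) _; last first.
  have : 0 <= th * (dot x f1 - dot y f2) ^+ 2 by rewrite mulr_ge0 ?sqr_ge0 ?(ltW th0).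
  move: (pair_form _ _ _ _ _) (dot x f1) (dot y f2) => A1 A2 A3; lra.
rewrite subr_ge0; apply: le_trans pf.
rewrite (dot_polar x y f1 f2).
have CS1 := cauchy_schwarz (x + y) (f1 + f2); have CS2 := cauchy_schwarz (x - y) (f1 - f2).
have F1 : dot (f1 + f2) (f1 + f2) <= 13 * w ^+ 2.
  have -> : f1 + f2 = 2 *: (e *m L) + (dot p1 e + dot p2 e) *: phi0 R n.
    by rewrite /f1 /f2 addrACA -mulr2n -scaler_nat (scalerDl (phi0 R n)).
  rewrite !dotDl !dotDr !dotZl !dotZr dot_graph_emb !dot_phi0 (dotC (phi0 R n)) dot_phi0.
  rewrite (graph_embE e).1 phi0_ord0 e1 mulr1 /=.
  have /andP[l1 l2] := p1e.
  have : (dot p1 e + w) ^+ 2 <= (3 * w) ^+ 2 by rewrite ler_sqr ?nnegrE; lra.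
  have : 1 <= w ^+ 2 by rewrite expr_ge1 // ltW.
  lra.
have F2 : dot (f1 - f2) (f1 - f2) <= h ^+ 2 * w ^+ 2 / 4.
  have -> : f1 - f2 = dot (p1 - p2) e *: phi0 R n.
    by rewrite /f1 /f2 opprD addrACA subrr add0r dotBl scalerBl.
  rewrite dotZl dotZr dot_phi0 phi0_ord0 mulr1 -expr2.
  apply: le_trans (cauchy_schwarz _ _) _; rewrite e1 mulr1 dot_enorm.
  have -> : h ^+ 2 * w ^+ 2 / 4 = (h / 2 * w) ^+ 2 by field.
  rewrite ler_sqr ?nnegrE ?enorm_ge0 // mulr_ge0 ?(ltW w0) // divr_ge0 //.
  by case/andP: h0.
have s0 := dot_ge0 (x + y); have d0 := dot_ge0 (x - y).
have G1 : dot (x + y) (f1 + f2) ^+ 2 <= dot (x + y) (x + y) * (13 * w ^+ 2).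
  by apply: le_trans CS1 _; rewrite ler_wpM2l.
have G2 : dot (x - y) (f1 - f2) ^+ 2 <= dot (x - y) (x - y) * (h ^+ 2 * w ^+ 2 / 4).
  by apply: le_trans CS2 _; rewrite ler_wpM2l.
have G : (2^-1 * dot (x + y) (f1 + f2) + 2^-1 * dot (x - y) (f1 - f2)) ^+ 2 <=
   2^-1 * (dot (x + y) (x + y) * (13 * w ^+ 2))
   + 2^-1 * (dot (x - y) (x - y) * (h ^+ 2 * w ^+ 2 / 4)).
  have := sqr_ge0 (dot (x + y) (f1 + f2) - dot (x - y) (f1 - f2)); lra.
apply: le_trans (ler_wpM2l (ltW th0) G) _.
have -> : th * (2^-1 * (dot (x + y) (x + y) * (13 * w ^+ 2))
   + 2^-1 * (dot (x - y) (x - y) * (h ^+ 2 * w ^+ 2 / 4)))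
  = (13 * c / 80) * dot (x + y) (x + y) + (c * h ^+ 2 / 320) * dot (x - y) (x - y).
  by rewrite /th; field; rewrite gt_eqF.
have kh : c * h ^+ 2 <= k.
  rewrite /k ler_wpM2r ?sqr_ge0 // /K lerDr.
  by apply: divr_ge0; [exact: sqr_ge0|exact: ltW].
have ch : 0 <= c * h ^+ 2 by rewrite mulr_ge0 ?sqr_ge0 // ltW.
by have c0' := c0; apply: lerD; rewrite ler_wpM2r //; lra.
Qed.

(* The rows of [X] and [Y] are the pairs of directions (xi, eta). *)
Lemma coupling : exists X Y : 'M[R]_(n + n, n),
  [/\ X^T *m X = L *m T1 *m L^T, Y^T *m Y = L *m T2 *m L^T,
      c / 20 <= \sum_i (dot p1 (row i X) - dot p2 (row i Y)) ^+ 2,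
      4 * th <= \sum_i dot e (row i X - row i Y) ^+ 2 &
      \sum_i dot (row i X - row i Y) (row i X - row i Y) <=
        4 * th + n%:R * (4 * (B + c) + 2 * D' + 2 * K) * h ^+ 2].
Proof.
have Ms : (block_mx (L *m T1 *m L^T) C C^T (L *m T2 *m L^T))^T
   = block_mx (L *m T1 *m L^T) C C^T (L *m T2 *m L^T).
  by rewrite tr_block_mx trmxK !trmx_mul !trmxK T1s T2s !mulmxA.
have [Q EQ] := psd_factor Ms form_ge0.
rewrite -[Q]hsubmxK in EQ; set X := lsubmx Q in EQ; set Y := rsubmx Q in EQ.
have fsum a b : \sum_i (dot a (row i X) + dot b (row i Y)) ^+ 2 =
  pair_form N1 N2 k (a *m (L *m P1)) (b *m (L *m P2)) - 4 * th * (dot a e * dot b e).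
  by rewrite sum_sqr_factor -form EQ.
have pf0 x y : 0 <= pair_form N1 N2 k x y.
  apply: le_trans (pair_form_ge N1s N2s c0 N12 kE hK x y T1E T2E).
  have k0 : 0 <= k by rewrite -(pmulr_rge0 k c0); exact: le_trans (sqr_ge0 _) kE.
  by rewrite addr_ge0 // mulr_ge0 ?dot_ge0 // divr_ge0 // ltW.
exists X, Y; rewrite tr_row_mx mul_col_row in EQ.
have [<- _ _ <-] := eq_block_mx EQ; split => //.
- under eq_bigr do rewrite -dotNl.
  rewrite fsum dotNl dotZl e1 mulr1.
  apply: le_trans (_ : 4 * th * (dot p1 e * w) <= _); last first.
    by rewrite mulrN mulrN opprK lerDr.
  (* Evaluated at [(p1, - p2)] the reflection contributes [4 * th * w * dot p1 e], and
     [dot p1 e >= w / 2]. The slope cancels; this is the origin of [c / 20]. *)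
  have -> : c / 20 = 4 * th * (w / 2 * w) by rewrite /th; field; rewrite gt_eqF.
  apply: ler_wpM2l; first by apply: mulr_ge0 => //; exact: ltW.
  apply: ler_wpM2r; first exact: ltW.
  by case/andP: p1e.
- under eq_bigr do rewrite dotBr -dotNl.
  by rewrite fsum dotNl e1 mulrN1 mulrN opprK mulr1 lerDr.
(* Coordinate by coordinate, the squared distance of the rows is the form at
   [(delta_j, - delta_j)]. *)
have -> : \sum_i dot (row i X - row i Y) (row i X - row i Y) =
  \sum_(j < n) \sum_i (dot (delta_mx 0 j) (row i X) + dot (- delta_mx 0 j) (row i Y)) ^+ 2.
  rewrite exchange_big /=; apply: eq_bigr => i _; rewrite dotE; apply: eq_bigr => j _.
  by rewrite dotNl !dot_delta !mxE expr2.
under eq_bigr do rewrite fsum dotNl dot_delta.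
have step (j : 'I_n) : pair_form N1 N2 k (delta_mx 0 j *m (L *m P1)) (- delta_mx 0 j *m (L *m P2))
    - 4 * th * (e 0 j * - e 0 j)
    <= 4 * th * (e 0 j * e 0 j) + (4 * (B + c) + 2 * D' + 2 * K) * h ^+ 2.
  rewrite addrC mulrN mulrN opprK lerD2l.
  have := pair_form_le N1s N2s c0 N12 kE (delta_mx 0 j *m (L *m P1))
    (- delta_mx 0 j *m (L *m P2)) (NB v1n0 T1B) (NB v2n0 T2B).
  move=> H; apply: le_trans H _.
  rewrite mulNmx opprK.
  (* At such an argument the sum [s] of the tangential parts is a difference of two projections, of
     size at most [2 * h], while [d] is bounded; every term of [pair_form_le] is thus of order
     [h^2]. *)
  set s := (_ *m _ - _ *m _); set d := (_ *m (L *m P1) + _).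
  set u := (delta_mx 0 j : 'rV_n) *m L.
  have u1 : enorm u = 1 by rewrite enormE dot_graph_emb -enormE enorm_delta.
  have s2 : enorm s <= 2 * h.
    have -> : s = - (u *m (line_proj v1 - line_proj v2)).
      rewrite /s /P1 /P2 !mulmxA -/u !mulmxBr mulmx1 !opprB.
      by rewrite addrC addrA subrK.
    rewrite enormN; have := opbound_enorm u (opbound_proj_diff v1n0 v2n0 normal_dist).
    by rewrite u1 mulr1.
  have Pn v : v != 0 -> enorm (u *m (1%:M - line_proj v)) <= 1.
    by move=> vn0; apply: le_trans (enorm_tangent u vn0) _; rewrite u1.
  have d2 : enorm d <= 2.
    apply: le_trans (enormD _ _) _; rewrite !mulmxA -/u.
    by have := Pn _ v1n0; have := Pn _ v2n0; rewrite -/P1 -/P2; lra.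
  have s0 := enorm_ge0 s; have d0 := enorm_ge0 d.
  have k0 : 0 <= k by rewrite -(pmulr_rge0 k c0); exact: le_trans (sqr_ge0 _) kE.
  have h00 : 0 <= h by case/andP: h0.
  have S1 : (B + c) * enorm s ^+ 2 <= (B + c) * (2 * h) ^+ 2.
    by rewrite ler_wpM2l ?addr_ge0 ?(ltW c0) // ler_sqr ?nnegrE // mulr_ge0.
  have S2 : 2^-1 * (D' * h) * (enorm s * enorm d) <= 2^-1 * (D' * h) * (2 * h * 2).
    by rewrite ler_wpM2l ?mulr_ge0 // ler_pM.
  have S3 : k / 2 * enorm d ^+ 2 <= k / 2 * 2 ^+ 2.
    by rewrite ler_wpM2l ?divr_ge0 // ler_sqr ?nnegrE.
  have Ek : k = K * h ^+ 2 by [].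
  lra.
apply: le_trans (ler_sum _ (fun j _ => step j)) _.
rewrite big_split /= -mulr_sumr -dotE e1 mulr1 lerD2l.
by rewrite sumr_const card_ord -[leLHS]mulr_natl mulrA.
Qed.

End CouplingLemma.

(** * The integrand *)

Lemma is_derive_unique (R : realType) (V : normedModType R) (f : V -> R) (x v : V) (a b : R) :
  is_derive x v f a -> is_derive x v f b -> a = b.
Proof. by move=> [_ <-] [_ <-]. Qed.

Lemma row_bvec (R : realType) (m : nat) (v : 'rV[R]_m) : v = \sum_i v 0 i *: bvec R i.
Proof.
rewrite {1}[v]row_sum_delta; apply: eq_bigr => i _; congr (_ *: _).
by apply/rowP => j; rewrite !mxE eqxx.
Qed.

(** The smoothness hypotheses speak of basis directions only. Adding one basis vector at a time,
    continuity of the partial derivatives yields every direction, linearly in [v]. *)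
Lemma is_derive_basis (R : realType) (m : nat) (f : 'rV[R]_m -> R)
    (df : 'I_m -> 'rV[R]_m -> R) (x : 'rV[R]_m) :
  (forall i, \forall y \near x, is_derive y (bvec R i) f (df i y)) ->
  (forall i, {for x, continuous (df i)}) ->
  forall v, is_derive x v f (\sum_i v 0 i * df i x).
Proof.
move=> Hd Hc v; rewrite [v in is_derive _ v]row_bvec.
elim: (index_enum _) => [|i r IH]; first by rewrite !big_nil; exact: is_derive0.
by rewrite !big_cons addrC [X in is_derive _ _ _ X]addrC; exact: is_derive_add_dir.
Qed.

Lemma is_derive_scale (R : realType) (V : normedModType R) (f : V -> R) (x v : V)
    (c a d : R) : c != 0 -> (forall p, f (c *: p) = a * f p) ->
  is_derive x v f d -> is_derive (c *: x) v f (a / c * d).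
Proof.
move=> c0 H Hd.
have H0 : is_derive (0 : R) 1 (fun h => f (x + h *: v)) d.
  by apply: (iffLR (is_derive_line f x v 0 d)); rewrite scale0r addr0.
have H1 : is_derive (0 : R) 1 (fun h => f (c *: x + h *: v)) (a / c * d).
  have -> : (fun h => f (c *: x + h *: v)) = a \*: ((fun h => f (x + h *: v)) \o ( *%R c^-1)).
    by apply/funext => h /=; rewrite -[RHS]H scalerDr scalerA mulrA mulfV // mul1r.
  have Hk : is_derive (0 : R) 1 ( *%R c^-1) c^-1.
    exact: (is_derive_eq (is_deriveZ c^-1 (is_derive_id (0 : R) 1)) (mulr1 _)).
  rewrite -[0](mulr0 c^-1) in H0; have H2 := is_derive1_comp H0 Hk.
  have H3 := is_deriveZ a H2; apply: is_derive_eq H3 _.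
  by rewrite /= /GRing.scale /=; ring.
have := iffRL (is_derive_line f (c *: x) v 0 (a / c * d)) H1.
by rewrite scale0r addr0.
Qed.

Lemma is_derive_radial (R : realType) (V : normedModType R) (f : V -> R) (x : V) :
  (forall (c : R), 0 < c -> f (c *: x) = f x) -> is_derive x x f 0.
Proof.
move=> H.
have H1 : is_derive (0 : R) 1 (fun h => f (x + h *: x)) 0.
  apply: (near_eq_is_derive (f := cst (f x))).
  apply/nbhs_ballP; exists 1 => //= h; rewrite /ball /= sub0r normrN => h1.
  rewrite -{2}[x]scale1r -scalerDl H //.
  by move: h1; rewrite ltr_norml; lra.
have := iffRL (is_derive_line f x x 0 0) H1.
by rewrite scale0r addr0.
Qed.

Lemma compact_norm_bound (R : realType) (m : nat) (K : set 'rV[R]_m) (f : 'rV[R]_m -> R) :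
  compact K -> (forall x, K x -> {for x, continuous f}) ->
  exists2 B, 0 <= B & forall x, K x -> `|f x| <= B.
Proof.
move=> cK cf; have [K0|/set0P/negP/negPn/eqP K0] := pselect (K !=set0); last first.
  by exists 0 => // x; rewrite K0.
have [|c cinK H] := @EVT_max_rV R m (fun x => `|f x|) K K0 cK.
  apply: continuous_in_subspaceT => x /set_mem Kx.
  exact: (@continuous_comp _ _ _ f (fun t : R => `|t|) x (cf x Kx) (@norm_continuous _ _ _)).
by exists `|f c| => // x Kx; apply: H; exact/mem_set.
Qed.

Lemma finite_uniform_bound (R : realType) (I : finType) (P : I -> R -> Prop) :
  (forall i (a b : R), a <= b -> P i a -> P i b) ->
  (forall i, exists2 B, 0 <= B & P i B) -> exists2 B : R, 0 <= B & forall i, P i B.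
Proof.
move=> mono H; have /choice [f Hf] : forall i, exists B, 0 <= B /\ P i B.
  by move=> i; have [B ? ?] := H i; exists B.
have f0 i : 0 <= f i by case: (Hf i).
exists (\sum_i f i) => [|i]; first exact: sumr_ge0.
apply: mono (Hf i).2; rewrite (bigD1 i) //= lerDl; exact: sumr_ge0.
Qed.

(** The norm [|x|] is the maximum norm, in which topology and compactness are expressed, whereas the
    estimates use the Euclidean [enorm]; the comparisons between the two produce the dimensional
    factors below. *)
Lemma norm_le_enorm (R : realType) (m : nat) (x : 'rV[R]_m) : `|x| <= enorm x.
Proof.
rewrite [leLHS]/Num.norm /= mx_normrE; apply/bigmax_leP; split => [|[i j] _ /=].
  exact: enorm_ge0.
by rewrite ord1 coord_le_enorm.
Qed.

Lemma coord_le_norm (R : realType) (m : nat) (x : 'rV[R]_m) j : `|x 0 j| <= `|x|.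
Proof.
rewrite [leRHS]/Num.norm /= mx_normrE; apply/bigmax_geP; right => /=.
by exists (ord0, j).
Qed.

Lemma enorm_le_norm (R : realType) (m : nat) (x : 'rV[R]_m) : enorm x <= m%:R * `|x|.
Proof.
have E : dot x x <= (m%:R * `|x|) ^+ 2.
  rewrite dotE; apply: le_trans (_ : m%:R * `|x| ^+ 2 <= _).
    rewrite mulr_natl -[m in _ *+ m]card_ord -sumr_const ler_sum // => j _.
    by rewrite -expr2 -real_normK ?num_real // ler_sqr ?nnegrE // coord_le_norm.
  rewrite exprMn ler_wpM2r ?sqr_ge0 // -natrX ler_nat.
  by case: m {x} => // k; rewrite -[leqLHS]expn1 leq_pexp2l.
rewrite enormE -[leRHS]ger0_norm ?mulr_ge0 // -sqrtr_sqr.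
by rewrite ler_wsqrtr.
Qed.

Lemma annulus_compact (R : realType) (m : nat) (a b : R) :
  compact [set x : 'rV[R]_m | a <= `|x| <= b].
Proof.
apply: bounded_closed_compact.
  exists b; split; first exact: num_real.
  by move=> M bM x /= /andP[_ xb]; exact: le_trans xb (ltW bM).
have -> : [set x : 'rV[R]_m | a <= `|x| <= b] = (fun x => `|x|) @^-1` `[a, b].
  by apply/funext => x; rewrite /= in_itv.
apply: closed_comp => [x _|]; first exact: norm_continuous.
exact: itv_closed.
Qed.

Lemma near_neq0 (R : realType) (V : normedModType R) (x : V) :
  x != 0 -> \forall y \near x, y != 0.
Proof.
move=> x0; apply/nbhs_normP; exists `|x|; first by rewrite /= normr_gt0.
by move=> y /= xy; apply: contraTneq xy => ->; rewrite subr0 ltxx.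
Qed.

(** The factor [F nu] makes the matrix homogeneous of degree zero in [nu], so bounds on a sphere are
    global. *)
Definition hess_mx (R : realType) (n : nat) (F : 'rV[R]_n.+1 -> R) (nu : 'rV[R]_n.+1) :
  'M[R]_n.+1 := \matrix_(i, j) (F nu * D2F F nu (bvec R i) (bvec R j)).

Section Integrand.
Variables (R : realType) (n : nat) (F : 'rV[R]_n.+1 -> R).
Hypothesis HF : standing_assumptions F.
Let b := @bvec R n.+1.
Let g1 i := 'D_(b i) F.
Let g2 i j := 'D_(b i) ('D_(b j) F).
Let g3 k i j := 'D_(b k) ('D_(b i) ('D_(b j) F)).

Let F_gt0 (p : 'rV[R]_n.+1) : p != 0 -> 0 < F p. Proof. by case: HF => H _; exact: H. Qed.
Let F_hom (c : R) (p : 'rV[R]_n.+1) : 0 < c -> F (c *: p) = c * F p.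
Proof. by case: HF => _ [_ [_ [H _]]]; exact: H. Qed.

Let b_in i : b i \in basis_seq R n.+1.
Proof. by apply/mapP; exists i => //; rewrite mem_enum. Qed.

Let iterD_derive vs (x : 'rV[R]_n.+1) i : (size vs < 3)%N -> all (fun v => v \in basis_seq R n.+1) vs ->
  x != 0 -> is_derive x (b i) (Defs.iterD vs F) (Defs.iterD (b i :: vs) F x).
Proof.
move=> s3 a x0; apply: derivableP.
by case: HF => _ [_ [[H _] _]]; exact: H.
Qed.

Let iterD_cont vs (x : 'rV[R]_n.+1) : (size vs <= 3)%N -> all (fun v => v \in basis_seq R n.+1) vs ->
  x != 0 -> {for x, continuous (Defs.iterD vs F)}.
Proof. by move=> s3 a x0; case: HF => _ [_ [[_ H] _]]; exact: H. Qed.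

Let dF (x : 'rV[R]_n.+1) i : x != 0 -> is_derive x (b i) F (g1 i x).
Proof. by move=> x0; apply: (@iterD_derive [::]). Qed.
Let dg1 (x : 'rV[R]_n.+1) i j : x != 0 -> is_derive x (b i) (g1 j) (g2 i j x).
Proof. by move=> x0; apply: (@iterD_derive [:: b j]) => //=; rewrite b_in. Qed.
Let dg2 (x : 'rV[R]_n.+1) k i j : x != 0 -> is_derive x (b k) (g2 i j) (g3 k i j x).
Proof. by move=> x0; apply: (@iterD_derive [:: b i; b j]) => //=; rewrite !b_in. Qed.
Let cF (x : 'rV[R]_n.+1) : x != 0 -> {for x, continuous F}.
Proof. by move=> x0; apply: (@iterD_cont [::]). Qed.
Let cg1 (x : 'rV[R]_n.+1) i : x != 0 -> {for x, continuous (g1 i)}.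
Proof. by move=> x0; apply: (@iterD_cont [:: b i]) => //=; rewrite !b_in. Qed.
Let cg2 (x : 'rV[R]_n.+1) i j : x != 0 -> {for x, continuous (g2 i j)}.
Proof. by move=> x0; apply: (@iterD_cont [:: b i; b j]) => //=; rewrite !b_in. Qed.
Let cg3 (x : 'rV[R]_n.+1) k i j : x != 0 -> {for x, continuous (g3 k i j)}.
Proof. by move=> x0; apply: (@iterD_cont [:: b k; b i; b j]) => //=; rewrite !b_in. Qed.

Let dF_dir (x : 'rV[R]_n.+1) v : x != 0 -> is_derive x v F (\sum_i v 0 i * g1 i x).
Proof.
move=> x0; apply: is_derive_basis => i; last exact: cg1.
by have N := near_neq0 x0; apply: filterS N => y; exact: dF.
Qed.

Let dg1_dir (x : 'rV[R]_n.+1) v j : x != 0 -> is_derive x v (g1 j) (\sum_i v 0 i * g2 i j x).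
Proof.
move=> x0; apply: (is_derive_basis (df := fun i => g2 i j)) => i; last exact: cg2.
by have N := near_neq0 x0; apply: filterS N => y; exact: dg1.
Qed.

Let g2_sym (x : 'rV[R]_n.+1) i j : x != 0 -> g2 i j x = g2 j i x.
Proof.
move=> x0; apply: (@mixed_derivative_sym _ _ F (g1 i) (g1 j) (g2 i j) (g2 j i) x (b i) (b j)).
- apply: filterS (near_neq0 x0) => y y0.
  by split; [exact: dF|exact: dF|exact: dg1|exact: dg1].
- exact: cg2.
- exact: cg2.
Qed.

Let g1_hom (x : 'rV[R]_n.+1) (c : R) i : 0 < c -> x != 0 -> g1 i (c *: x) = g1 i x.
Proof.
move=> c0 x0; have cx0 : c *: x != 0 by rewrite scaler_eq0 negb_or gt_eqF.
have := @is_derive_scale _ _ F x (b i) c c _ (lt0r_neq0 c0) _ (dF i x0).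
move=> /(_ (fun p => F_hom p c0)) H.
rewrite (is_derive_unique (dF i cx0) H); field; exact: lt0r_neq0.
Qed.

Let g2_hom (x : 'rV[R]_n.+1) (c : R) i j : 0 < c -> x != 0 -> g2 i j (c *: x) = g2 i j x / c.
Proof.
move=> c0 x0; have cx0 : c *: x != 0 by rewrite scaler_eq0 negb_or gt_eqF.
have H (p : 'rV[R]_n.+1) : g1 j (c *: p) = 1 * g1 j p.
  by have [->|p0] := eqVneq p 0; rewrite ?scaler0 mul1r // g1_hom.
have Hd := is_derive_scale (lt0r_neq0 c0) H (dg1 i j x0).
by rewrite (is_derive_unique (dg1 i j cx0) Hd) div1r mulrC.
Qed.

Let hess := hess_mx F.

Let hessE x i j : hess x i j = F x * g2 i j x.
Proof. by rewrite /hess /hess_mx mxE. Qed.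

Let hess_hom (x : 'rV[R]_n.+1) (c : R) : 0 < c -> x != 0 -> hess (c *: x) = hess x.
Proof.
move=> c0 x0.
have E i j : F (c *: x) * g2 i j (c *: x) = F x * g2 i j x.
  by rewrite (F_hom x c0) (g2_hom i j c0 x0); field; exact: lt0r_neq0.
apply/matrixP => i j.
exact: etrans (hessE (c *: x) i j) (etrans (E i j) (esym (hessE x i j))).
Qed.

Let hess_sym (x : 'rV[R]_n.+1) : x != 0 -> (hess x)^T = hess x.
Proof.
move=> x0; apply/matrixP => i j; rewrite [LHS]mxE.
have E : F x * g2 j i x = F x * g2 i j x by rewrite (g2_sym j i x0).
exact: etrans (hessE x j i) (etrans E (esym (hessE x i j))).
Qed.

(** The first partials of [F] are homogeneous of degree zero, hence constant along rays, and their
    radial derivatives vanish. *)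
Let hess_ker (x : 'rV[R]_n.+1) : x != 0 -> x *m hess x = 0.
Proof.
move=> x0; apply/rowP => j; rewrite [RHS]mxE mxE.
have H1 : is_derive x x (g1 j) 0 by apply: is_derive_radial => c c0; exact: g1_hom.
have := is_derive_unique (dg1_dir x j x0) H1 => E.
transitivity (F x * \sum_i x 0 i * g2 i j x); last by rewrite E mulr0.
rewrite mulr_sumr; apply: eq_bigr => i _; rewrite hessE; ring.
Qed.

Let euler (x : 'rV[R]_n.+1) : x != 0 -> \sum_i x 0 i * g1 i x = F x.
Proof.
move=> x0; apply: is_derive_unique (dF_dir x x0) _.
have H1 : is_derive (0 : R) 1 (fun h => F (x + h *: x)) (F x).
  apply: (near_eq_is_derive (f := (fun h : R => F x) + ((F x) \*: (@id R)))).
    apply/nbhs_ballP; exists 1 => //= h; rewrite /ball /= sub0r normrN => h1.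
    rewrite -{3}[x]scale1r -scalerDl F_hom /=; last by move: h1; rewrite ltr_norml; lra.
    by rewrite fctE /= /GRing.scale /=; ring.
  have D := is_deriveD (is_derive_cst (F x) (0 : R) 1) (is_deriveZ (F x) (is_derive_id (0 : R) 1)).
  by apply: is_derive_eq D _; rewrite add0r /GRing.scale /= mulr1.
have := iffRL (is_derive_line F x x 0 (F x)) H1.
by rewrite scale0r addr0.
Qed.

Let hess_form (x v : 'rV[R]_n.+1) :
  dot (v *m hess x) v = F x * \sum_j v 0 j * \sum_i v 0 i * g2 i j x.
Proof.
rewrite dotE mulr_sumr; apply: eq_bigr => j _.
have E : (v *m hess x) 0 j = F x * \sum_i v 0 i * g2 i j x.
  rewrite mxE mulr_sumr; apply: eq_bigr => i _.
  by apply: etrans (congr1 ( *%R (v 0 i)) (hessE x i j)) _; ring.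
by rewrite E; ring.
Qed.

Let deriv_line (x v : 'rV[R]_n.+1) : x != 0 ->
  \forall h \near (0 : R), is_derive (h : R) 1 (fun h => F (x + h *: v))
    (\sum_i v 0 i * g1 i (x + h *: v)).
Proof.
move=> x0; have /nbhs_normP [r /= r0 Hr] := near_neq0 x0.
have v0 : 0 < `|v| + 1 by rewrite ltr_wpDl.
apply/nbhs_ballP; exists (r / (`|v| + 1)); first by rewrite /= divr_gt0.
move=> h; rewrite /ball /= sub0r normrN ltr_pdivlMr // => hr.
apply: (iffLR (is_derive_line F x v h _)); apply: dF_dir; apply: Hr.
rewrite /= opprD addrA subrr sub0r normrN normrZ; apply: le_lt_trans hr.
by rewrite ler_wpM2l // lerDl.
Qed.

Let deriv2_line (x v : 'rV[R]_n.+1) : x != 0 ->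
  is_derive (0 : R) 1 (fun h => \sum_i v 0 i * g1 i (x + h *: v))
    (\sum_j v 0 j * \sum_i v 0 i * g2 i j x).
Proof.
move=> x0.
have H : is_derive x v (\sum_j (v 0 j \*: g1 j)) (\sum_j v 0 j * \sum_i v 0 i * g2 i j x).
  by apply: is_derive_sum => j; exact: is_deriveZ (dg1_dir v j x0).
have E : (fun h : R => \sum_i v 0 i * g1 i (x + h *: v))
  = (fun h => (\sum_j (v 0 j \*: g1 j)) (x + h *: v)).
  by apply/funext => h; rewrite fct_sumE.
by rewrite E; apply: (iffLR (is_derive_line _ x v 0 _)); rewrite scale0r addr0.
Qed.

(* Near [x] the level set lies below the parabola of curvature [D'] if the second derivative is smaller than [D']; uniform convexity at the points [x + h v] and [x - h v] then bounds [D'] from below. *)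
Let tangent_bound (c : R) (x v : 'rV[R]_n.+1) : 0 < c ->
  (forall X Y z, F X <= 1 -> F Y <= 1 ->
    enorm (z - 2^-1 *: (X + Y)) <= c * enorm (X - Y) ^+ 2 -> F z <= 1) ->
  F x = 1 -> x != 0 -> \sum_i v 0 i * g1 i x = 0 ->
  8 * c * dot v v / enorm x <= \sum_j v 0 j * \sum_i v 0 i * g2 i j x.
Proof.
move=> c0 U Fx x0 tv; set S := 8 * c * _ / _; set D := \sum_j _.
have nx : 0 < enorm x by rewrite enorm_gt0.
have S0 : 0 <= S.
  apply: divr_ge0; last exact: ltW.
  by apply: mulr_ge0; [apply: mulr_ge0 => //; exact: ltW|exact: dot_ge0].
rewrite leNgt; apply/negP => DS.
have Spos : 0 < S.
  rewrite lt_def S0 andbT; apply: contraTneq DS => S1; rewrite S1 -leNgt.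
  have v0 : v = 0.
    apply/eqP; rewrite -dot_eq0; apply/eqP; apply: (mulfI (lt0r_neq0 c0)).
    have -> : c * dot v v = S * enorm x / 8 by rewrite /S; field; rewrite gt_eqF.
    by rewrite S1 !mul0r mulr0.
  by rewrite /D v0 big1 // => j _; rewrite mxE mul0r.
have [D' [D'D D'0 D'S]] : exists D', [/\ D < D', 0 < D' & D' < S].
  have [D0|D0] := leP D 0; first by exists (S / 2); split; lra.
  by exists ((D + S) / 2); split; lra.
pose q : R -> R := (D' / 2) \*: (@id R ^+ 2).
have qE (h : R) : q h = D' / 2 * h ^+ 2 by [].
have dq (h : R) : is_derive h 1 q (D' * h).
  apply: is_derive_eq (is_deriveZ (D' / 2) (is_deriveX 2 (is_derive_id (h : R) 1))) _.
  by rewrite /GRing.scale /=; field.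
have H1 : \forall h \near (0 : R), is_derive (h : R) 1 ((fun h => F (x + h *: v)) - q)
    (((fun h => \sum_i v 0 i * g1 i (x + h *: v)) - (fun h : R => D' * h)) h).
  by apply: filterS (deriv_line v x0) => h Hh; exact: is_deriveB Hh (dq h).
have H2 : is_derive (0 : R) 1 ((fun h => \sum_i v 0 i * g1 i (x + h *: v)) - (fun h : R => D' * h))
    (D - D').
  apply: is_deriveB; first exact: deriv2_line.
  by apply: is_derive_eq (is_deriveZ D' (is_derive_id (0 : R) 1)) _; rewrite /GRing.scale /= mulr1.
have H3 : ((fun h => \sum_i v 0 i * g1 i (x + h *: v)) - (fun h : R => D' * h)) 0 = 0.
  rewrite fctE /= scale0r addr0 tv add0r; exact: etrans (congr1 -%R (mulr0 D')) (oppr0 R).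
have DD' : D - D' < 0 by rewrite subr_lt0.
have /nbhs_ballP [r /= r0 Hr] := deriv2_lt0_max H1 H3 H2 DD'.
pose e := (S - D') / (D' ^+ 2 + 1).
have D'2 : 0 < D' ^+ 2 + 1 by rewrite ltr_wpDl ?sqr_ge0.
have e0 : 0 < e by rewrite divr_gt0 // subr_gt0.
pose h := Num.min r (Num.min 1 e) / 2.
have m0 : 0 < Num.min r (Num.min 1 e) by rewrite !lt_min r0 e0 ltr01.
have h0 : 0 < h by rewrite divr_gt0.
have hm : h < Num.min r (Num.min 1 e) by rewrite /h; lra.
move: (hm); rewrite !lt_min => /and3P [hr h1 he].
(* By the parabola bound, division by [l] brings both [x + h v] and [x - h v] into the set where
   [F <= 1]. The choice of [e] makes [h] small enough that [l * D'] is still below [S]. *)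
pose l := 1 + D' * h ^+ 2 / 2.
have lD' : l * D' < S.
  have h2 : h ^+ 2 <= h by rewrite expr2 ler_piMl ?ltW.
  move: he; rewrite /e ltr_pdivlMr // => he.
  have : D' ^+ 2 * h ^+ 2 <= D' ^+ 2 * h by rewrite ler_wpM2l ?sqr_ge0.
  have : 0 <= D' ^+ 2 * h by rewrite mulr_ge0 ?sqr_ge0 ?ltW.
  rewrite /l; nra.
have l1 : 1 <= l.
  by rewrite /l lerDl; apply: divr_ge0 => //; apply: mulr_ge0; [exact: ltW|exact: sqr_ge0].
have l0 : 0 < l by exact: lt_le_trans ltr01 l1.
have below (s : R) : s = h \/ s = - h -> F (l^-1 *: (x + s *: v)) <= 1.
  move=> Hs; have s2 : s ^+ 2 = h ^+ 2 by case: Hs => ->; rewrite ?sqrrN.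
  have sn : `|s| = h by case: Hs => ->; rewrite ?normrN gtr0_norm.
  have H : F (x + s *: v) - q s < F (x + 0 *: v) - q 0.
    apply: Hr; first by rewrite /ball /= sub0r normrN sn.
    by rewrite -normr_eq0 sn gt_eqF.
  move: H; rewrite scale0r addr0 Fx !qE s2 expr0n /= mulr0 subr0 => H.
  rewrite F_hom ?invr_gt0 // ler_pdivrMl // mulr1 /l; lra.
(* The displacement that uniform convexity allows around the midpoint [x / l]. Spent in the
   direction of [x], it gives [1 / l + s / enorm x <= 1], that is, [S <= l * D']. *)
pose s := c * (4 * h ^+ 2 * dot v v / l ^+ 2).
have s0 : 0 <= s.
  apply: mulr_ge0; first exact: ltW.
  apply: divr_ge0; last exact: sqr_ge0.
  by apply: mulr_ge0; [apply: mulr_ge0 => //; exact: sqr_ge0|exact: dot_ge0].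
have := U _ _ ((l^-1 + s / enorm x) *: x) (below h (or_introl erefl))
  (below (- h) (or_intror erefl)).
have -> : l^-1 *: (x + h *: v) - l^-1 *: (x + - h *: v) = (2 * h / l) *: v.
  rewrite -scalerBr opprD addrACA subrr add0r scaleNr opprK -scalerDl scalerA.
  by congr (_ *: _); ring.
have -> : (l^-1 + s / enorm x) *: x - 2^-1 *: (l^-1 *: (x + h *: v) + l^-1 *: (x + - h *: v))
   = (s / enorm x) *: x.
  have Ex : x + h *: v + (x + - h *: v) = 2 *: x.
    by rewrite addrACA scaleNr subrr addr0 scaler_nat mulr2n.
  rewrite -scalerDr Ex !scalerA -scalerBl.
  by congr (_ *: _); field; rewrite gt_eqF // gt_eqF.
rewrite !enormZ exprMn -dot_enorm real_normK ?num_real //.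
have sx : 0 <= s / enorm x by apply: divr_ge0 => //; exact: ltW.
rewrite (ger0_norm sx) divfK ?gt_eqF //.
have -> : c * ((2 * h / l) ^+ 2 * dot v v) = s by rewrite /s; field; rewrite gt_eqF.
move=> /(_ (lexx _)); rewrite F_hom; last by rewrite ltr_wpDr ?invr_gt0 // divr_ge0 // ltW.
rewrite Fx mulr1 => H.
have : l * (l^-1 + s / enorm x) <= l by rewrite -[leRHS]mulr1 ler_wpM2l // ltW.
have -> : l * (l^-1 + s / enorm x) = 1 + (S / l) * (h ^+ 2 / 2).
  by rewrite /s /S; field; rewrite !gt_eqF.
have h2 : 0 < h ^+ 2 / 2 by rewrite divr_gt0 ?exprn_gt0.
have El : l = 1 + D' * (h ^+ 2 / 2) by rewrite /l; ring.
rewrite [X in _ <= X]El lerD2l (ler_pM2r h2) ler_pdivrMr // (mulrC D'); lra.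
Qed.

Let enorm_neq0 (x : 'rV[R]_n.+1) : `|x| = 1 -> x != 0.
Proof. by move=> x1; rewrite -normr_eq0 x1 oner_eq0. Qed.

(** By homogeneity a bound for [1 / F] on a sphere bounds the level set; it turns the factor
    [1 / enorm x] of [tangent_bound] into a constant. *)
Let F_lower : exists2 B, 0 <= B & forall x, x != 0 -> F x = 1 -> enorm x <= B.
Proof.
have [||B B0 HB] := @compact_norm_bound R _ [set x : 'rV[R]_n.+1 | 1 <= `|x| <= 1] (fun x => (F x)^-1).
- exact: annulus_compact.
- move=> x /= /andP[x1 x2]; have {x1 x2} x1 : `|x| = 1 by apply/eqP; rewrite eq_le x1 x2.
  have x0 := enorm_neq0 x1.
  exact: (cvgV (lt0r_neq0 (F_gt0 x0)) (cF x0)).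
exists (n.+1%:R * B) => [|x x0 Fx]; first exact: mulr_ge0.
apply: le_trans (enorm_le_norm x) _; rewrite ler_wpM2l //.
have nx : 0 < `|x| by rewrite normr_gt0.
have y1 : `|(`|x|)^-1 *: x| = 1 by rewrite normrZ normfV normr_id mulVf ?gt_eqF.
have := HB (`|x|^-1 *: x); rewrite /= y1 lexx => /(_ isT).
by rewrite F_hom ?invr_gt0 // Fx mulr1 invrK normr_id.
Qed.

(** Subtracting from [v] the multiple [DF(v)] of [x] makes it tangent when [F x = 1], and does not
    change the form since [x] lies in its kernel. The tangent vector obtained is at least as long as
    the part of [v] orthogonal to [x]. *)
Let hess_lower : exists2 c : R, 0 < c & forall x, x != 0 -> forall v,
  c * (dot v v - dot v x ^+ 2 / dot x x) <= dot (v *m hess x) v.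
Proof.
have [c [c0 U]] : unif_convex_set [set p | F p <= 1] by case: HF => _ [_ [_ [_ H]]]; exact: H.
have [B B0 HB] := F_lower.
have B1 : 0 < B + 1 by rewrite ltr_wpDl.
exists (8 * c / (B + 1)); first by rewrite divr_gt0 ?mulr_gt0.
have main (x v : 'rV[R]_n.+1) : x != 0 -> F x = 1 ->
    8 * c / (B + 1) * (dot v v - dot v x ^+ 2 / dot x x) <= dot (v *m hess x) v.
  move=> x0 Fx; pose a := \sum_i v 0 i * g1 i x; pose w := v - a *: x.
  have xx : 0 < dot x x by rewrite dot_gt0.
  have nx : 0 < enorm x by rewrite enorm_gt0.
  have Ev : dot (v *m hess x) v = dot (w *m hess x) w.
    have xk := hess_ker x0; have xs := hess_sym x0.
    rewrite /w mulmxBl -scalemxAl xk scaler0 subr0 dotBr dotZr dot_mulmx xs.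
    by rewrite [X in _ = _ - _ * X]dot_mulmx xs xk dot0r mulr0 subr0.
  have ww : dot v v - dot v x ^+ 2 / dot x x <= dot w w.
    have -> : dot w w = dot v v - dot v x ^+ 2 / dot x x + (dot v x - a * dot x x) ^+ 2 / dot x x.
      by rewrite /w !dotBl !dotBr !dotZl !dotZr (dotC x v); field; rewrite gt_eqF.
    by rewrite lerDl divr_ge0 ?sqr_ge0 ?dot_ge0.
  have tw : \sum_i w 0 i * g1 i x = 0.
    have -> : \sum_i w 0 i * g1 i x = a - a * \sum_i x 0 i * g1 i x.
      rewrite mulr_sumr -sumrB; apply: eq_bigr => i _; rewrite !mxE; ring.
    by rewrite (euler x0) Fx mulr1 subrr.
  have := tangent_bound c0 U Fx x0 tw; rewrite Ev hess_form Fx mul1r.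
  apply: le_trans; have c8 : 0 <= 8 * c by apply: mulr_ge0 => //; exact: ltW.
  apply: le_trans (_ : 8 * c * dot w w / (B + 1) <= _).
    rewrite [leRHS]mulrAC; apply: ler_wpM2l ww.
    by apply: divr_ge0 => //; exact: ltW.
  apply: ler_wpM2l; first by apply: mulr_ge0 => //; exact: dot_ge0.
  rewrite lef_pV2 ?posrE //; apply: le_trans (HB x x0 Fx) _; lra.
move=> x x0 v; have Fx := F_gt0 x0.
have xF0 : (F x)^-1 *: x != 0 by rewrite scaler_eq0 negb_or invr_neq0 ?gt_eqF.
have FxF : F ((F x)^-1 *: x) = 1 by rewrite F_hom ?invr_gt0 // mulVf // gt_eqF.
have Fi : 0 < (F x)^-1 by rewrite invr_gt0.
have := main _ v xF0 FxF; rewrite (hess_hom Fi x0) !dotZr !dotZl.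
have -> // : ((F x)^-1 * dot v x) ^+ 2 / ((F x)^-1 * ((F x)^-1 * dot x x)) =
  dot v x ^+ 2 / dot x x.
by field; rewrite !gt_eqF ?dot_gt0.
Qed.

Let hess_bound : exists2 B : R, 0 <= B & forall x, x != 0 -> opbound (hess x) B.
Proof.
have [|[i j]|B B0 HB] := @finite_uniform_bound R ('I_n.+1 * 'I_n.+1)%type
    (fun ij B => forall x, 1 <= `|x| <= 1 -> `|F x * g2 ij.1 ij.2 x| <= B).
- by move=> ij a a' aa H x Hx; exact: le_trans (H x Hx) aa.
- apply: (@compact_norm_bound R _ [set x : 'rV[R]_n.+1 | 1 <= `|x| <= 1] (fun x => F x * g2 i j x)).
    exact: annulus_compact.
  move=> x /= /andP[x1 x2]; have {x1 x2} x1 : `|x| = 1 by apply/eqP; rewrite eq_le x1 x2.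
  by have x0 := enorm_neq0 x1; apply: (@continuousM _ _ F (g2 i j)); [exact: cF|exact: cg2].
exists (n.+1%:R * n.+1%:R * B) => [|x x0]; first by rewrite !mulr_ge0.
have nx : 0 < `|x|^-1 by rewrite invr_gt0 normr_gt0.
rewrite -(hess_hom nx x0); apply: opbound_entries => i j.
have -> : hess (`|x|^-1 *: x) i j = F (`|x|^-1 *: x) * g2 i j (`|x|^-1 *: x) by exact: hessE.
apply: (HB (i, j)) => /=.
by rewrite normrZ normfV normr_id mulVf ?lexx // normr_eq0.
Qed.

Let da k i j x := F x * g3 k i j x + g2 i j x * g1 k x.

Let da_derive (x : 'rV[R]_n.+1) k i j : x != 0 ->
  is_derive x (b k) (F * g2 i j) (da k i j x).
Proof. by move=> x0; apply: is_deriveM; [exact: dF|exact: dg2]. Qed.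

Let da_cont (x : 'rV[R]_n.+1) k i j : x != 0 -> {for x, continuous (da k i j)}.
Proof.
move=> x0; apply: (@continuousD _ _ _ (F * g3 k i j) (g2 i j * g1 k)).
  by apply: continuousM; [exact: cF|exact: cg3].
by apply: continuousM; [exact: cg2|exact: cg1].
Qed.

Let da_dir (x v : 'rV[R]_n.+1) i j : x != 0 ->
  is_derive x v (F * g2 i j) (\sum_k v 0 k * da k i j x).
Proof.
move=> x0; apply: (is_derive_basis (df := fun k => da k i j)) => k; last exact: da_cont.
by have N := near_neq0 x0; apply: filterS N => y; exact: da_derive.
Qed.

(** After scaling [y] to length one, the segment from [y] to [x] keeps Euclidean distance at least
    1/2 from the origin, where [F] is singular. It therefore lies in the compact annulus [K], on
    which the third derivatives are bounded, and the mean value theorem applies entry by entry. *)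
Let hess_lipschitz : exists2 D : R, 0 <= D & forall x y, x != 0 -> y != 0 ->
  enorm (x - y) <= 2^-1 * enorm y ->
  opbound (hess x - hess y) (D * (enorm (x - y) / enorm y)).
Proof.
pose m : R := n.+1%:R; have m0 : 0 < m by rewrite ltr0n.
pose K := [set x : 'rV[R]_n.+1 | (2 * m)^-1 <= `|x| <= 2].
have [|[[k i] j]|B B0 HB] := @finite_uniform_bound R ('I_n.+1 * 'I_n.+1 * 'I_n.+1)%type
    (fun ij B => forall x, K x -> `|da ij.1.1 ij.1.2 ij.2 x| <= B).
- by move=> ij a a' aa H x Hx; exact: le_trans (H x Hx) aa.
- apply: (@compact_norm_bound R _ K (da k i j)); first exact: annulus_compact.
  move=> x /= /andP[x1 _]; apply: da_cont; rewrite -normr_gt0; apply: lt_le_trans x1.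
  by rewrite invr_gt0 mulr_gt0.
exists (m * m * (m * B)) => [|x y x0 y0 xy]; first by rewrite !mulr_ge0 // ltW.
have ny : 0 < enorm y by rewrite enorm_gt0.
have niy : 0 < (enorm y)^-1 by rewrite invr_gt0.
rewrite -(hess_hom niy x0) -(hess_hom niy y0) -mulrA; apply: opbound_entries => i j.
pose y' := (enorm y)^-1 *: y; pose d := (enorm y)^-1 *: (x - y).
have Ex : (enorm y)^-1 *: x = y' + 1 *: d by rewrite scale1r -scalerDr addrC subrK.
have ed : enorm d = enorm (x - y) / enorm y by rewrite enormZ ger0_norm ?(ltW niy) // mulrC.
have d2 : enorm d <= 2^-1 by rewrite ed ler_pdivrMr.
have y'1 : enorm y' = 1 by rewrite enormZ ger0_norm ?(ltW niy) // mulVf ?gt_eqF.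
have inK (l : R) : 0 <= l <= 1 -> K (y' + l *: d).
  move=> /andP[l0 l1]; have ld : enorm (l *: d) <= 2^-1.
    by rewrite enormZ ger0_norm // (le_trans _ d2) // ler_piMl ?enorm_ge0.
  apply/andP; split; last first.
    apply: le_trans (norm_le_enorm _) _; apply: le_trans (enormD _ _) _; rewrite y'1; lra.
  have := enormB (y' + l *: d) (l *: d); rewrite addrK y'1.
  have := enorm_le_norm (y' + l *: d); rewrite -/m => H1 H2.
  rewrite invfM ler_pdivrMr //; lra.
have nz (z : 'rV[R]_n.+1) : K z -> z != 0.
  move=> /andP[z1 _]; rewrite -normr_gt0; apply: lt_le_trans z1.
  by rewrite invr_gt0 mulr_gt0.
have [l l01] : exists2 l : R, 0 < l < 1 & (F * g2 i j) (y' + 1 *: d) - (F * g2 i j) (y' + 0 *: d)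
    = 1 * \sum_k d 0 k * da k i j (y' + (l * 1) *: d).
  apply: (MVT0 (f := fun h => (F * g2 i j) (y' + h *: d))
    (df := fun h => \sum_k d 0 k * da k i j (y' + h *: d))) => l Hl.
  apply: (iffLR (is_derive_line (F * g2 i j) y' d (l * 1) _)).
  by apply: da_dir; rewrite mulr1; apply: nz; exact: inK.
rewrite mul1r mulr1 scale0r addr0 => E.
have -> : (hess ((enorm y)^-1 *: x) - hess ((enorm y)^-1 *: y)) i j =
    (F * g2 i j) (y' + 1 *: d) - (F * g2 i j) y'.
  have subE (M N : 'M[R]_n.+1) : (M - N) i j = M i j - N i j by rewrite !mxE.
  rewrite subE Ex.
  by congr (_ - _); [exact: hessE (y' + 1 *: d) i j|exact: hessE y' i j].
rewrite E -ed; apply: le_trans (ler_norm_sum _ _ _) _.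
apply: le_trans (_ : \sum_(k < n.+1) B * enorm d <= _); last first.
  by rewrite sumr_const card_ord -[leLHS]mulr_natl -/m mulrA.
apply: ler_sum => k _; rewrite normrM mulrC ler_pM ?normr_ge0 ?coord_le_enorm //.
by apply: (HB (k, i, j)); apply: inK; case/andP: l01 => ? ?; rewrite !ltW.
Qed.

Lemma hess_mx_sym (x : 'rV[R]_n.+1) : x != 0 -> (hess_mx F x)^T = hess_mx F x.
Proof. exact: hess_sym. Qed.

Lemma hess_mx_ker (x : 'rV[R]_n.+1) : x != 0 -> x *m hess_mx F x = 0.
Proof. exact: hess_ker. Qed.

Lemma hess_mx_bounds : exists c B D : R, [/\ 0 < c, 0 <= B, 0 <= D &
  forall x, x != 0 ->
    [/\ (forall v, c * (dot v v - dot v x ^+ 2 / dot x x) <= dot (v *m hess_mx F x) v),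
        opbound (hess_mx F x) B &
        forall y, y != 0 -> enorm (x - y) <= 2^-1 * enorm y ->
          opbound (hess_mx F x - hess_mx F y) (D * (enorm (x - y) / enorm y))]].
Proof.
have [c c0 Hc] := hess_lower; have [B B0 HB] := hess_bound.
have [D D0 HD] := hess_lipschitz.
exists c, B, D; split => // x x0; split; [exact: Hc|exact: HB|].
by move=> y y0; exact: HD.
Qed.

End Integrand.

(** * Second order conditions at a two-point maximum *)

Section RealDerivatives.
Variables (R : realType) (t : R).
Implicit Types (f g : R -> R) (a b c : R).

Lemma rderD f g a b : is_derive t 1 f a -> is_derive t 1 g b ->
  is_derive t 1 (fun s => f s + g s) (a + b).
Proof. by move=> Hf Hg; exact: is_deriveD Hf Hg. Qed.

Lemma rderB f g a b : is_derive t 1 f a -> is_derive t 1 g b ->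
  is_derive t 1 (fun s => f s - g s) (a - b).
Proof. by move=> Hf Hg; exact: is_deriveB Hf Hg. Qed.

Lemma rderM f g a b : is_derive t 1 f a -> is_derive t 1 g b ->
  is_derive t 1 (fun s => f s * g s) (a * g t + f t * b).
Proof.
move=> Hf Hg; apply: is_derive_eq (is_deriveM Hf Hg) _.
by rewrite /GRing.scale /=; ring.
Qed.

Lemma rderZ c f a : is_derive t 1 f a -> is_derive t 1 (fun s => c * f s) (c * a).
Proof. by move=> Hf; have H := is_deriveZ c Hf; apply: is_derive_eq H _. Qed.

Lemma rder_cst c : is_derive t 1 (fun _ : R => c) 0.
Proof. exact: is_derive_cst. Qed.

Lemma rder_id : is_derive t 1 (fun s : R => s) 1.
Proof. exact: is_derive_id. Qed.

Lemma rder_comp g f a b : is_derive (f t) 1 g b -> is_derive t 1 f a ->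
  is_derive t 1 (fun s => g (f s)) (b * a).
Proof. by move=> Hg Hf; exact: is_derive1_comp Hg Hf. Qed.

Lemma rderV f a : f t != 0 -> is_derive t 1 f a ->
  is_derive t 1 (fun s => (f s)^-1) (- a / f t ^+ 2).
Proof.
move=> f0 Hf; apply: is_derive_eq (is_deriveV f0 Hf) _.
by rewrite /GRing.scale /= mulrC mulNr mulrN.
Qed.

Lemma rder_exp f a : is_derive t 1 f a ->
  is_derive t 1 (fun s => expR (f s)) (expR (f t) * a).
Proof. by move=> Hf; exact: rder_comp (is_derive_expR _) Hf. Qed.

Lemma rder_sqrt f a : 0 < f t -> is_derive t 1 f a ->
  is_derive t 1 (fun s => Num.sqrt (f s)) (a / (2 * Num.sqrt (f t))).
Proof.
move=> f0 Hf; apply: is_derive_eq (rder_comp (is_derive1_sqrt f0) Hf) _.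
by rewrite mulrC.
Qed.

End RealDerivatives.

(** Only earlier times are compared, so that the maximum may sit at the last time of the
    interval. *)
Lemma is_derive_max_left (R : realType) (f : R -> R) (t r d : R) : 0 < r ->
  is_derive t 1 f d -> (forall s, t - r < s -> s <= t -> f s <= f t) -> 0 <= d.
Proof.
move=> r0 [Hd1 Hd2] H; rewrite leNgt; apply/negP => d0.
have C : (fun h : R => h^-1 * (f (h + t) - f t)) @ 0^' --> d.
  rewrite -Hd2 /derive.
  rewrite (_ : (fun h => _) = (fun h : R => h^-1 *: (f (h *: 1 + t) - f t))) //.
  by apply/funext => h; rewrite /GRing.scale /= mulr1.
have /nbhs_ballP [e /= e0 B] : \forall h \near 0^', h^-1 * (f (h + t) - f t) < 0.
  exact: cvgr_lt C _ d0.
pose m := Num.min e r / 2.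
have mr0 : 0 < Num.min e r by rewrite lt_min e0.
have m0 : 0 < m by rewrite divr_gt0.
have mm : m < Num.min e r by rewrite /m; lra.
move: (mm); rewrite lt_min => /andP[me mr].
have := B (- m); rewrite /ball /= sub0r opprK gtr0_norm // => /(_ me).
rewrite oppr_eq0 gt_eqF // => /(_ isT).
rewrite invrN mulNr oppr_lt0 pmulr_rgt0 ?invr_gt0 // subr_gt0.
apply/negP; rewrite -leNgt; apply: H; lra.
Qed.

Section LineDistance.
Variables (R : realType) (n : nat) (z w : 'rV[R]_n).
Hypothesis z0 : z != 0.
Let q (h : R) := dot z z + 2 * h * dot z w + h ^+ 2 * dot w w.

Let qE h : dot (z + h *: w) (z + h *: w) = q h.
Proof. by rewrite /q !dotDl !dotDr !dotZl !dotZr (dotC w z); ring. Qed.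

Definition dist_line (h : R) := enorm (z + h *: w).
Definition ddist_line (h : R) := (dot z w + h * dot w w) / dist_line h.

Lemma is_derive_dist_line : \forall h \near (0 : R), 0 < dist_line h /\
  is_derive (h : R) 1 dist_line (ddist_line h).
Proof.
have nz : 0 < `|z| by rewrite normr_gt0.
have nw : 0 < `|w| + 1 by rewrite ltr_wpDl.
apply/nbhs_ballP; exists (`|z| / (`|w| + 1)); first by rewrite /= divr_gt0.
move=> h; rewrite /ball /= sub0r normrN ltr_pdivlMr // => hz.
have nz0 : z + h *: w != 0.
  apply: contraTneq hz => /eqP; rewrite addr_eq0 => /eqP ->.
  by rewrite normrN normrZ -leNgt ler_wpM2l // lerDl.
have q0 : 0 < q h by rewrite -qE dot_gt0.
split; first by rewrite /dist_line enorm_gt0.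
have -> : dist_line = fun h => Num.sqrt (q h) by apply/funext => k; rewrite /dist_line enormE qE.
have dq : is_derive h 1 q (2 * dot z w + 2 * h * dot w w).
  have D := rderD (rderD (rder_cst h (dot z z))
      (rderM (rderZ 2 (rder_id h)) (rder_cst h (dot z w))))
    (rderM (rderM (rder_id h) (rder_id h)) (rder_cst h (dot w w))).
  by apply: is_derive_eq D _; ring.
apply: is_derive_eq (rder_sqrt q0 dq) _.
rewrite /ddist_line /dist_line enormE qE.
have s0 : Num.sqrt (q h) != 0 by rewrite sqrtr_eq0 -ltNge.
by field.
Qed.

Lemma is_derive_ddist_line :
  is_derive (0 : R) 1 ddist_line ((dot w w - (dot z w / enorm z) ^+ 2) / enorm z).
Proof.
have [d0 Hd] := nbhs_singleton is_derive_dist_line.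
have d1 : dist_line 0 != 0 by rewrite gt_eqF.
have D := rderM (rderD (rder_cst (0 : R) (dot z w)) (rderM (rder_id (0 : R)) (rder_cst (0 : R) (dot w w))))
  (rderV d1 Hd).
apply: is_derive_eq D _.
rewrite /ddist_line /dist_line scale0r addr0 /=.
have z1 : enorm z != 0 by rewrite enorm_eq0.
by field.
Qed.

Variable dl : R.
Definition modulus_line (h : R) := dist_line h + dl * Num.sqrt (dist_line h).
Definition dmodulus_line (h : R) := ddist_line h * (1 + dl / 2 / Num.sqrt (dist_line h)).

Lemma is_derive_modulus_line : \forall h \near (0 : R),
  is_derive (h : R) 1 modulus_line (dmodulus_line h).
Proof.
apply: filterS is_derive_dist_line => h [d0 Hd].
apply: is_derive_eq (rderD Hd (rderZ dl (rder_sqrt d0 Hd))) _.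
rewrite /dmodulus_line; have s0 : Num.sqrt (dist_line h) != 0 by rewrite sqrtr_eq0 -ltNge.
by field.
Qed.

(** The Hessian of a radial function psi(|z|): weight psi'/r across [z] and psi'' along [z], here
    for psi(r) = r + dl sqrt(r). The negative psi'' is the concavity that will be exploited. *)
Lemma is_derive_dmodulus_line : let r := enorm z in let a := dot z w / r in
  is_derive (0 : R) 1 dmodulus_line
    ((1 + dl / (2 * Num.sqrt r)) / r * (dot w w - a ^+ 2)
     - dl / (4 * r * Num.sqrt r) * a ^+ 2).
Proof.
move=> r a; have [d0 Hd] := nbhs_singleton is_derive_dist_line.
have r0 : 0 < r by rewrite enorm_gt0.
have Er : dist_line 0 = r by rewrite /dist_line scale0r addr0.
have s0 : Num.sqrt r != 0 by rewrite sqrtr_eq0 -ltNge.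
have Hs := rder_sqrt d0 Hd.
have s0' : Num.sqrt (dist_line 0) != 0 by rewrite Er.
have D := rderM is_derive_ddist_line
  (rderD (rder_cst (0 : R) 1) (rderZ (dl / 2) (rderV (f := fun h => Num.sqrt (dist_line h)) s0' Hs))).
apply: is_derive_eq D _.
rewrite /ddist_line Er mul0r addr0 -/r -/a.
(* With [r] replaced by the square of its root, the identity becomes rational in one variable. *)
rewrite (_ : r = Num.sqrt r ^+ 2) in a *; last by rewrite sqr_sqrtr // ltW.
rewrite sqrtr_sqr ger0_norm ?sqrtr_ge0 //.
by field.
Qed.

End LineDistance.

Lemma dot_ext (R : realType) (n : nat) (u v : 'rV[R]_n) :
  (forall x, dot u x = dot v x) -> u = v.
Proof. by move=> H; apply/rowP => i; have := H (delta_mx 0 i); rewrite !(dotC _ (delta_mx _ _)) !dot_delta. Qed.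

Section LineCalculus.
Variables (R : realType) (n : nat) (U : 'rV[R]_n -> R).
Variables (g : 'I_n -> 'rV[R]_n -> R) (H : 'I_n -> 'I_n -> 'rV[R]_n -> R).
Hypotheses (dU : forall x i, is_derive x (bvec R i) U (g i x))
  (cg : forall i x, {for x, continuous (g i)})
  (dg : forall x i j, is_derive x (bvec R i) (g j) (H i j x))
  (cH : forall i j x, {for x, continuous (H i j)}).

Definition grad_row x : 'rV[R]_n := \row_i g i x.
Definition hess_fun x : 'M[R]_n := \matrix_(i, j) H i j x.

Lemma line_deriv1 (x v : 'rV[R]_n) (h : R) :
  is_derive h 1 (fun h => U (x + h *: v)) (dot (grad_row (x + h *: v)) v).
Proof.
apply: (iffLR (is_derive_line U x v h _)); rewrite dotC dotE.
under eq_bigr do rewrite mxE.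
apply: is_derive_basis => i; last exact: cg.
by near=> y; exact: dU.
Unshelve. all: by end_near.
Qed.

Lemma line_deriv2 (x v : 'rV[R]_n) :
  is_derive (0 : R) 1 (fun h => dot (grad_row (x + h *: v)) v) (dot (v *m hess_fun x) v).
Proof.
have D j : is_derive (0 : R) 1 (fun h => g j (x + h *: v)) (\sum_i v 0 i * H i j x).
  apply: (iffLR (is_derive_line (g j) x v 0 _)); rewrite scale0r addr0.
  apply: (is_derive_basis (df := fun i => H i j)) => i; last exact: cH.
  by near=> y; exact: dg.
have E : (fun h : R => dot (grad_row (x + h *: v)) v) =
    \sum_j (v 0 j \*: (fun h : R => g j (x + h *: v))).
  apply/funext => h; rewrite dotE fct_sumE; apply: eq_bigr => j _.
  by rewrite mxE mulrC.
rewrite E; have S := @is_derive_sum _ _ _ n _ (0 : R) 1 _ (fun j => is_deriveZ (v 0 j) (D j)).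
apply: is_derive_eq S _; rewrite dotE; apply: eq_bigr => j _.
rewrite [(v *m _) 0 j]mxE /GRing.scale /= mulrC; congr (_ * _).
by apply: eq_bigr => i _; rewrite mxE.
Unshelve. all: by end_near.
Qed.

Section TwoPointMax.
Variables (a b dl mu : R) (x y : 'rV[R]_n).
Let Z x' y' := a * (expR (b * (U x' - U y')) - 1)
  - (enorm (x' - y') + dl * Num.sqrt (enorm (x' - y'))) - mu * dot x' x'.
Hypotheses (xy : x - y != 0) (Zmax : forall x' y', Z x' y' <= Z x y).
Let s := U x - U y.
Let r := enorm (x - y).
Let e := r^-1 *: (x - y).
Let phi1 := a * b * expR (b * s).
Let phi2 := a * b ^+ 2 * expR (b * s).
Let psi1 := 1 + dl / (2 * Num.sqrt r).

(** Moving [x] along [v] and [y] along [w] at the same time reduces both conditions to those for a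
    function of one real variable. *)
Let two_point_max_dir (v w : 'rV[R]_n) :
  phi1 * (dot (grad_row x) v - dot (grad_row y) w) = psi1 * dot e (v - w) + 2 * mu * dot x v /\
  phi1 * (dot (v *m hess_fun x) v - dot (w *m hess_fun y) w)
  + phi2 * (dot (grad_row x) v - dot (grad_row y) w) ^+ 2 <=
  psi1 / r * (dot (v - w) (v - w) - dot e (v - w) ^+ 2)
  - dl / (4 * r * Num.sqrt r) * dot e (v - w) ^+ 2 + 2 * mu * dot v v.
Proof.
pose S h := U (x + h *: v) - U (y + h *: w).
pose dS h := dot (grad_row (x + h *: v)) v - dot (grad_row (y + h *: w)) w.
have DS (h : R) : is_derive h 1 S (dS h) by apply: rderB; exact: line_deriv1.
have DdS : is_derive (0 : R) 1 dS (dot (v *m hess_fun x) v - dot (w *m hess_fun y) w).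
  by apply: rderB; exact: line_deriv2.
pose f h := a * (expR (b * S h) - 1) - modulus_line (x - y) (v - w) dl h
   - mu * (dot x x + 2 * h * dot x v + h ^+ 2 * dot v v).
pose df h := a * b * (expR (b * S h) * dS h) - dmodulus_line (x - y) (v - w) dl h
   - mu * (2 * dot x v + 2 * h * dot v v).
have Df : \forall h \near (0 : R), is_derive (h : R) 1 f (df h).
  apply: filterS (is_derive_modulus_line (v - w) xy dl) => h Dm.
  have D := rderB (rderB (rderZ a (rderB (rder_exp (rderZ b (DS h))) (rder_cst h 1))) Dm)
    (rderZ mu (rderD (rderD (rder_cst h (dot x x))
      (rderM (rderZ 2 (rder_id h)) (rder_cst h (dot x v))))
      (rderM (rderM (rder_id h) (rder_id h)) (rder_cst h (dot v v))))).
  by apply: is_derive_eq D _; rewrite /df; ring.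
have Ddf : is_derive (0 : R) 1 df (a * b * (expR (b * S 0) * (b * dS 0) * dS 0
     + expR (b * S 0) * (dot (v *m hess_fun x) v - dot (w *m hess_fun y) w))
   - ((1 + dl / (2 * Num.sqrt r)) / r * (dot (v - w) (v - w) - (dot (x - y) (v - w) / r) ^+ 2)
     - dl / (4 * r * Num.sqrt r) * (dot (x - y) (v - w) / r) ^+ 2)
   - mu * (2 * dot v v)).
  have D := rderB (rderB (rderZ (a * b) (rderM (rder_exp (rderZ b (DS 0))) DdS))
      (is_derive_dmodulus_line (v - w) xy dl))
    (rderZ mu (rderD (rder_cst (0 : R) (2 * dot x v))
      (rderM (rderZ 2 (rder_id (0 : R))) (rder_cst (0 : R) (dot v v))))).
  by apply: is_derive_eq D _; rewrite -/r; ring.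
have fZ h : f h = Z (x + h *: v) (y + h *: w).
  rewrite /f /Z /modulus_line /dist_line -/(S h).
  have -> : x + h *: v - (y + h *: w) = x - y + h *: (v - w).
    by rewrite opprD addrACA scalerBr.
  congr (_ - _ * _); rewrite !dotDl !dotDr !dotZl !dotZr (dotC v x); ring.
have fmax : \forall h \near (0 : R), f h <= f 0.
  by near=> h; rewrite !fZ !scale0r !addr0; exact: Zmax.
have [df0 d2f] := deriv2_max_le0 Df Ddf fmax.
have S0 : S 0 = s by rewrite /S !scale0r !addr0.
have dS0 : dS 0 = dot (grad_row x) v - dot (grad_row y) w by rewrite /dS !scale0r !addr0.
have ev : dot e (v - w) = dot (x - y) (v - w) / r by rewrite /e dotZl mulrC.
rewrite S0 dS0 -ev in d2f; split.
  move: df0; rewrite /df S0 dS0 /dmodulus_line /ddist_line /dist_line scale0r addr0 -/r.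
  rewrite mul0r addr0 -ev /phi1 /psi1 invfM mulrA => df0.
  by apply/eqP; rewrite -subr_eq0; apply/eqP; rewrite -[RHS]df0; ring.
rewrite /phi1 /phi2 /psi1 -subr_le0; apply: le_trans d2f; rewrite le_eqVlt; apply/orP; left.
by apply/eqP; ring.
Unshelve. all: by end_near.
Qed.

(** Setting [w = 0] and then [v = 0] separates the first order condition into its two gradients. The
    penalty acts on [x] only, so the gradient at [y] is exactly parallel to [e], as the coupling
    requires of [p2]. *)
Lemma two_point_max :
  [/\ phi1 *: grad_row x = psi1 *: e + (2 * mu) *: x, phi1 *: grad_row y = psi1 *: e &
   forall v w, phi1 * (dot (v *m hess_fun x) v - dot (w *m hess_fun y) w)
    + phi2 * (dot (grad_row x) v - dot (grad_row y) w) ^+ 2 <=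
    psi1 / r * (dot (v - w) (v - w) - dot e (v - w) ^+ 2)
    - dl / (4 * r * Num.sqrt r) * dot e (v - w) ^+ 2 + 2 * mu * dot v v].
Proof.
split; last by move=> v w; case: (two_point_max_dir v w).
- apply: dot_ext => v; have [+ _] := two_point_max_dir v 0.
  by rewrite dot0r !subr0 dotDl !dotZl.
- apply: dot_ext => w; have [+ _] := two_point_max_dir 0 w.
  by rewrite !dot0r !sub0r dotNr mulr0 addr0 !mulrN !dotZl => /oppr_inj.
Qed.

End TwoPointMax.
End LineCalculus.

(** This turns the second order conditions, summed over the pairs of directions, into the right-hand
    side of the equation. *)
Lemma sum_row_form (R : realType) (N n : nat) (X : 'M[R]_(N, n)) (M : 'M[R]_n) :
  \sum_k dot (row k X *m M) (row k X) = \sum_i \sum_j (X^T *m X) i j * M i j.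
Proof.
have E k : dot (row k X *m M) (row k X) = \sum_i \sum_j X k i * X k j * M i j.
  rewrite dotE exchange_big /=; apply: eq_bigr => j _.
  rewrite [(_ *m _) 0 j]mxE mulr_suml; apply: eq_bigr => i _.
  by rewrite !mxE; ring.
under eq_bigr do rewrite E.
rewrite exchange_big /=; apply: eq_bigr => i _.
rewrite exchange_big /=; apply: eq_bigr => j _.
rewrite [in RHS]mxE mulr_suml; apply: eq_bigr => k _.
by rewrite mxE.
Qed.

Lemma sum_row_dot (R : realType) (N n : nat) (X : 'M[R]_(N, n)) :
  \sum_k dot (row k X) (row k X) = \sum_i (X^T *m X) i i.
Proof.
under eq_bigr do rewrite dotE.
rewrite exchange_big /=; apply: eq_bigr => i _; rewrite mxE.
by apply: eq_bigr => k _; rewrite !mxE.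
Qed.

(** * Summation of the second order conditions over the coupled pairs *)

Section DoublingIneq.
Variables (R : realType) (n : nat) (F : 'rV[R]_n.+1 -> R).
Hypothesis HF : standing_assumptions F.
Variables (c B D : R).
Hypotheses (c0 : 0 < c) (B0 : 0 <= B) (D0 : 0 <= D).
Hypothesis bounds : forall x, x != 0 ->
    [/\ (forall v, c * (dot v v - dot v x ^+ 2 / dot x x) <= dot (v *m hess_mx F x) v),
        opbound (hess_mx F x) B &
        forall y, y != 0 -> enorm (x - y) <= 2^-1 * enorm y ->
          opbound (hess_mx F x - hess_mx F y) (D * (enorm (x - y) / enorm y))].

(** The coefficient matrix of (AMCF) at a point where the gradient is [p]. *)
Definition graph_coef (p : 'rV[R]_n) : 'M[R]_n :=
  graph_emb R n *m hess_mx F (graph_normal p) *m (graph_emb R n)^T.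

Let K := (D + 2 * c) ^+ 2 / c + c.
Let C := n%:R * (4 * (B + c) + 2 * (D + 2 * c) + 2 * K).

Lemma trace_graph_coef p : \sum_i graph_coef p i i <= n%:R * B.
Proof.
apply: le_trans (_ : \sum_(i < n) B <= _); last by rewrite sumr_const card_ord mulr_natl.
apply: ler_sum => i _.
have [_ HB _] := bounds (graph_normal_neq0 p).
have u1 : enorm ((delta_mx 0 i : 'rV[R]_n) *m graph_emb R n) = 1.
  by rewrite enormE dot_graph_emb -enormE enorm_delta.
have := HB (delta_mx 0 i *m graph_emb R n) (delta_mx 0 i *m graph_emb R n).
rewrite u1 !mulr1 ler_norml => /andP[_]; apply: le_trans.
rewrite -dot_conj dotC dot_delta -rowE [X in _ <= X]mxE.
by rewrite /graph_coef.
Qed.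

(** [f1] and [f2] stand for zeta_s and zeta_ss, [psi1] for the derivative of the modulus at [r]. By
    the coupling the transversal part [DD - EE] is at most [C * h^2], while [EE >= 4 * th] activates
    the concavity of the modulus; the two are weighed against each other. *)
Lemma doubling_ineq (p1 p2 e x : 'rV[R]_n) (X Y : 'M[R]_n) (f1 f2 r dl mu : R) :
  let psi1 := 1 + dl / (2 * Num.sqrt r) in
  dot e e = 1 -> 0 < f1 <= 1 -> 0 <= f2 -> 0 < r <= 1 -> 0 < dl <= 1 ->
  0 < mu -> mu * enorm x <= 1 ->
  f1 *: p1 = psi1 *: e + (2 * mu ^+ 2) *: x -> f1 *: p2 = psi1 *: e ->
  (forall v w, f1 * (dot (v *m X) v - dot (w *m Y) w)
    + f2 * (dot p1 v - dot p2 w) ^+ 2 <=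
    psi1 / r * (dot (v - w) (v - w) - dot e (v - w) ^+ 2)
    - dl / (4 * r * Num.sqrt r) * dot e (v - w) ^+ 2 + 2 * mu ^+ 2 * dot v v) ->
  4 * mu <= 1 -> mu ^+ 2 * (32 * K) <= c -> mu ^+ 2 * (1280 * C) <= dl * c * f1 ^+ 2 ->
  f1 * (\sum_i \sum_j graph_coef p1 i j * X i j - \sum_i \sum_j graph_coef p2 i j * Y i j)
  <= - (f2 * (c / 20)) + mu ^+ 2 * (2 * (n%:R * B)).
Proof.
move=> psi1 e1 /andP[f10 f11] f20 /andP[r0 r1] /andP[dl0 dl1] mu0 mux E1 E2 so S1 S2 S3.
have sr0 : 0 < Num.sqrt r by rewrite sqrtr_gt0.
have sr1 : Num.sqrt r <= 1 by rewrite -sqrtr1 ler_wsqrtr.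
have psi0 : 1 <= psi1 by rewrite /psi1 lerDl divr_ge0 ?mulr_ge0 ?(ltW dl0) ?(ltW sr0).
have psip : 0 < psi1 by exact: lt_le_trans ltr01 psi0.
pose w := psi1 / f1.
have wp2 : p2 = w *: e.
  by rewrite -[LHS]scale1r -(mulVf (lt0r_neq0 f10)) -scalerA E2 scalerA mulrC.
have w1 : 1 <= w by rewrite ler_pdivlMr // mul1r (le_trans f11).
have w0 : 0 < w by exact: lt_le_trans ltr01 w1.
(* The penalty is mu^2 |x|^2 and mu |x| <= 1, so the gradients differ by 2 mu^2 |x| / f1 <= 2 mu /
   f1, which is [h / 2 * w] for this [h]. *)
pose h := 4 * mu / psi1.
have h0 : 0 <= h by rewrite divr_ge0 ?mulr_ge0 ?(ltW mu0) ?(ltW psip).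
have hmu : h <= 4 * mu by rewrite ler_pdivrMr // ler_peMr // mulr_ge0 // ltW.
have h01 : 0 <= h <= 1 by rewrite h0 (le_trans hmu).
have K0 : 0 <= K by rewrite addr_ge0 ?divr_ge0 ?sqr_ge0 ?(ltW c0).
have h2 : h ^+ 2 <= 16 * mu ^+ 2.
  have -> : 16 * mu ^+ 2 = (4 * mu) ^+ 2 by ring.
  by rewrite ler_sqr ?nnegrE // mulr_ge0 // ltW.
have hK : K * h ^+ 2 <= c / 2 by have := ler_wpM2l K0 h2; lra.
have Ed : p1 - p2 = (2 * mu ^+ 2 / f1) *: x.
  have -> : p1 - p2 = f1^-1 *: (f1 *: p1 - f1 *: p2).
    by rewrite -scalerBr scalerA mulVf ?gt_eqF // scale1r.
  by rewrite E1 E2 addrC addKr scalerA mulrC.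
have p12 : enorm (p1 - p2) <= h / 2 * w.
  have f1i : 0 <= 2 * mu ^+ 2 / f1.
    by apply: divr_ge0; [apply: mulr_ge0 => //; exact: sqr_ge0|exact: ltW].
  rewrite Ed enormZ ger0_norm //.
  have -> : h / 2 * w = 2 * mu / f1 by rewrite /h /w; field; rewrite !gt_eqF.
  have -> : 2 * mu ^+ 2 / f1 * enorm x = 2 * mu / f1 * (mu * enorm x) by ring.
  rewrite ler_piMr //; apply: divr_ge0; [apply: mulr_ge0 => //; exact: ltW|exact: ltW].
set v1 := graph_normal p1; set v2 := graph_normal p2.
have v10 : v1 != 0 := graph_normal_neq0 p1.
have v20 : v2 != 0 := graph_normal_neq0 p2.
have nv2 : 0 < enorm v2 by rewrite enorm_gt0.
have wv2 : w <= enorm v2.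
  rewrite /v2 wp2 enormE dot_graph_normal dotZl dotZr e1 mulr1.
  by rewrite -[leLHS]ger0_norm ?(ltW w0) // -sqrtr_sqr ler_wsqrtr // expr2; lra.
have dv : enorm (v1 - v2) <= h / 2 * enorm v2.
  rewrite /v1 /v2 graph_normalB enormE dot_graph_emb -enormE -/v2.
  by apply: le_trans p12 _; rewrite ler_wpM2l // divr_ge0.
have [c1 b1 l1] := bounds v10; have [c2 b2 _] := bounds v20.
have T12 : opbound (hess_mx F v1 - hess_mx F v2) (D * h).
  have dv' : enorm (v1 - v2) <= 2^-1 * enorm v2.
    apply: le_trans dv _; rewrite ler_wpM2r ?(ltW nv2) //.
    by case/andP: h01; lra.
  apply: opboundW (l1 v2 v20 dv'); rewrite ler_wpM2l // ler_pdivrMr //.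
  by apply: le_trans dv _; rewrite ler_wpM2r ?(ltW nv2) //; lra.
have s1 := hess_mx_sym HF v10; have s2 := hess_mx_sym HF v20.
have k1 := hess_mx_ker HF v10; have k2 := hess_mx_ker HF v20.
rewrite /v2 wp2 in c2 b2 T12 s2 k2; rewrite wp2 in p12.
have [Xi [Yi [EX EY Q1 Q2 Q3]]] := coupling c0 B0 D0 h01 w1 e1 p12 s1 s2 k1 k2 c1 c2 b1 b2 T12 hK.
rewrite -wp2 in EX EY Q1 Q2 Q3.
set th := c / (40 * w ^+ 2) in Q2 Q3.
have tr : \sum_k dot (row k Xi) (row k Xi) <= n%:R * B.
  by rewrite sum_row_dot EX; exact: trace_graph_coef.
have SO := ler_sum _ (fun k (_ : true) => so (row k Xi) (row k Yi)).
have {}SO := SO (index_enum 'I_(n + n)).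
have L : \sum_k (f1 * (dot (row k Xi *m X) (row k Xi) - dot (row k Yi *m Y) (row k Yi))
    + f2 * (dot p1 (row k Xi) - dot p2 (row k Yi)) ^+ 2) =
  f1 * (\sum_i \sum_j graph_coef p1 i j * X i j - \sum_i \sum_j graph_coef p2 i j * Y i j)
  + f2 * \sum_k (dot p1 (row k Xi) - dot p2 (row k Yi)) ^+ 2.
  by rewrite big_split /= -!mulr_sumr sumrB !sum_row_form EX EY.
pose EE := \sum_k dot e (row k Xi - row k Yi) ^+ 2.
pose DD := \sum_k dot (row k Xi - row k Yi) (row k Xi - row k Yi).
have Rr : \sum_k (psi1 / r * (dot (row k Xi - row k Yi) (row k Xi - row k Yi)
      - dot e (row k Xi - row k Yi) ^+ 2)
    - dl / (4 * r * Num.sqrt r) * dot e (row k Xi - row k Yi) ^+ 2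
    + 2 * mu ^+ 2 * dot (row k Xi) (row k Xi)) =
  psi1 / r * (DD - EE) - dl / (4 * r * Num.sqrt r) * EE
  + 2 * mu ^+ 2 * \sum_k dot (row k Xi) (row k Xi).
  by rewrite big_split /= sumrB -!mulr_sumr sumrB.
rewrite L Rr in SO.
have th0 : 0 < th by rewrite divr_gt0 // mulr_gt0 // exprn_gt0.
have C0 : 0 <= C.
  apply: mulr_ge0 => //; apply: addr_ge0; last by apply: mulr_ge0.
  apply: addr_ge0; apply: mulr_ge0 => //; apply: addr_ge0 => //; first exact: ltW.
  by apply: mulr_ge0 => //; exact: ltW.
have X1 : psi1 / r * (DD - EE) <= psi1 / r * (C * h ^+ 2).
  apply: ler_wpM2l; first by apply: divr_ge0; exact: ltW.
  by move: Q2 Q3; rewrite -/EE -/DD -/K -/C; lra.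
have rsr : 0 < 4 * r * Num.sqrt r by rewrite !mulr_gt0.
have X2 : dl / (4 * r * Num.sqrt r) * (4 * th) <= dl / (4 * r * Num.sqrt r) * EE.
  by apply: ler_wpM2l => //; apply: divr_ge0; exact: ltW.
(* Over a common denominator the singular powers of [r] cancel, and
   [psi1 * sqrt r = sqrt r + dl / 2 <= 2] leaves [32 C mu^2 <= dl c f1^2 / 40]: hence the 1280. *)
have X3 : psi1 / r * (C * h ^+ 2) <= dl / (4 * r * Num.sqrt r) * (4 * th).
  have -> : psi1 / r * (C * h ^+ 2) = (C * mu ^+ 2 * (16 * (psi1 * Num.sqrt r))) / (psi1 ^+ 2 * r * Num.sqrt r).
    by rewrite /h; field; rewrite !gt_eqF.
  have -> : dl / (4 * r * Num.sqrt r) * (4 * th) = (dl * c * f1 ^+ 2 / 40) / (psi1 ^+ 2 * r * Num.sqrt r).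
    by rewrite /th /w; field; rewrite !gt_eqF.
  apply: ler_wpM2r; first by rewrite invr_ge0 ltW // !mulr_gt0 // exprn_gt0.
  have ps : psi1 * Num.sqrt r <= 2.
    have -> : psi1 * Num.sqrt r = Num.sqrt r + dl / 2 by rewrite /psi1; field; rewrite gt_eqF.
    lra.
  apply: le_trans (_ : C * mu ^+ 2 * (16 * 2) <= _); last by lra.
  by apply: ler_wpM2l; [apply: mulr_ge0 => //; exact: sqr_ge0|lra].
have X4 : f2 * (c / 20) <= f2 * \sum_k (dot p1 (row k Xi) - dot p2 (row k Yi)) ^+ 2.
  by apply: ler_wpM2l.
have X5 : 2 * mu ^+ 2 * \sum_k dot (row k Xi) (row k Xi) <= 2 * mu ^+ 2 * (n%:R * B).
  by apply: ler_wpM2l => //; apply: mulr_ge0 => //; exact: sqr_ge0.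
move: (f1 * _) (f2 * \sum_k _) (psi1 / r * _) (psi1 / r * _) (dl / _ * _) (dl / _ * _)
  (2 * mu ^+ 2 * \sum_k _) SO X1 X2 X3 X4 X5 => t1 t2 t3 t4 t5 t6 t7; lra.
Qed.
End DoublingIneq.

(** * The two-point estimate *)

Section Slices.
Variables (R : realType) (V : normedModType R) (f : V * R -> R).

Let quot_x (v y : V) (t : R) :
  (fun h : R => h^-1 *: (f (h *: (v, 0) + (y, t)) - f (y, t))) =
  (fun h : R => h^-1 *: (f (h *: v + y, t) - f (y, t))).
Proof.
apply/funext => h; congr (_ *: (f _ - _)).
by congr pair; rewrite /= scaler0 add0r.
Qed.

Let quot_t (y : V) (t : R) :
  (fun h : R => h^-1 *: (f (h *: (0, 1) + (y, t)) - f (y, t))) =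
  (fun h : R => h^-1 *: (f (y, h *: 1 + t) - f (y, t))).
Proof.
apply/funext => h; congr (_ *: (f _ - _)).
by congr pair; rewrite /= scaler0 add0r.
Qed.

(** The regularity of a solution is stated in space-time, the equation for slices. A difference
    quotient along [(v, 0)] or [(0, 1)] moves one variable only, so the two agree. *)
Lemma derive_slice_space (v y : V) (t : R) :
  'D_(v, 0) f (y, t) = 'D_v (fun y => f (y, t)) y.
Proof. by rewrite /derive quot_x. Qed.

Lemma derivable_slice_space (v y : V) (t : R) :
  derivable f (y, t) (v, 0) -> derivable (fun y => f (y, t)) y v.
Proof. by rewrite /derivable quot_x. Qed.

Lemma derivable_slice_time (y : V) (t : R) :
  derivable f (y, t) (0, 1) -> derivable (fun t => f (y, t)) t 1.
Proof. by rewrite /derivable quot_t. Qed.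

Lemma continuous_slice (y : V) (t : R) :
  {for (y, t), continuous f} -> {for y, continuous (fun y => f (y, t))}.
Proof.
move=> cf; apply: (@continuous_comp _ _ _ (fun y : V => (y, t)) f) => //.
by apply: (@cvg_pair _ _ _ _ (nbhs y) (nbhs t)); [exact: cvg_id|exact: cvg_cst].
Qed.

End Slices.

Lemma graph_coefE (R : realType) (n : nat) (F : 'rV[R]_n.+1 -> R) (p : 'rV[R]_n) i j :
  graph_coef F p i j = hess_mx F (graph_normal p) (lift ord0 i) (lift ord0 j).
Proof.
rewrite /graph_coef; move: (hess_mx _ _) => M.
rewrite mxE (bigD1 (lift ord0 j)) //= [_^T _ _]mxE [graph_emb _ _ _ _]mxE eqxx mulr1.
rewrite big1 => [|k kj]; last by rewrite [_^T _ _]mxE [graph_emb _ _ _ _]mxE (negPf kj) mulr0.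
rewrite addr0 mxE (bigD1 (lift ord0 i)) //= [graph_emb _ _ _ _]mxE eqxx mul1r.
rewrite big1 => [|k ki]; last by rewrite [graph_emb _ _ _ _]mxE (negPf ki) mul0r.
by rewrite addr0.
Qed.

(** * Partial derivatives of the solution on time slices *)

Section Solution.
Variables (R : realType) (n : nat) (F : 'rV[R]_n.+1 -> R) (T : R) (u : 'rV[R]_n -> R -> R).
Hypothesis sol : C3_solution F T u.
Let uu := fun z : 'rV[R]_n * R => u z.1 z.2.
Let S := [set z : 'rV[R]_n * R | 0 < z.2 < T].

Let bx_in (i : 'I_n) : (bvec R i, 0 : R) \in st_dirs R n.
Proof. by rewrite inE; apply/orP; right; apply/mapP; exists i => //; rewrite mem_enum. Qed.

Let D1 j := 'D_(bvec R j, 0 : R) uu.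
Let D2 i j := 'D_(bvec R i, 0 : R) ('D_(bvec R j, 0 : R) uu).

Let Ckd vs v z : (size vs < 3)%N -> all (fun v => v \in st_dirs R n) vs -> v \in st_dirs R n ->
  S z -> derivable (Defs.iterD vs uu) z v.
Proof. by move=> s a vin Sz; case: sol => -[[H _] _] _; exact: H. Qed.

Let Ckc vs z : (size vs <= 3)%N -> all (fun v => v \in st_dirs R n) vs ->
  S z -> {for z, continuous (Defs.iterD vs uu)}.
Proof. by move=> s a Sz; case: sol => -[[_ H] _] _; exact: H. Qed.

Lemma solution_continuous y t : 0 < t < T -> {for (y, t), continuous uu}.
Proof. by move=> tT; apply: (@Ckc [::]). Qed.

Lemma solution_dx y t i : 0 < t < T ->
  is_derive y (bvec R i) (fun y => u y t) (du u i y t).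
Proof.
move=> tT; apply: derivableP.
by apply: (@derivable_slice_space _ _ uu); apply: (@Ckd [::]) => //; rewrite inE eqxx.
Qed.

Let D1E j t : (fun y => D1 j (y, t)) = (fun y => du u j y t).
Proof. by apply/funext => y; exact: derive_slice_space. Qed.

Lemma solution_dx_cont y t i : 0 < t < T -> {for y, continuous (fun y => du u i y t)}.
Proof.
move=> tT; rewrite -D1E; apply: (@continuous_slice _ _ (D1 i)).
by apply: (@Ckc [:: (bvec R i, 0)]) => //=; rewrite bx_in.
Qed.

Lemma solution_dxx y t i j : 0 < t < T ->
  is_derive y (bvec R i) (fun y => du u j y t) (d2u u i j y t).
Proof.
move=> tT; apply: derivableP; rewrite -D1E.
apply: (@derivable_slice_space _ _ (D1 j)).
by apply: (@Ckd [:: (bvec R j, 0)]) => //=; rewrite ?bx_in.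
Qed.

Lemma solution_dxx_cont y t i j : 0 < t < T -> {for y, continuous (fun y => d2u u i j y t)}.
Proof.
move=> tT.
have -> : (fun y => d2u u i j y t) = (fun y => D2 i j (y, t)).
  apply/funext => z; rewrite /D2 derive_slice_space.
  by rewrite -[fun y => _]/(fun y => D1 j (y, t)) D1E.
apply: (@continuous_slice _ _ (D2 i j)).
by apply: (@Ckc [:: (bvec R i, 0); (bvec R j, 0)]) => //=; rewrite !bx_in.
Qed.

Lemma solution_dt y t : 0 < t < T -> is_derive t 1 (u y) (dtu u y t).
Proof.
move=> tT; apply: derivableP.
by apply: (@derivable_slice_time _ _ uu); apply: (@Ckd [::]) => //; rewrite inE eqxx.
Qed.

Lemma solution_AMCF y t : 0 < t < T ->
  dtu u y t = \sum_i \sum_j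
    graph_coef F (grad_row (fun i y => du u i y t) y) i j * d2u u i j y t.
Proof.
move=> tT; case: sol => _ /(_ y t tT); rewrite /AMCF_at => ->.
have E : Du u y t - phi0 R n = graph_normal (grad_row (fun i y => du u i y t) y).
  rewrite /graph_normal /Du; congr (_ - _); rewrite mulmx_sum_row.
  apply: eq_bigr => i _; rewrite mxE; congr (_ *: _).
  by apply/rowP => j; rewrite !mxE.
rewrite E; apply: eq_bigr => i _; apply: eq_bigr => j _; congr (_ * _).
by rewrite graph_coefE /hess_mx mxE.
Qed.

End Solution.

Lemma continuous_enorm (R : realType) (m : nat) : continuous (@enorm R m).
Proof.
move=> x; apply/(@cvgrPdist_lt _ _ _ _ (nbhs_filter x)) => e e0; apply: nbhs_le_nbhs_norm.
exists (e / (m%:R + 1)); first by rewrite /= divr_gt0 // ltr_wpDl.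
move=> y /= xy; apply: le_lt_trans (_ : enorm (x - y) < e).
  rewrite ler_norml; have := enormD (x - y) y; have := enormB x (x - y).
  by rewrite subrK opprB addrC subrK; lra.
apply: le_lt_trans (enorm_le_norm _) _.
move: xy; rewrite ltr_pdivlMr ?ltr_wpDl // => xy; apply: le_lt_trans xy.
by rewrite mulrC ler_wpM2l // lerDl.
Qed.

Lemma rderN (R : realType) (t : R) (f : R -> R) (a : R) : is_derive t 1 f a ->
  is_derive t 1 (fun s => - f s) (- a).
Proof. by move=> Hf; exact: is_deriveN Hf. Qed.

(** One penalty parameter has to satisfy several smallness conditions at once, each linear in its
    square. *)
Lemma small_sqr (R : realType) (s : seq (R * R)) : all (fun p => 0 < p.2) s ->
  exists2 mu : R, 0 < mu & all (fun p => mu ^+ 2 * p.1 <= p.2) s.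
Proof.
elim: s => [|[a b] s IH] /=; first by exists 1.
move=> /andP[b0 sp]; have [m m0 Hm] := IH sp.
pose d := b / (`|a| + 1); have a1 : 0 < `|a| + 1 by rewrite ltr_wpDl.
have d0 : 0 < d by rewrite divr_gt0.
pose k := Num.min m (Num.min 1 d).
have k0 : 0 < k by rewrite !lt_min m0 d0 ltr01.
have km : k <= m by rewrite ge_min lexx.
have k1 : k <= 1 by rewrite !ge_min lexx !orbT.
have kd : k <= d by rewrite !ge_min lexx !orbT.
exists k => //; apply/andP; split.
  have k2 : k ^+ 2 <= d by apply: le_trans kd; rewrite expr2 ler_piMl // ltW.
  apply: le_trans (_ : d * (`|a| + 1) <= _); last by rewrite divfK ?gt_eqF.
  apply: le_trans (_ : k ^+ 2 * (`|a| + 1) <= _); last by rewrite ler_wpM2r // ltW.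
  by apply: ler_wpM2l; [exact: sqr_ge0|have := ler_norm a; lra].
apply/allP => p ps; have := allP Hm p ps; have := allP sp p ps => p0 H.
have [c0|c0] := leP 0 p.1.
  by apply: le_trans H; rewrite ler_wpM2r // ler_sqr ?nnegrE // ltW.
by apply: le_trans (ltW p0); rewrite mulr_ge0_le0 ?sqr_ge0 // ltW.
Qed.

Definition zeta (R : realType) (K L s t : R) := expR (- (K / t)) * (expR (L / t * s) - 1).

(** The exponent [L * s <= 2 * M * L] is overcome by [K] with [2 * L] to spare. This surplus gives
    the decay as [t] tends to 0, and later zeta_s <= 1. *)
Lemma zeta_le (R : realType) (K L M s t : R) : 0 < L -> K = 2 * (M + 1) * L -> 0 < t -> s <= 2 * M ->
  expR (- (K / t)) * expR (L / t * s) <= expR (- (2 * (L / t))).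
Proof.
move=> L0 -> t0 sM; rewrite -expRD ler_expR.
have Lt : 0 < L / t by rewrite divr_gt0.
have -> : 2 * (M + 1) * L / t = 2 * (M + 1) * (L / t) by ring.
have := ler_wpM2l (ltW Lt) sM; lra.
Qed.

Lemma expRN_le_inv (R : realType) (x : R) : 0 < x -> expR (- x) <= x^-1.
Proof.
move=> x0; rewrite expRN lef_pV2 ?posrE ?expR_gt0 //.
by apply: le_trans (expR_ge1Dx x); lra.
Qed.

Lemma continuous_exp_comp (R : realType) (P : topologicalType) (f : P -> R) (p : P) :
  {for p, continuous f} -> {for p, continuous (fun q => expR (f q))}.
Proof. by move=> cf; apply: (@continuous_comp _ _ _ f expR) => //; exact: continuous_expR. Qed.

Lemma continuous_zeta (R : realType) (P : topologicalType) (K L : R) (f g : P -> R) (p : P) :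
  g p != 0 -> {for p, continuous f} -> {for p, continuous g} ->
  {for p, continuous (fun q => zeta K L (f q) (g q))}.
Proof.
move=> g0 cf cg; have cV := continuousV g0 cg.
have cst (k : R) : {for p, continuous (fun _ : P => k)} by exact: cvg_cst.
have c1 := continuous_exp_comp (continuousN (continuousM (cst K) cV)).
have c2 := continuous_exp_comp (continuousM (continuousM (cst L) cV) cf).
exact: continuousM c1 (continuousB c2 (cst 1)).
Qed.

(** * The maximum principle for the doubled function *)

Section TwoPointBound.
Variables (R : realType) (n : nat) (F : 'rV[R]_n.+1 -> R).
Hypothesis HF : standing_assumptions F.
Variables (c B D : R).
Hypotheses (c0 : 0 < c) (B0 : 0 <= B) (D0 : 0 <= D).
Hypothesis bounds : forall x, x != 0 ->
    [/\ (forall v, c * (dot v v - dot v x ^+ 2 / dot x x) <= dot (v *m hess_mx F x) v),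
        opbound (hess_mx F x) B &
        forall y, y != 0 -> enorm (x - y) <= 2^-1 * enorm y ->
          opbound (hess_mx F x - hess_mx F y) (D * (enorm (x - y) / enorm y))].
Variables (T M : R) (u : 'rV[R]_n -> R -> R).
Hypothesis sol : C3_solution F T u.
Hypotheses (M0 : 0 < M) (uM : forall y t, 0 <= t <= T -> `|u y t| <= M).
(** Determined by [L^2 * (c / 20) = K], given [K = 2 * (M + 1) * L]. *)
Let L := 40 * (M + 1) / c.
Let K := 2 * (M + 1) * L.

Let M1 : 0 < M + 1. Proof. exact: addr_gt0. Qed.
Let L0 : 0 < L. Proof. by apply: divr_gt0 => //; exact: mulr_gt0. Qed.
Let K0 : 0 < K. Proof. by apply: mulr_gt0 => //; exact: mulr_gt0. Qed.

Let osc x y t : 0 < t < T -> u x t - u y t <= 2 * M.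
Proof.
move=> tT; have H : 0 <= t <= T by case/andP: tT => ? ?; rewrite !ltW.
by have := uM x H; have := uM y H; rewrite !ler_norml; lra.
Qed.

Definition two_point_fun (dl mu : R) (p : ('rV[R]_n * 'rV[R]_n) * R) : R :=
  zeta K L (u p.1.1 p.2 - u p.1.2 p.2) p.2
  - (enorm (p.1.1 - p.1.2) + dl * Num.sqrt (enorm (p.1.1 - p.1.2)))
  - mu ^+ 2 * enorm p.1.1 ^+ 2.

Lemma two_point_fun_continuous dl mu p : 0 < p.2 < T ->
  {for p, continuous (two_point_fun dl mu)}.
Proof.
case: p => [[x y] t] /= tT.
pose P := (('rV[R]_n * 'rV[R]_n) * R)%type; pose q0 : P := ((x, y), t).
have cst (k : R) : {for q0, continuous (fun _ : P => k)} by exact: cvg_cst.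
have c2 : {for q0, continuous (fun q : P => q.2)} by exact: cvg_snd.
have c1 : {for q0, continuous (fun q : P => q.1)} by exact: cvg_fst.
have c11 : {for q0, continuous (fun q : P => q.1.1)}.
  exact: (@continuous_comp _ _ _ _ (@fst 'rV[R]_n 'rV[R]_n) q0 c1 cvg_fst).
have c12 : {for q0, continuous (fun q : P => q.1.2)}.
  exact: (@continuous_comp _ _ _ _ (@snd 'rV[R]_n 'rV[R]_n) q0 c1 cvg_snd).
have cu (f : P -> 'rV[R]_n) : {for q0, continuous f} ->
    {for q0, continuous (fun q : P => u (f q) q.2)}.
  move=> cf; have cp : {for q0, continuous (fun q : P => (f q, q.2))}.
    by apply: (@cvg_pair _ _ _ _ (nbhs (f q0)) (nbhs q0.2)).
  apply: (@continuous_comp _ _ _ _ (fun z : 'rV[R]_n * R => u z.1 z.2) q0 cp).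
  exact: (solution_continuous sol).
have t0 : q0.2 != 0 by rewrite gt_eqF //; case/andP: tT.
have cs0 := @continuousB _ _ _ (fun q : P => u q.1.1 q.2) (fun q : P => u q.1.2 q.2) q0
  (cu _ c11) (cu _ c12).
have cz := @continuous_zeta _ _ K L _ (fun q : P => q.2) q0 t0 cs0 c2.
have ce (f : P -> 'rV[R]_n) : {for q0, continuous f} ->
    {for q0, continuous (fun q : P => enorm (f q))}.
  by move=> cf; exact: (@continuous_comp _ _ _ f (@enorm R n) q0 cf (@continuous_enorm R n _)).
have cd := ce _ (@continuousB _ _ _ (fun q : P => q.1.1) (fun q : P => q.1.2) q0 c11 c12).
have cs := @continuous_comp _ _ _ _ (@Num.sqrt R) q0 cd (@sqrt_continuous R _).
have cx := ce _ c11.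
exact: continuousB (continuousB cz (continuousD cd (continuousM (cst dl) cs)))
  (continuousM (cst (mu ^+ 2)) (continuousM cx cx)).
Qed.


Let K1 := (D + 2 * c) ^+ 2 / c + c.
Let C := n%:R * (4 * (B + c) + 2 * (D + 2 * c) + 2 * K1).

(** By contradiction. Half of the excess at the given point, [m], will be a lower bound for the
    maximum; the other half absorbs the penalty at [x0]. *)
Lemma two_point_delta dl x0 y0 t0 : 0 < dl <= 1 -> 0 < t0 < T ->
  zeta K L (u x0 t0 - u y0 t0) t0 <= enorm (x0 - y0) + dl * Num.sqrt (enorm (x0 - y0)).
Proof.
move=> /andP[dl0 dl1] /andP[t00 t0T]; rewrite leNgt; apply/negP => H.
have L0' := L0; have K0' := K0.
pose m := (zeta K L (u x0 t0 - u y0 t0) t0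
  - (enorm (x0 - y0) + dl * Num.sqrt (enorm (x0 - y0)))) / 2.
have m0 : 0 < m by rewrite divr_gt0 // subr_gt0.
(* At time [t1] zeta is at most exp(-2L/t1) <= t1/(2L) <= m/2, so a maximum of at least [m] is not
   attained at this initial time. *)
pose t1 := Num.min (t0 / 2) (L * m).
have t10 : 0 < t1 by rewrite lt_min divr_gt0 // mulr_gt0.
have t1t0 : t1 < t0.
  by apply: le_lt_trans (_ : t0 / 2 < t0); [rewrite ge_min lexx|lra].
have t1m : t1 <= L * m by rewrite ge_min lexx orbT.
have inT t : t1 <= t <= t0 -> 0 < t < T.
  by move=> /andP[a b]; rewrite (lt_le_trans t10 a) (le_lt_trans b t0T).
(* [mu] must be fixed before the maximum point is known. On [[t1, t0]] the factor exp(-K/t) is at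
   least [w], and zeta_s is at least [L / t0 * w] wherever zeta is positive. *)
pose w := expR (- (K / t1)); have w0 : 0 < w by exact: expR_gt0.
have w' : 0 < L / t0 * w by rewrite mulr_gt0 // divr_gt0.
have sl0 : 0 < K / t0 ^+ 2 * w.
  by apply: mulr_gt0 => //; apply: divr_gt0 => //; exact: exprn_gt0.
have pos3 : 0 < dl * c * (L / t0 * w) ^+ 2.
  by apply: mulr_gt0; [exact: mulr_gt0|exact: exprn_gt0].
have pos4 : 0 < K / t0 ^+ 2 * w / 2 by exact: divr_gt0.
(* In order: [4 * mu <= 1], positivity of the coupling, the concavity of the modulus against the
   error of the normals, the Hessian of the penalty against half of the surplus, and the penalty at
   [x0] against [m]. *)
have [|mu mu0 /=] := @small_sqr R [:: (16, 1); (32 * K1, c); (1280 * C, dl * c * (L / t0 * w) ^+ 2);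
    (2 * (n%:R * B), K / t0 ^+ 2 * w / 2); (enorm x0 ^+ 2, m)].
  by rewrite /= ltr01 c0 pos3 pos4 m0.
move=> /and5P[S1 S2 S3 S4 /andP[S5 _]].
set Z := two_point_fun dl mu.
have ZE x y t : Z (x, y, t) = zeta K L (u x t - u y t) t
    - (enorm (x - y) + dl * Num.sqrt (enorm (x - y))) - mu ^+ 2 * enorm x ^+ 2 by [].
have Z0 : m <= Z (x0, y0, t0) by move: S5; rewrite ZE /m; lra.
have psi_ge (x y : 'rV[R]_n) : enorm (x - y) <= enorm (x - y) + dl * Num.sqrt (enorm (x - y)).
  by rewrite lerDl; apply: mulr_ge0; [exact: ltW|exact: sqrtr_ge0].
have Ezeta x y t : t1 <= t <= t0 ->
    expR (- (K / t)) * expR (L / t * (u x t - u y t)) <= expR (- (2 * (L / t))).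
  move=> Ht; have tT := inT t Ht; apply: (zeta_le (M := M)) => //; first by case/andP: tT.
  exact: osc.
have zle x y t : t1 <= t <= t0 -> zeta K L (u x t - u y t) t <= expR (- (2 * (L / t))).
  move=> Ht; apply: le_trans (Ezeta x y t Ht).
  by rewrite /zeta mulrBr mulr1 gerBl expR_ge0.
have zle1 x y t : t1 <= t <= t0 -> zeta K L (u x t - u y t) t <= 1.
  move=> Ht; apply: le_trans (zle x y t Ht) _; rewrite -expR0 ler_expR oppr_le0.
  by case/andP: (inT t Ht) => tp _; apply: mulr_ge0 => //; apply: divr_ge0; exact: ltW.
(* As zeta <= 1, positivity of [Z] forces |x - y| <= 1 and mu |x| <= 1. All positive values on the
   time interval thus occur in this compact set, and its maximum is a maximum over all [x] and
   [y]. *)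
pose A : set (('rV[R]_n * 'rV[R]_n) * R) :=
  ([set x | 0 <= `|x| <= mu^-1] `*` [set y | 0 <= `|y| <= mu^-1 + 1]) `*` `[t1, t0].
have cA : compact A.
  apply: compact_setX; last exact: segment_compact.
  by apply: compact_setX; exact: annulus_compact.
have posA x y t : t1 <= t <= t0 -> 0 < Z (x, y, t) ->
    [/\ 0 < zeta K L (u x t - u y t) t, enorm (x - y) <= 1, mu * enorm x <= 1 & A (x, y, t)].
  move=> Ht; rewrite ZE => Zp; have z1 := zle1 x y t Ht.
  have mx : 0 <= mu ^+ 2 * enorm x ^+ 2 by apply: mulr_ge0; exact: sqr_ge0.
  have exy := psi_ge x y; have exy0 := enorm_ge0 (x - y).
  have zp : 0 < zeta K L (u x t - u y t) t by lra.
  have xy1 : enorm (x - y) <= 1 by lra.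
  have mux : mu * enorm x <= 1.
    have mx0 : 0 <= mu * enorm x by apply: mulr_ge0; [exact: ltW|exact: enorm_ge0].
    have : (mu * enorm x) ^+ 2 <= 1 ^+ 2 by rewrite exprMn expr1n; lra.
    by rewrite ler_sqr ?nnegrE.
  have xmu : enorm x <= mu^-1 by rewrite -[leRHS]mul1r ler_pdivlMr // mulrC.
  split => //; split; last by rewrite /= in_itv.
  split; rewrite /= normr_ge0 /=; first exact: le_trans (norm_le_enorm x) xmu.
  apply: le_trans (norm_le_enorm y) _.
  by have := enormB x (x - y); rewrite opprB addrC subrK; lra.
have t00' : t1 <= t0 <= t0 by rewrite lexx ltW.
have A0 : A !=set0.
  by exists (x0, y0, t0); have [] := posA x0 y0 t0 t00' (lt_le_trans m0 Z0).
have cZ : {within A, continuous Z}.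
  apply: continuous_in_subspaceT => -[[x y] t] /set_mem [_ /=]; rewrite in_itv /= => Ht.
  by apply: two_point_fun_continuous; exact: inT.
have [[[x y] t] Ain Zmax'] := compact_EVT_max A0 cA cZ.
have Ht : t1 <= t <= t0 by move/set_mem: Ain => [_ /=]; rewrite in_itv.
have Zm : m <= Z (x, y, t).
  apply: (le_trans Z0); apply: Zmax'; apply/mem_set.
  by have [] := posA x0 y0 t0 t00' (lt_le_trans m0 Z0).
have Zmax x' y' t' : t1 <= t' <= t0 -> Z (x', y', t') <= Z (x, y, t).
  move=> Ht'; have [Zn|Zp] := leP (Z (x', y', t')) 0.
    by apply: le_trans Zn _; apply: le_trans Zm; exact: ltW.
  by apply: Zmax'; apply/mem_set; have [] := posA x' y' t' Ht' Zp.
have [zp xy1 mux _] := posA x y t Ht (lt_le_trans m0 Zm).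
have tT := inT t Ht; have tp : 0 < t by case/andP: tT.
have t1t : t1 < t.
  rewrite lt_def; case/andP: (Ht) => -> _; rewrite andbT; apply/eqP => tt1.
  have Lt : 0 < 2 * (L / t) by rewrite mulr_gt0 // divr_gt0.
  have := zle x y t Ht; have := expRN_le_inv Lt; rewrite {2 4}tt1.
  have -> : (2 * (L / t1))^-1 = t1 / L / 2 by field; rewrite !gt_eqF.
  have : t1 / L <= m by rewrite ler_pdivrMr // mulrC.
  move: Zm; rewrite ZE; have := psi_ge x y; have := enorm_ge0 (x - y).
  have : 0 <= mu ^+ 2 * enorm x ^+ 2 by apply: mulr_ge0; exact: sqr_ge0.
  by rewrite tt1; lra.
pose a := expR (- (K / t)); pose b := L / t; pose s := u x t - u y t.
pose E := expR (b * s).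
have a0 : 0 < a by exact: expR_gt0.
have b0 : 0 < b by rewrite divr_gt0.
have zE : zeta K L s t = a * (E - 1) by [].
have E1 : 1 < E by move: zp; rewrite zE pmulr_rgt0 // subr_gt0.
have s0 : 0 < s by move: E1; rewrite /E -expR0 ltr_expR pmulr_rgt0.
have xy0 : x - y != 0.
  by rewrite subr_eq0; apply: contraTneq s0 => xy; rewrite /s xy subrr ltxx.
have nxy : 0 < enorm (x - y) by rewrite enorm_gt0.
have h1 z i : is_derive z (bvec R i) (fun y => u y t) (du u i z t).
  exact: (solution_dx sol).
have h2 i z : {for z, continuous (fun y => du u i y t)} by exact: (solution_dx_cont sol).
have h3 z i j : is_derive z (bvec R i) (fun y => du u j y t) (d2u u i j z t).
  exact: (solution_dxx sol).
have h4 i j z : {for z, continuous (fun y => d2u u i j y t)} by exact: (solution_dxx_cont sol).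
have hmax x' y' : a * (expR (b * (u x' t - u y' t)) - 1)
    - (enorm (x' - y') + dl * Num.sqrt (enorm (x' - y'))) - mu ^+ 2 * dot x' x'
  <= a * (expR (b * (u x t - u y t)) - 1)
    - (enorm (x - y) + dl * Num.sqrt (enorm (x - y))) - mu ^+ 2 * dot x x.
  by rewrite !dot_enorm; exact: Zmax.
have [P1 P2 so] := @two_point_max R n (fun y => u y t) (fun i y => du u i y t)
  (fun i j y => d2u u i j y t) h1 h2 h3 h4 a b dl (mu ^+ 2) x y xy0 hmax.
rewrite -/s -/E in P1 P2 so.
have aw : w <= a.
  rewrite ler_expR lerN2 ler_pM2l // lef_pV2 ?posrE // ltW //.
have bL : L / t0 <= b.
  by rewrite ler_pM2l // lef_pV2 ?posrE //; case/andP: Ht.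
have phiw : L / t0 * w <= a * b * E.
  apply: le_trans (_ : a * b <= _); last by rewrite ler_peMr ?(ltW E1) // ltW // mulr_gt0.
  by rewrite mulrC ler_pM // ltW // divr_gt0.
have phi0 : 0 < a * b * E by exact: lt_le_trans w' phiw.
(* With [a * E <= exp(-2b)] one gets [a * b * E <= b / (2b)]. *)
have phi1 : a * b * E <= 1.
  have b2 : 0 < 2 * b by rewrite mulr_gt0.
  have := le_trans (Ezeta x y t Ht) (expRN_le_inv b2); rewrite -/b -/s -/E -/a => H1.
  have := ler_wpM2l (ltW b0) H1.
  have -> : b * (2 * b)^-1 = 2^-1 by field; rewrite gt_eqF.
  rewrite mulrCA mulrA => H2; apply: le_trans H2 _.
  by rewrite invf_le1 // ler1n.
have phi01 : 0 < a * b * E <= 1 by rewrite phi0.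
have phi2 : 0 <= a * b ^+ 2 * E.
  apply: mulr_ge0; first by apply: mulr_ge0; [exact: ltW|exact: sqr_ge0].
  exact: ltW (lt_trans ltr01 E1).
have e1 : dot ((enorm (x - y))^-1 *: (x - y)) ((enorm (x - y))^-1 *: (x - y)) = 1.
  by rewrite dotZl dotZr dot_enorm; field; rewrite gt_eqF.
have mu4 : 4 * mu <= 1.
  have m4 : 0 <= 4 * mu by apply: mulr_ge0 => //; exact: ltW.
  have : (4 * mu) ^+ 2 <= 1 ^+ 2 by rewrite exprMn expr1n; lra.
  by rewrite ler_sqr ?nnegrE.
have S3' : mu ^+ 2 * (1280 * C) <= dl * c * (a * b * E) ^+ 2.
  apply: le_trans S3 _; apply: ler_wpM2l; first by rewrite mulr_ge0 // ltW.
  by rewrite ler_sqr ?nnegrE // ltW.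
have r01 : 0 < enorm (x - y) <= 1 by rewrite nxy.
have dl01 : 0 < dl <= 1 by rewrite dl0.
have tr z : \sum_i \sum_j graph_coef F (grad_row (fun i y => du u i y t) z) i j
    * hess_fun (fun i j y => d2u u i j y t) z i j = dtu u z t.
  rewrite (solution_AMCF sol z tT); apply: eq_bigr => i _; apply: eq_bigr => j _.
  by rewrite [hess_fun _ _ _ _]mxE.
have DI : a * b * E * (dtu u x t - dtu u y t)
    <= - (a * b ^+ 2 * E * (c / 20)) + mu ^+ 2 * (2 * (n%:R * B)).
  rewrite -(tr x) -(tr y).
  exact: (doubling_ineq HF c0 B0 D0 bounds e1 phi01 phi2 r01 dl01 mu0 mux P1 P2 so mu4 S2 S3').
have tn0 : t != 0 by rewrite gt_eqF.
have dtx z : is_derive t 1 (u z) (dtu u z t) by exact: (solution_dt sol).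
have dinv := rderV (f := fun s => s) tn0 (rder_id t).
have dz := rderM (rder_exp (rderN (rderZ K dinv)))
  (rderB (rder_exp (rderM (rderZ L dinv) (rderB (dtx x) (dtx y))))
    (rder_cst t 1)).
have r0 : 0 < t - t1 by rewrite subr_gt0.
have := is_derive_max_left r0 dz => /(_ _)/wrap[].
  move=> tau; rewrite opprB addrC subrK => ht1 ht2.
  have Htau : t1 <= tau <= t0 by rewrite ltW // (le_trans ht2) //; case/andP: Ht.
  have := Zmax x y tau Htau; rewrite !ZE /zeta lerD2r lerD2r.
  by rewrite /GRing.scale /=.
rewrite -/a -/b -/s -/E.
have Kc : b ^+ 2 * (c / 20) = K / t ^+ 2 by rewrite /b /K /L; field; rewrite !gt_eqF.
(* The terms with [K / t^2 * a * E] from the time derivative and from [(c / 20)] zeta_ss cancel; the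
   -1 in zeta leaves [- K / t^2 * a]. This bound for it does not depend on the maximum point and
   exceeds the penalty error, which contradicts a nonnegative time derivative. *)
have slack : K / t0 ^+ 2 * w <= K / t ^+ 2 * a.
  apply: ler_pM; [|exact: ltW| |exact: aw].
    by apply: divr_ge0; [exact: ltW|exact: sqr_ge0].
  rewrite ler_pM2l // lef_pV2 ?posrE ?exprn_gt0 // ler_sqr ?nnegrE ?(ltW t00) ?(ltW tp) //.
  by case/andP: Ht.
have E2 : a * b ^+ 2 * E * (c / 20) = a * E * (K / t ^+ 2) by rewrite -Kc; ring.
rewrite E2 in DI.
set dd := (X in 0 <= X -> _).
have -> : dd = K / t ^+ 2 * a * (E - 1) - a * E * (L / t ^+ 2) * s
   + a * b * E * (dtu u x t - dtu u y t).
  by rewrite /dd /b -/s; field.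
have : 0 <= a * E * (L / t ^+ 2) * s.
  apply: mulr_ge0; last exact: ltW.
  apply: mulr_ge0; first by apply: mulr_ge0; apply: ltW => //; exact: lt_trans ltr01 E1.
  by apply: divr_ge0; [exact: ltW|exact: sqr_ge0].
move: slack sl0 S4 DI.
move: (a * E * (L / t ^+ 2) * s) (a * b * E * (dtu u x t - dtu u y t)) => q1 q2.
rewrite mulrBr mulr1 (mulrC (a * E)) (mulrA (K / t ^+ 2) a E).
move: (K / t0 ^+ 2 * w) (K / t ^+ 2 * a * E) (K / t ^+ 2 * a) (mu ^+ 2 * _) => q3 q4 q5 q6.
lra.
Qed.

(** Let [dl] tend to 0, then use exp(z) - 1 >= z to pass from zeta to a bound linear in the
    difference of [u]. *)
Lemma two_point_bound x y t : 0 < t < T ->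
  u x t - u y t <= t / L * expR (K / t) * enorm (x - y).
Proof.
move=> tT; have tp : 0 < t by case/andP: tT.
have L0' := L0.
have Z : zeta K L (u x t - u y t) t <= enorm (x - y).
  apply/ler_addgt0Pr => e e0; set r := enorm (x - y).
  have r0 : 0 <= r by exact: enorm_ge0.
  pose d := Num.min 1 (e / (Num.sqrt r + 1)).
  have sr : 0 < Num.sqrt r + 1 by rewrite ltr_wpDl ?sqrtr_ge0.
  have d0 : 0 < d by rewrite lt_min ltr01 divr_gt0.
  have d1 : 0 < d <= 1 by rewrite d0 ge_min lexx.
  apply: le_trans (two_point_delta x y d1 tT) _; rewrite lerD2l.
  apply: le_trans (_ : e / (Num.sqrt r + 1) * (Num.sqrt r + 1) <= _); last by rewrite divfK ?gt_eqF.
  by apply: ler_pM; rewrite ?sqrtr_ge0 ?(ltW d0) // ?ge_min ?lexx ?orbT // lerDl.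
have a0 := expR_gt0 (K / t).
have H : L / t * (u x t - u y t) <= expR (K / t) * enorm (x - y).
  have := ler_wpM2l (ltW a0) Z; rewrite /zeta mulrA expRN mulfV ?gt_eqF // mul1r.
  by apply: le_trans; rewrite lerBrDl expR_ge1Dx.
have tL : 0 <= t / L by apply: divr_ge0; exact: ltW.
have := ler_wpM2l tL H.
have -> : t / L * (L / t * (u x t - u y t)) = u x t - u y t by field; rewrite !gt_eqF.
by rewrite mulrA.
Qed.

End TwoPointBound.

(** * The gradient estimate *)

Section FinalTime.
Variables (R : realType) (n : nat) (F : 'rV[R]_n.+1 -> R) (T : R) (u : 'rV[R]_n -> R -> R).
Hypotheses (T0 : 0 < T) (sol : C3_solution F T u).

(** The equation holds for [t < T] only; continuity on the closure carries the Lipschitz bound to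
    [t = T]. *)
Lemma solution_final_time x (e : R) : 0 < e ->
  exists2 d, 0 < d & forall t, T - d < t < T -> `|u x T - u x t| < e.
Proof.
move=> e0; pose S := [set z : 'rV[R]_n * R | 0 < z.2 < T].
have point_S (d : R) : 0 < d -> exists2 t, 0 < t < T & T - d < t.
  move=> d0; exists (T - Num.min d T / 2).
    have m1 : Num.min d T <= T by rewrite ge_min lexx orbT.
    have m0 : 0 < Num.min d T by rewrite lt_min d0.
    by apply/andP; split; lra.
  have m1 : Num.min d T <= d by rewrite ge_min lexx.
  have m0 : 0 < Num.min d T by rewrite lt_min d0.
  lra.
have clS : closure S (x, T).
  move=> B /nbhs_ballP [r /= r0 HB]; have [t tT tr] := point_S r r0.
  exists (x, t); split => //; apply: HB; split => /=; first exact: ballxx.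
  by rewrite /ball /= ger0_norm; case/andP: tT => ? ?; lra.
case: sol => -[_ [cS _]] _.
have H : (fun z : 'rV[R]_n * R => u z.1 z.2) z @[z --> within (closure S) (nbhs (x, T))]
    --> u x T by exact: iffLR (subspace_continuousP (closure S) _) cS (x, T) clS.
move/cvgrPdist_lt: H => /(_ _ e0) /nbhs_ballP [d /= d0 Hd].
exists (Num.min d T) => [|t]; first by rewrite lt_min d0.
rewrite ltrBlDr => /andP[t1 t2].
have m1 : Num.min d T <= T by rewrite ge_min lexx orbT.
have m2 : Num.min d T <= d by rewrite ge_min lexx.
apply: (Hd (x, t)); last by apply: subset_closure; rewrite /S /=; apply/andP; split; lra.
split => /=; first exact: ballxx.
by rewrite /ball /= ger0_norm; lra.
Qed.

End FinalTime.

(* Where the directional derivative does not exist, ['D_v f x] is [0]; so nothing is needed about [u] at [t = T]. *)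
Lemma derive_bound (R : realType) (V : normedModType R) (f : V -> R) (x v : V) (k : R) :
  0 <= k -> (forall h : R, `|f (h *: v + x) - f x| <= `|h| * k) -> `|'D_v f x| <= k.
Proof.
move=> k0 H; have [D|/dvgP D] := pselect (derivable f x v); last first.
  by rewrite /derive D normr0.
have D' : (fun h : R => `|h^-1 *: (f (h *: v + x) - f x)|) @ 0^' --> `|'D_v f x|.
  by apply: cvg_norm; exact: D.
apply: (cvgr_to_le D'); apply/nbhs_ballP; exists 1 => //= h _ h0.
rewrite normrZ normfV ler_pdivrMl ?normr_gt0 //; exact: H.
Qed.

Section Sublinear.
Variables (R : realType) (n : nat) (F : 'rV[R]_n.+1 -> R).
Hypothesis HF : standing_assumptions F.

Let F_hom (c : R) (p : 'rV[R]_n.+1) : 0 < c -> F (c *: p) = c * F p.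
Proof. by case: HF => _ [_ [_ [H _]]]; exact: H. Qed.

Lemma integrand0 : F 0 = 0.
Proof. by have := @F_hom 2 0 (ltr0Sn _ _); rewrite scaler0; lra. Qed.

Lemma integrand_ge0 p : 0 <= F p.
Proof.
have [->|p0] := eqVneq p 0; first by rewrite integrand0.
by case: HF => H _; apply: ltW; exact: H.
Qed.

Lemma integrand_subadd p q : F (p + q) <= F p + F q.
Proof.
have conv : F (2^-1 *: (2 *: p) + (1 - 2^-1) *: (2 *: q)) <= 2^-1 * F (2 *: p) + (1 - 2^-1) * F (2 *: q).
  by case: HF => _ [H _]; apply: H; lra.
have h2 : 1 - 2^-1 = 2^-1 :> R by lra.
move: conv; rewrite h2 !scalerA mulVf // !scale1r !F_hom //; lra.
Qed.

(** Homogeneity covers positive factors only and [F] may fail to be even, so a negative factor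
    brings in [F (- p)]. *)
Lemma integrandZ (a : R) p : F (a *: p) <= `|a| * (F p + F (- p)).
Proof.
have Fp := integrand_ge0 p; have Fn := integrand_ge0 (- p).
have [a0|a0|->] := ltgtP a 0.
- rewrite ltr0_norm // -[a]opprK scaleNr -scalerN F_hom ?oppr_gt0 // opprK.
  by rewrite ler_wpM2l ?oppr_ge0 ?(ltW a0) // lerDr.
- by rewrite gtr0_norm // F_hom // ler_wpM2l ?(ltW a0) // lerDl.
- by rewrite scale0r integrand0 normr0 mul0r.
Qed.

Lemma integrand_sum (I : finType) (a : I -> R) (p : I -> 'rV[R]_n.+1) (k : R) :
  (forall i, `|a i| <= k) ->
  F (\sum_i a i *: p i) <= k * \sum_i (F (p i) + F (- p i)).
Proof.
move=> H; rewrite mulr_sumr; elim/big_ind2 : _ => [|x1 x2 y1 y2 H1 H2|i _].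
- by rewrite integrand0.
- by apply: le_trans (integrand_subadd _ _) _; exact: lerD.
- apply: le_trans (integrandZ _ _) _; rewrite ler_wpM2r //.
  by apply: addr_ge0; exact: integrand_ge0.
Qed.

End Sublinear.

(** With y = M^2/(4t) the claim is t exp(y) >= 1, and exp(y) >= y^2/4 gives t exp(y) >= M^4/(64
    t). *)
Lemma exp_half_bound (R : realType) (M t : R) : 0 < M -> 0 < t -> t <= M ^+ 4 / 64 ->
  - (M ^+ 2 / (4 * t)) <= ln t.
Proof.
move=> M0 t0 tM; pose y := M ^+ 2 / (4 * t).
have y0 : 0 < y by rewrite divr_gt0 ?exprn_gt0 ?mulr_gt0.
have ey : y ^+ 2 / 4 <= expR y.
  have -> : expR y = expR (y / 2) ^+ 2 by rewrite expr2 -expRD; congr expR; lra.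
  have -> : y ^+ 2 / 4 = (y / 2) ^+ 2 by field.
  rewrite ler_sqr ?nnegrE ?expR_ge0 //; last by apply: divr_ge0 => //; exact: ltW.
  by apply: le_trans (expR_ge1Dx _); lra.
have ty : 1 <= t * expR y.
  apply: le_trans (_ : t * (y ^+ 2 / 4) <= _); last by rewrite ler_pM2l.
  have -> : t * (y ^+ 2 / 4) = M ^+ 4 / 64 / t by rewrite /y; field; rewrite gt_eqF.
  by rewrite ler_pdivlMr // mul1r.
have : 0 <= ln (t * expR y) by exact: ln_ge0.
by rewrite lnM ?posrE ?expR_gt0 // expRK -/y; lra.
Qed.

(** Since |X| <= M, the square is at least M^2. Half of the resulting exponent compensates
    [t^(q/2)], the other half is kept; a base at most [Rr^2] raised to the power -2 is at least
    [Rr^(-4)]. *)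
Lemma barrier_ge (R : realType) (M Rr q t X e : R) : 0 < M -> 0 < Rr -> 0 <= q -> 0 < t ->
  t <= M ^+ 4 / 64 -> `|X| <= M -> 0 < e -> e <= Rr ^+ 2 ->
  expR (q * M ^+ 2 / (8 * t)) / Rr ^+ 4 <=
  t `^ (q / 2) * expR (1 * q * (`|X| - 2 * M) ^+ 2 / (4 * t)) * e `^ (- 2).
Proof.
move=> M0 R0 q0 t0 tM XM e0 eR.
have tn0 : t != 0 by rewrite gt_eqF.
have e2 : (Rr ^+ 4)^-1 <= e `^ (- 2).
  rewrite powRN lef_pV2 ?posrE ?exprn_gt0 ?powR_gt0 //.
  rewrite -[2]/(2%:R) powR_mulrn ?(ltW e0) //.
  have -> : Rr ^+ 4 = (Rr ^+ 2) ^+ 2 by ring.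
  by rewrite ler_sqr ?nnegrE ?(ltW e0) // sqr_ge0.
have X2 : M ^+ 2 <= (`|X| - 2 * M) ^+ 2.
  rewrite -[leRHS]sqrrN ler_sqr ?nnegrE ?(ltW M0) //; lra.
have main : expR (q * M ^+ 2 / (8 * t)) <=
    t `^ (q / 2) * expR (1 * q * (`|X| - 2 * M) ^+ 2 / (4 * t)).
  rewrite /powR (negPf tn0) -expRD ler_expR mul1r.
  have l1 := exp_half_bound M0 t0 tM.
  have q2 : 0 <= q / 2 by rewrite divr_ge0.
  have := ler_wpM2l q2 l1.
  have : q * M ^+ 2 / (4 * t) <= q * (`|X| - 2 * M) ^+ 2 / (4 * t).
    apply: ler_wpM2r; first by rewrite invr_ge0 mulr_ge0 // ltW.
    exact: ler_wpM2l.
  have -> : q * M ^+ 2 / (8 * t) = q / 2 * (M ^+ 2 / (4 * t)) by field.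
  have -> : q * M ^+ 2 / (4 * t) = 2 * (q / 2 * (M ^+ 2 / (4 * t))) by field.
  lra.
by apply: ler_pM => //; rewrite ?expR_ge0 ?invr_ge0 ?exprn_ge0 ?(ltW R0).
Qed.

Unset Implicit Arguments.

Theorem theorem3 (R : realType) (n : nat) (F : 'rV[R]_n.+1 -> R) (C1 : R) :
  (1 < n)%N ->
  standing_assumptions F ->
  0 < C1 -> SC F C1 -> C1 ^+ 2 < 2 / Num.sqrt (n%:R) ->
  SYM F ->
  exists A P k : R, 0 < A /\ F (- phi0 R n) < P /\ 0 < k /\
  forall M Rr : R, 0 < M -> 0 < Rr ->
  exists T0 q r : R, 0 < T0 /\ 1 < q /\ 1 < r /\
  forall (T : R) (u : 'rV[R]_n -> R -> R),
    0 < T ->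
    C3_solution F T u ->
    (forall y t, 0 <= t <= T -> `|u y t| <= M) ->
    forall (t : R) (x : 'rV[R]_n),
      0 < t <= Num.min T T0 ->
      enorm x ^+ 2 < Rr ^+ 2 - 2 * k * t ->
      F (Du u x t - phi0 R n) <=
        Num.max (t `^ (q / 2) * expR (A * q * (`|u x t| - 2 * M) ^+ 2 / (4 * t))
                   * (Rr ^+ 2 - 2 * k * t - enorm x ^+ 2) `^ (- r))
                P.
Proof.
move=> _ HF _ _ _ _.
have [c [B [D [c0 B0 D0 bounds]]]] := hess_mx_bounds HF.
exists 1, (F (- phi0 R n) + 1), 1; split; first by [].
split; first by rewrite ltrDl.
split; first by [].
move=> M Rr M0 R0.
pose L := 40 * (M + 1) / c; pose K := 2 * (M + 1) * L.
have M1 : 0 < M + 1 by exact: addr_gt0.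
have L0 : 0 < L by apply: divr_gt0 => //; exact: mulr_gt0.
have K0 : 0 < K by apply: mulr_gt0 => //; exact: mulr_gt0.
pose b (i : 'I_n) := bvec R (lift ord0 i).
pose G := \sum_i (F (b i) + F (- b i)).
have G0 : 0 <= G by apply: sumr_ge0 => i _; apply: addr_ge0; exact: integrand_ge0.
have F0 : 0 <= F (- phi0 R n) by exact: integrand_ge0.
pose W := Rr ^+ 4 * (F (- phi0 R n) + G / L).
have R40 : 0 < Rr ^+ 4 by exact: exprn_gt0.
have GL : 0 <= G / L by apply: divr_ge0 => //; exact: ltW.
have W0 : 0 <= W by apply: mulr_ge0; [exact: ltW|exact: addr_ge0].
(* Then [q M^2 / (8 t)] equals [(2 K + W) / t + M^2 / (4 t)]. The part [2 K / t] matches the growth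
   of the Lipschitz constant, and [W / t >= W] for [t <= 1] absorbs the factor [W <= exp W], which
   collects [Rr^4] and the values of [F]. *)
pose q := 8 * (2 * K + W) / M ^+ 2 + 2.
have q2 : 2 <= q.
  rewrite lerDr; apply: divr_ge0; last exact: sqr_ge0.
  by apply: mulr_ge0 => //; apply: addr_ge0 => //; apply: mulr_ge0 => //; exact: ltW.
exists (Num.min 1 (M ^+ 4 / 64)), q, 2; split.
  by rewrite lt_min ltr01 divr_gt0 // exprn_gt0.
split; first by lra.
split; first by lra.
move=> T u T0 sol uM t x; rewrite !le_min => /andP[t0 /and3P[tT t1 tM]].
rewrite mulr1 => xR; have Rt := ltW T0.
have tTT : 0 <= t <= T by rewrite (ltW t0).
(* A Lipschitz constant valid for all times in [[t/2, t]] below [T], hence [2 * K] in place of [K]: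
   a uniform bound is needed to reach [t = T] as a limit. *)
pose E := t / L * expR (2 * K / t).
have E0 : 0 <= E by apply: mulr_ge0; [apply: divr_ge0; exact: ltW|exact: expR_ge0].
have lip_s s y z : t / 2 <= s -> s <= t -> s < T -> u y s - u z s <= E * enorm (y - z).
  move=> s1 s2 sT; have s0 : 0 < s by lra.
  have sT' : 0 < s < T by rewrite s0.
  apply: le_trans (two_point_bound HF c0 B0 D0 bounds sol M0 uM y z sT') _.
  apply: ler_wpM2r; first exact: enorm_ge0.
  apply: ler_pM; [apply: divr_ge0; exact: ltW|exact: expR_ge0| |].
    by apply: ler_wpM2r => //; rewrite invr_ge0 ltW.
  rewrite ler_expR -/L -/K ler_pdivrMr //.
  have -> : 2 * K / t * s = K * (2 * s / t) by ring.
  rewrite -[leLHS]mulr1; apply: ler_wpM2l; first exact: ltW.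
  by rewrite ler_pdivlMr // mul1r; lra.
have lip y z : u y t - u z t <= E * enorm (y - z).
  have [tltT|Tlet] := ltP t T; first by apply: lip_s => //; lra.
  have tE : t = T by apply/eqP; rewrite eq_le tT.
  apply/ler_addgt0Pr => e e0; have e2 : 0 < e / 2 by rewrite divr_gt0.
  have [d1 d10 H1] := solution_final_time T0 sol y e2.
  have [d2 d20 H2] := solution_final_time T0 sol z e2.
  pose d := Num.min (t / 2) (Num.min d1 d2) / 2.
  have m0 : 0 < Num.min (t / 2) (Num.min d1 d2) by rewrite !lt_min divr_gt0 // d10.
  have mt : Num.min (t / 2) (Num.min d1 d2) <= t / 2 by rewrite ge_min lexx.
  have md1 : Num.min (t / 2) (Num.min d1 d2) <= d1 by rewrite !ge_min lexx orbT.
  have md2 : Num.min (t / 2) (Num.min d1 d2) <= d2 by rewrite !ge_min lexx !orbT.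
  have Hd1 : T - d1 < t - d < T by rewrite -tE /d; lra.
  have Hd2 : T - d2 < t - d < T by rewrite -tE /d; lra.
  have := H1 _ Hd1; have := H2 _ Hd2; rewrite -tE !ltr_norml.
  have := lip_s (t - d) y z; rewrite -tE => /(_ _ _ _)/wrap[]; rewrite /d; lra.
have dub i : `|du u i x t| <= E.
  apply: derive_bound => // h.
  have Eh : enorm (h *: bvec R i) = `|h|.
    have -> : bvec R i = delta_mx 0 i by apply/rowP => j; rewrite !mxE eqxx.
    by rewrite enormZ enorm_delta mulr1.
  have := lip (h *: bvec R i + x) x; have := lip x (h *: bvec R i + x).
  rewrite addrK opprD addrCA subrr addr0 enormN Eh mulrC => l1 l2.
  by rewrite ler_norml; lra.
have FD : F (Du u x t - phi0 R n) <= E * G + F (- phi0 R n).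
  apply: le_trans (integrand_subadd HF _ _) _; rewrite lerD2r.
  exact: integrand_sum.
rewrite le_max; apply/orP; left; apply: le_trans FD _.
have Xq : 0 < Rr ^+ 2 - 2 * t - enorm x ^+ 2 by rewrite subr_gt0.
have Xr : Rr ^+ 2 - 2 * t - enorm x ^+ 2 <= Rr ^+ 2.
  by have := sqr_ge0 (enorm x); lra.
have q0 : 0 <= q by lra.
apply: le_trans (barrier_ge M0 R0 q0 t0 tM (uM x t tTT) Xq Xr).
rewrite ler_pdivlMr //.
have e1 : 1 <= expR (2 * K / t).
  by rewrite -expR0 ler_expR; apply: divr_ge0; [apply: mulr_ge0 => //|]; exact: ltW.
apply: le_trans (_ : W * expR (2 * K / t) <= _).
  rewrite /W mulrC -mulrA; apply: ler_wpM2l; first exact: ltW.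
  have : E * G <= G / L * expR (2 * K / t).
    have -> : E * G = t * (G / L * expR (2 * K / t)) by rewrite /E; ring.
    by rewrite ler_piMl // mulr_ge0 // expR_ge0.
  have : F (- phi0 R n) <= F (- phi0 R n) * expR (2 * K / t) by rewrite ler_peMr.
  rewrite mulrDl; lra.
apply: le_trans (_ : expR W * expR (2 * K / t) <= _).
  apply: ler_wpM2r; first exact: expR_ge0.
  by apply: le_trans (expR_ge1Dx W); lra.
rewrite -expRD ler_expR.
have -> : q * M ^+ 2 / (8 * t) = (2 * K + W) / t + M ^+ 2 / (4 * t).
  by rewrite /q; field; rewrite !gt_eqF.
have Wt : W <= W / t by rewrite ler_pdivlMr // ler_piMr.
have : 0 <= M ^+ 2 / (4 * t) by apply: divr_ge0; [exact: sqr_ge0|apply: mulr_ge0 => //; exact: ltW].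
rewrite mulrDl; lra.
Qed.
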